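(* Let $T>0$, let $\beta\in C^1([0,1])$ with $\beta>0$, and let $\eta_0,u_0$ be constants such that $\beta(x)+\eta_0>0$, $u_0>0$ and $u_0>\sqrt{\beta(x)+\eta_0}$ for $x\in[0,1]$. Let $(\eta,u)$ be the solution, assumed sufficiently smooth, of the initial-boundary-value problem $$\eta_t+u_0\eta_x+(\beta+\eta_0)u_x+(\eta u)_x+(u+u_0)\beta_x=0,\qquad u_t+\eta_x+u_0u_x+uu_x=0,\qquad 0\le x\le1,\ 0\le t\le T,$$ $$\eta(x,0)=\eta^0(x)-\eta_0,\quad u(x,0)=u^0(x)-u_0,\quad 0\le x\le 1,\qquad \eta(0,t)=0,\quad u(0,t)=0,\quad 0\le t\le T,$$ where $\eta^0,u^0$ are given functions on $[0,1]$. Assume that there exist positive constants $a$ and $b$ such that for all $(x,t)\in[0,1]\times[0,T]$ $$\beta+\eta+\eta_0\ge b,\qquad u+u_0\ge 2a,\qquad \beta+\eta+\eta_0\le (u+u_0-a)\left(u+u_0-\tfrac{2a}{3}\right).$$ Let $r\ge3$ be an integer and let $\mathring S_h$ be the finite element space defined in the context, on quasiuniform partitions of $[0,1]$ with maximal mesh length $h$. Then, if $h$ is sufficiently small, the semidiscrete initial-value problem of finding $\eta_h,u_h:[0,T]\to\mathring S_h$ such that for $0\le t\le T$ $$(\eta_{ht},\phi)+(u_0\eta_{hx},\phi)+((\beta+\eta_0)u_{hx},\phi)+((\eta_hu_h)_x,\phi)+((u_h+u_0)\beta_x,\phi)=0\quad\forall\phi\in\mathring S_h,$$ $$(u_{ht},\phi)+(\eta_{hx},\phi)+(u_0u_{hx},\phi)+(u_hu_{hx},\phi)=0\quad\forall\phi\in\mathring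 S_h,$$ $$\eta_h(0)=\mathrm P^0(\eta^0(\cdot)-\eta_0),\qquad u_h(0)=\mathrm P^0(u^0(\cdot)-u_0),$$ has a unique solution $(\eta_h,u_h)$ for $0\le t\le T$, and it satisfies $$\max_{0\le t\le T}\left(\|\eta(t)-\eta_h(t)\|+\|u(t)-u_h(t)\|\right)\le C h^{r-1},$$ where $C$ is a constant independent of $h$.
   Context: $(\cdot,\cdot)$ and $\|\cdot\|$ denote the inner product and norm of $L^2=L^2(0,1)$; $C^m[0,1]$ denotes the $m$ times continuously differentiable functions on $[0,1]$; $\mathbb P_m$ denotes polynomials of degree at most $m$. Let $0=x_1<x_2<\dots<x_{N+1}=1$ be a quasiuniform partition of $[0,1]$ with $h:=\max_i(x_{i+1}-x_i)$ (quasiuniform: $h\le c\,\min_i(x_{i+1}-x_i)$ with a constant $c$ independent of the partition in the family considered). Define $$\mathring S_h=\{\phi\in C^{r-2}[0,1]:\ \phi(0)=0,\ \phi|_{[x_j,x_{j+1}]}\in\mathbb P_{r-1},\ 1\le j\le N\},$$ and let $\mathrm P^0$ be the $L^2$-projection operator onto $\mathring S_h$. ''Sufficiently smooth'' means that the data and the solution $(\eta,u)$ have as many continuous (bounded) derivatives on $[0,1]\times[0,T]$ as required for the error estimation. ''$h$ sufficiently small'' means that there is $h_0>0$ such that the conclusion holds for all partitions in the quasiuniform family with $h\le h_0$, with $C$ the same for all of them. *)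

(* Defs.v *)
From Stdlib Require Import Reals.
From Coquelicot Require Import Coquelicot.
Open Scope R_scope.

(* Derivatives on a closed interval [a,b] use only values on [a,b]: they are
   two-sided in the interior and one-sided at a and b.  For a < b the limit is
   unique; where it does not exist [Derive_on] is a junk value, so every use
   below is accompanied by an [ex_derive_on] or a smoothness hypothesis. *)
Definition is_derive_on (a b : R) (f : R -> R) (x l : R) : Prop :=
  filterlim (fun y => (f y - f x) / (y - x))
            (within (fun y => a <= y <= b) (locally' x)) (locally l).

Definition ex_derive_on (a b : R) (f : R -> R) (x : R) : Prop :=
  exists l, is_derive_on a b f x l.

Definition Derive_on (a b : R) (f : R -> R) (x : R) : R :=
  iota (is_derive_on a b f x).

Fixpoint Cm_on (a b : R) (m : nat) (f : R -> R) : Prop :=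
  continuous_on (fun x => a <= x <= b) f /\
  match m with
  | O => True
  | S k => (forall x, a <= x <= b -> ex_derive_on a b f x) /\
           Cm_on a b k (Derive_on a b f)
  end.

(* Space-time functions are written f x t, with x in [0,1] and t in [0,T]. *)
Definition Dx (f : R -> R -> R) (x t : R) : R :=
  Derive_on 0 1 (fun y => f y t) x.

Definition Dt (T : R) (f : R -> R -> R) (x t : R) : R :=
  Derive_on 0 T (fun s => f x s) t.

(* C^m([0,1] x [0,T]); bounds on the derivatives follow by compactness. *)
Fixpoint Cm_cyl (T : R) (m : nat) (f : R -> R -> R) : Prop :=
  continuous_on (fun p : R * R => 0 <= fst p <= 1 /\ 0 <= snd p <= T)
                (fun p : R * R => f (fst p) (snd p)) /\
  match m with
  | O => True
  | S k =>
      (forall x t, 0 <= x <= 1 -> 0 <= t <= T ->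
         ex_derive_on 0 1 (fun y => f y t) x /\
         ex_derive_on 0 T (fun s => f x s) t) /\
      Cm_cyl T k (Dx f) /\ Cm_cyl T k (Dt T f)
  end.

(* All functions paired below are continuous on [0,1] or agree on (0,1) with
   such a function, so the Riemann integral gives the L^2(0,1) inner product. *)
Definition inner (f g : R -> R) : R := RInt (fun x => f x * g x) 0 1.

Definition L2norm (f : R -> R) : R := sqrt (inner f f).

(* Nodes are numbered x 1, ..., x (N+1); other values of x are irrelevant. *)
Definition partition01 (N : nat) (x : nat -> R) : Prop :=
  x 1%nat = 0 /\ x (N + 1)%nat = 1 /\
  forall j, (1 <= j <= N)%nat -> x j < x (j + 1)%nat.

(* Starting the maximum at 0 is harmless since all gaps are positive. *)
Fixpoint mesh_size (x : nat -> R) (N : nat) : R :=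
  match N with
  | O => 0
  | S k => Rmax (mesh_size x k) (x (N + 1)%nat - x N)
  end.

Definition quasiuniform (c : R) (N : nat) (x : nat -> R) : Prop :=
  forall j, (1 <= j <= N)%nat -> mesh_size x N <= c * (x (j + 1)%nat - x j).

Definition poly_on (a b : R) (m : nat) (f : R -> R) : Prop :=
  exists c : nat -> R,
    forall x, a <= x <= b -> f x = sum_f_R0 (fun i => c i * x ^ i) m.

Definition Sh (r N : nat) (x : nat -> R) (phi : R -> R) : Prop :=
  Cm_on 0 1 (r - 2) phi /\ phi 0 = 0 /\
  forall j, (1 <= j <= N)%nat -> poly_on (x j) (x (j + 1)%nat) (r - 1) phi.

(* p = P^0 f on [0,1]. *)
Definition is_L2_projection (r N : nat) (x : nat -> R) (f p : R -> R) : Prop :=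
  Sh r N x p /\ forall phi, Sh r N x phi -> inner p phi = inner f phi.

Definition solves_ibvp (T : R) (beta : R -> R) (eta0 u0 : R)
  (eta_init u_init : R -> R) (eta u : R -> R -> R) : Prop :=
  (forall x t, 0 <= x <= 1 -> 0 <= t <= T ->
     Dt T eta x t + u0 * Dx eta x t + (beta x + eta0) * Dx u x t
       + Dx (fun y s => eta y s * u y s) x t
       + (u x t + u0) * Derive_on 0 1 beta x = 0 /\
     Dt T u x t + Dx eta x t + u0 * Dx u x t + u x t * Dx u x t = 0) /\
  (forall x, 0 <= x <= 1 ->
     eta x 0 = eta_init x - eta0 /\ u x 0 = u_init x - u0) /\
  (forall t, 0 <= t <= T -> eta 0 t = 0 /\ u 0 t = 0).

(* S_h is finite dimensional, so differentiability of t |-> eta_h(t) as an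
   S_h-valued map is the same as differentiability at each point x. *)
Definition solves_semidiscrete (T : R) (beta : R -> R) (eta0 u0 : R)
  (eta_init u_init : R -> R) (r N : nat) (xs : nat -> R)
  (etah uh : R -> R -> R) : Prop :=
  (forall t, 0 <= t <= T ->
     Sh r N xs (fun x => etah x t) /\ Sh r N xs (fun x => uh x t)) /\
  (forall x t, 0 <= x <= 1 -> 0 <= t <= T ->
     ex_derive_on 0 T (fun s => etah x s) t /\
     ex_derive_on 0 T (fun s => uh x s) t) /\
  (forall t, 0 <= t <= T -> forall phi, Sh r N xs phi ->
     inner (fun x => Dt T etah x t) phi
       + inner (fun x => u0 * Dx etah x t) phi
       + inner (fun x => (beta x + eta0) * Dx uh x t) phi
       + inner (fun x => Dx (fun y s => etah y s * uh y s) x t) phi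
       + inner (fun x => (uh x t + u0) * Derive_on 0 1 beta x) phi = 0 /\
     inner (fun x => Dt T uh x t) phi
       + inner (fun x => Dx etah x t) phi
       + inner (fun x => u0 * Dx uh x t) phi
       + inner (fun x => uh x t * Dx uh x t) phi = 0) /\
  is_L2_projection r N xs (fun x => eta_init x - eta0) (fun x => etah x 0) /\
  is_L2_projection r N xs (fun x => u_init x - u0) (fun x => uh x 0).

(* Main.v *)
Require Import Defs.
From Stdlib Require Import Reals Lra Lia Psatz Classical.
From Coquelicot Require Import Coquelicot.
Open Scope R_scope.

(** Let H, V be the L^2-projections of eta, u on S_h, let th = H - eta_h, xi = V - u_h be the
    discrete errors and rho = eta - H, sg = u - V the projection errors, and put
    w = beta + eta + eta0, U = u + u0.  Testing the error equations with th and with the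
    projection P(w xi) makes the principal part the exact derivative of
    (U th^2 + 2 w th xi + U w xi^2) / 2, which is nonnegative at x = 1 because w <= U^2 there
    and vanishes at x = 0.  Replacing P(w xi) by w xi costs O(h) times |xi| (superapproximation),
    which compensates the factor 1/h of the inverse inequality, so that
    |th|^2 + (w xi, xi), which is 0 at t = 0, grows at most like a Gronwall exponential times
    h^(2(r-1)).  The quadratic terms in (th, xi) are first multiplied by a cutoff which keeps
    the x-derivatives of the errors bounded by 1; the truncated system is globally Lipschitz,
    hence solvable on [0,T], and the error estimate shows, for r >= 3 and small h, that the
    cutoff is never active.

    The properties of S_h that are needed (inverse inequalities, superapproximation, order of
    approximation) come from B-splines, by induction on the degree: derivatives of splines are
    splines of lower degree, and a spline is controlled on each element by its coefficients
    and conversely. *)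

(** * One-sided calculus on an interval *)

(** The linearised system has the matrix with rows (U, w) and (1, U). It is symmetrised by
    multiplying the second equation by w, but w xi does not belong to S_h, and this is why P(w xi)
    and superapproximation enter. The order is h^(r-1) and not h^r because the x-derivatives of rho
    and sg occur in the residuals and are only O(h^(r-1)) in L^2.

    The quadratic nonlinearity prevents a direct global existence proof; truncating first replaces a
    continuation argument on a maximal interval of existence. The radius of the cutoff is
    sqrt(h^3/K), K being the constant in the inverse inequality sup |v'|^2 <= (K/h^3) |v|^2. The
    energy estimate yields C h^(2(r-1)) for the squared discrete error, and for small h this is
    below h^3/K because 2(r-1) >= 4 when r >= 3. Only products of two discrete errors are damped:
    factors coming from the projection errors are bounded in advance.

    Coordinates in an L^2-orthonormal basis of S_h make the mass matrix the identity, so both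
    semidiscrete problems are explicit ODE systems with quadratic right-hand side. *)

Definition clamp (a b x : R) : R := Rmax a (Rmin b x).

Lemma clamp_in a b x : a <= b -> a <= clamp a b x <= b.
Proof.
  intros H; unfold clamp; split.
  - apply Rmax_l.
  - apply Rmax_lub; [exact H | apply Rmin_l].
Qed.

Lemma clamp_id a b x : a <= x <= b -> clamp a b x = x.
Proof.
  intros [H1 H2]; unfold clamp.
  rewrite Rmin_right, Rmax_right; lra.
Qed.

Lemma clamp_lipschitz a b x y : Rabs (clamp a b y - clamp a b x) <= Rabs (y - x).
Proof.
  unfold clamp, Rmax, Rmin.
  repeat destruct Rle_dec; unfold Rabs; repeat destruct Rcase_abs; lra.
Qed.

Lemma continuous_clamp a b x : continuous (clamp a b) x.
Proof.
  apply filterlim_locally; intros eps; exists eps; intros y Hy.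
  change (Rabs (y - x) < eps) in Hy.
  change (Rabs (clamp a b y - clamp a b x) < eps).
  eapply Rle_lt_trans; [apply clamp_lipschitz | exact Hy].
Qed.

(* Continuity on [a,b] as continuity on the line of the constant extension of f. *)
Definition cts (a b : R) (f : R -> R) : Prop :=
  forall x, continuous (fun y => f (clamp a b y)) x.

Lemma cts_of_continuous a b f : a <= b ->
  (forall x, a <= x <= b -> continuous f x) -> cts a b f.
Proof.
  intros Hab H x.
  apply (continuous_comp (clamp a b) f); [apply continuous_clamp |].
  apply H, clamp_in, Hab.
Qed.

Lemma continuous_on_cts a b f : a <= b ->
  continuous_on (fun x => a <= x <= b) f <-> cts a b f.
Proof.
  intros Hab; split; intros H.
  - intros x. unfold continuous.
    eapply filterlim_comp; [| apply (H (clamp a b x)), clamp_in, Hab].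
    intros P [eps HP].
    destruct (continuous_clamp a b x (fun z => ball (clamp a b x) eps z)) as [d Hd].
    { exists eps; auto. }
    exists d; intros y Hy. apply HP; [apply Hd, Hy | apply clamp_in, Hab].
  - intros x Hx P HP.
    generalize (H x); unfold continuous; rewrite clamp_id by exact Hx.
    intros H'; destruct (H' P HP) as [d Hd]; exists d; intros y Hy Hy'.
    generalize (Hd y Hy); rewrite clamp_id by exact Hy'; auto.
Qed.

Lemma cts_ext a b f g : a <= b -> (forall x, a <= x <= b -> f x = g x) ->
  cts a b f -> cts a b g.
Proof.
  intros Hab E H x; eapply continuous_ext; [| apply H].
  intros y; apply E, clamp_in, Hab.
Qed.

Lemma cts_const a b c : cts a b (fun _ => c).
Proof. intros x; apply continuous_const. Qed.

Lemma cts_id a b : cts a b (fun x => x).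
Proof. intros x; apply continuous_clamp. Qed.

Lemma cts_plus a b f g : cts a b f -> cts a b g -> cts a b (fun x => f x + g x).
Proof. intros Hf Hg x; apply (continuous_plus (V := R_NormedModule)); auto. Qed.

Lemma cts_opp a b f : cts a b f -> cts a b (fun x => - f x).
Proof. intros Hf x; apply (continuous_opp (V := R_NormedModule)); auto. Qed.

Lemma cts_minus a b f g : cts a b f -> cts a b g -> cts a b (fun x => f x - g x).
Proof. intros Hf Hg; apply cts_plus; [| apply cts_opp]; auto. Qed.

Lemma cts_mult a b f g : cts a b f -> cts a b g -> cts a b (fun x => f x * g x).
Proof. intros Hf Hg x; apply (continuous_mult (K := R_AbsRing)); auto. Qed.

Lemma cts_pow a b f n : cts a b f -> cts a b (fun x => f x ^ n).
Proof.
  intros H; induction n; simpl; [apply cts_const | apply cts_mult; auto].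
Qed.

Lemma cts_Rabs a b f : cts a b f -> cts a b (fun x => Rabs (f x)).
Proof. intros Hf x; apply continuous_Rabs_comp, Hf. Qed.

#[local] Hint Resolve cts_const cts_id cts_plus cts_opp cts_minus cts_mult cts_pow cts_Rabs : cts.

Lemma cts_sub a b c d f : a <= c -> c <= d -> d <= b -> cts a b f -> cts c d f.
Proof.
  intros H1 H2 H3 H.
  apply continuous_on_cts; [exact H2 |].
  apply (continuous_on_subset (fun x => a <= x <= b)).
  - intros x Hx; lra.
  - apply continuous_on_cts; [lra | exact H].
Qed.

Lemma cts_ex_RInt a b f : a <= b -> cts a b f -> ex_RInt f a b.
Proof.
  intros Hab H.
  apply (ex_RInt_ext (fun y => f (clamp a b y))).
  - intros x; rewrite Rmin_left, Rmax_right by exact Hab; intros Hx.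
    rewrite clamp_id by lra; reflexivity.
  - apply (ex_RInt_continuous (V := R_CompleteNormedModule)); intros; apply H.
Qed.

Lemma cts_bounded a b f : a <= b -> cts a b f ->
  exists M, 0 <= M /\ forall x, a <= x <= b -> Rabs (f x) <= M.
Proof.
  intros Hab H.
  destruct (continuity_ab_maj (fun y => Rabs (f (clamp a b y))) a b Hab) as [m [Hm _]].
  { intros c _. apply continuity_pt_filterlim.
    apply (continuous_Rabs_comp (fun y => f (clamp a b y)) c), H. }
  exists (Rabs (f (clamp a b m))); split; [apply Rabs_pos |].
  intros x Hx. generalize (Hm x Hx); rewrite (clamp_id a b x) by exact Hx; auto.
Qed.

Lemma is_derive_on_eps a b f x l : is_derive_on a b f x l <->
  forall eps : posreal, exists d : posreal, forall y,
    Rabs (y - x) < d -> y <> x -> a <= y <= b ->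
    Rabs ((f y - f x) / (y - x) - l) < eps.
Proof.
  unfold is_derive_on; rewrite filterlim_locally.
  split; intros H eps; destruct (H eps) as [d Hd]; exists d;
    intros y; intros; apply Hd; auto.
Qed.

Lemma is_derive_on_unique a b f x l1 l2 : a < b -> a <= x <= b ->
  is_derive_on a b f x l1 -> is_derive_on a b f x l2 -> l1 = l2.
Proof.
  intros Hab Hx; rewrite !is_derive_on_eps; intros H1 H2.
  destruct (Req_dec l1 l2) as [E | E]; [exact E | exfalso].
  assert (He : 0 < Rabs (l1 - l2) / 2).
  { assert (0 < Rabs (l1 - l2)) by (apply Rabs_pos_lt; lra). lra. }
  destruct (H1 (mkposreal _ He)) as [d1 K1].
  destruct (H2 (mkposreal _ He)) as [d2 K2]; simpl in K1, K2.
  assert (exists y, Rabs (y - x) < d1 /\ Rabs (y - x) < d2 /\ y <> x /\ a <= y <= b)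
    as [y [Y1 [Y2 [Y3 Y4]]]].
  (* The test point is taken towards the farther endpoint, at most half the length away, so that it
     stays in [a,b]. *)
  { set (s := Rmin (Rmin (d1 / 2) (d2 / 2)) ((b - a) / 2)).
    assert (Hs : 0 < s).
    { repeat apply Rmin_pos; destruct d1, d2; simpl; lra. }
    assert (s <= d1 / 2) by (eapply Rle_trans; [apply Rmin_l | apply Rmin_l]).
    assert (s <= d2 / 2) by (eapply Rle_trans; [apply Rmin_l | apply Rmin_r]).
    assert (s <= (b - a) / 2) by apply Rmin_r.
    destruct (Rle_dec x ((a + b) / 2)).
    - exists (x + s); replace (x + s - x) with s by ring.
      rewrite Rabs_right by lra. repeat split; lra.
    - exists (x - s); replace (x - s - x) with (- s) by ring.
      rewrite Rabs_left by lra. repeat split; lra. }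
  specialize (K1 y Y1 Y3 Y4); specialize (K2 y Y2 Y3 Y4).
  revert K1 K2; generalize ((f y - f x) / (y - x)); intros q.
  unfold Rabs; repeat destruct Rcase_abs; lra.
Qed.

Lemma Derive_on_eq a b f x l : a < b -> a <= x <= b ->
  is_derive_on a b f x l -> Derive_on a b f x = l.
Proof.
  intros Hab Hx H; apply (iota_unique (V := R_CompleteNormedModule)).
  - intros y Hy; eapply is_derive_on_unique; eauto.
  - exact H.
Qed.

Lemma Derive_on_correct a b f x : a < b -> a <= x <= b ->
  ex_derive_on a b f x -> is_derive_on a b f x (Derive_on a b f x).
Proof. intros Hab Hx [l Hl]; rewrite (Derive_on_eq a b f x l); auto. Qed.

Lemma is_derive_eps f x l : is_derive f x l <->
  forall eps : posreal, exists d : posreal, forall y,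
    Rabs (y - x) < d -> y <> x ->
    Rabs ((f y - f x) / (y - x) - l) < eps.
Proof.
  rewrite is_derive_Reals; split.
  - intros H eps; destruct (H eps (cond_pos eps)) as [d Hd]; exists d.
    intros y Hy Hyx; specialize (Hd (y - x)).
    replace (x + (y - x)) with y in Hd by ring.
    apply Hd; [lra | exact Hy].
  - intros H eps He; destruct (H (mkposreal _ He)) as [d Hd]; exists d.
    intros k Hk Hkd; specialize (Hd (x + k)).
    replace (x + k - x) with k in Hd by ring. apply Hd; [exact Hkd | lra].
Qed.

(** Outside [a,b] the function is continued by its tangent line at x, which makes the derivative
    two-sided. The calculus rules for [is_derive] are transferred to [is_derive_on] through this
    extension. *)
Lemma is_derive_on_lift a b f x l : a <= x <= b -> is_derive_on a b f x l ->
  exists F, is_derive F x l /\ forall y, a <= y <= b -> F y = f y.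
Proof.
  intros Hx H; rewrite is_derive_on_eps in H.
  exists (fun y => if Rle_dec a y then if Rle_dec y b then f y else f x + l * (y - x)
                   else f x + l * (y - x)).
  split.
  - apply is_derive_eps; intros eps; destruct (H eps) as [d Hd]; exists d.
    intros y Hy Hyx.
    assert (Hlin : Rabs ((f x + l * (y - x) - f x) / (y - x) - l) < eps).
    { replace ((f x + l * (y - x) - f x) / (y - x) - l) with 0 by (field; lra).
      rewrite Rabs_R0; apply cond_pos. }
    destruct (Rle_dec a x) as [_ | ?]; [| lra].
    destruct (Rle_dec x b) as [_ | ?]; [| lra].
    destruct (Rle_dec a y); [destruct (Rle_dec y b) |]; auto.
  - intros y Hy; destruct (Rle_dec a y); [| lra]; destruct (Rle_dec y b); lra.
Qed.

Lemma is_derive_on_of_is_derive a b f F x l :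
  a <= x <= b -> is_derive F x l -> (forall y, a <= y <= b -> F y = f y) ->
  is_derive_on a b f x l.
Proof.
  intros Hx; rewrite is_derive_eps, is_derive_on_eps; intros H E eps.
  destruct (H eps) as [d Hd]; exists d; intros y H1 H2 H3.
  rewrite <- !E by assumption; auto.
Qed.

Lemma is_derive_on_interior a b f x l : a < x < b ->
  is_derive_on a b f x l -> is_derive f x l.
Proof.
  intros Hx H; destruct (is_derive_on_lift a b f x l) as [F [HF E]]; [lra | exact H |].
  apply (is_derive_ext_loc F); [| exact HF].
  assert (He : 0 < Rmin (x - a) (b - x)) by (apply Rmin_pos; lra).
  exists (mkposreal _ He); intros y Hy; change (Rabs (y - x) < Rmin (x - a) (b - x)) in Hy.
  apply E. generalize (Rmin_l (x - a) (b - x)) (Rmin_r (x - a) (b - x)); intros.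
  apply Rabs_def2 in Hy; lra.
Qed.

Lemma is_derive_on_ext a b f g x l : a <= x <= b ->
  (forall y, a <= y <= b -> f y = g y) ->
  is_derive_on a b f x l -> is_derive_on a b g x l.
Proof.
  intros Hx E H; destruct (is_derive_on_lift a b f x l) as [F [HF EF]]; auto.
  apply (is_derive_on_of_is_derive a b g F); auto.
  intros y Hy; rewrite EF, E; auto.
Qed.

Lemma is_derive_on_sub a b c d f x l : a <= c -> d <= b ->
  is_derive_on a b f x l -> is_derive_on c d f x l.
Proof.
  rewrite !is_derive_on_eps; intros H1 H2 H eps.
  destruct (H eps) as [e He]; exists e; intros; apply He; auto; lra.
Qed.

Lemma is_derive_on_plus a b f g x l m : a <= x <= b ->
  is_derive_on a b f x l -> is_derive_on a b g x m ->
  is_derive_on a b (fun y => f y + g y) x (l + m).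
Proof.
  intros Hx Hf Hg.
  destruct (is_derive_on_lift a b f x l) as [F [HF EF]]; auto.
  destruct (is_derive_on_lift a b g x m) as [G [HG EG]]; auto.
  apply (is_derive_on_of_is_derive a b _ (fun y => F y + G y)); auto.
  - apply (is_derive_plus (V := R_NormedModule)); auto.
  - intros y Hy; rewrite EF, EG; auto.
Qed.

Lemma is_derive_on_mult a b f g x l m : a <= x <= b ->
  is_derive_on a b f x l -> is_derive_on a b g x m ->
  is_derive_on a b (fun y => f y * g y) x (l * g x + f x * m).
Proof.
  intros Hx Hf Hg.
  destruct (is_derive_on_lift a b f x l) as [F [HF EF]]; auto.
  destruct (is_derive_on_lift a b g x m) as [G [HG EG]]; auto.
  apply (is_derive_on_of_is_derive a b _ (fun y => F y * G y)); auto.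
  - rewrite <- EF, <- EG by auto.
    apply (is_derive_mult F G x l m); auto. intros; apply Rmult_comm.
  - intros y Hy; rewrite EF, EG; auto.
Qed.

Lemma is_derive_on_const a b c x : a <= x <= b -> is_derive_on a b (fun _ => c) x 0.
Proof.
  intros Hx; apply (is_derive_on_of_is_derive a b _ (fun _ => c)); auto.
  apply (is_derive_const (V := R_NormedModule)).
Qed.

Lemma is_derive_on_scal a b k f x l : a <= x <= b ->
  is_derive_on a b f x l -> is_derive_on a b (fun y => k * f y) x (k * l).
Proof.
  intros Hx Hf; replace (k * l) with (0 * f x + k * l) by ring.
  apply is_derive_on_mult; auto; apply is_derive_on_const; auto.
Qed.

Lemma is_derive_on_opp a b f x l : a <= x <= b ->
  is_derive_on a b f x l -> is_derive_on a b (fun y => - f y) x (- l).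
Proof.
  intros Hx Hf; replace (- l) with ((-1) * l) by ring.
  apply (is_derive_on_ext a b (fun y => (-1) * f y)); auto.
  - intros; ring.
  - apply is_derive_on_scal; auto.
Qed.

Lemma is_derive_on_minus a b f g x l m : a <= x <= b ->
  is_derive_on a b f x l -> is_derive_on a b g x m ->
  is_derive_on a b (fun y => f y - g y) x (l - m).
Proof. intros; apply is_derive_on_plus, is_derive_on_opp; auto. Qed.

Definition dfn (a b : R) (f f' : R -> R) : Prop :=
  forall x, a <= x <= b -> is_derive_on a b f x (f' x).

Lemma dfn_cts a b f f' : a <= b -> dfn a b f f' -> cts a b f.
Proof.
  intros Hab H; apply continuous_on_cts; auto.
  intros x Hx; destruct (is_derive_on_lift a b f x (f' x)) as [F [HF E]]; auto.
  rewrite <- (E x Hx).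
  intros P HP.
  assert (C : continuous F x).
  { apply (ex_derive_continuous (V := R_NormedModule)); exists (f' x); exact HF. }
  destruct (C P HP) as [d Hd]; exists d; intros y Hy Hy'.
  rewrite <- (E y Hy'); apply Hd, Hy.
Qed.

(** The constant extension of f is continuous on the line and has the derivative f' inside (x,y), so
    the usual theorem applies. The closed range of z admits x = y. *)
Lemma dfn_MVT a b f f' x y : dfn a b f f' -> a <= x -> x <= y -> y <= b ->
  exists z, x <= z <= y /\ f y - f x = f' z * (y - x).
Proof.
  intros H H1 H2 H3.
  assert (Hab : a <= b) by lra.
  destruct (MVT_gen (fun z => f (clamp a b z)) x y f') as [z [Hz E]].
  - rewrite Rmin_left, Rmax_right by exact H2; intros z Hz.
    assert (Dz : is_derive f z (f' z)).
    { apply (is_derive_on_interior a b); [lra | apply H; lra]. }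
    apply (is_derive_ext_loc f); [| exact Dz].
    assert (He : 0 < Rmin (z - x) (y - z)) by (apply Rmin_pos; lra).
    exists (mkposreal _ He); intros t Ht.
    change (Rabs (t - z) < Rmin (z - x) (y - z)) in Ht.
    generalize (Rmin_l (z - x) (y - z)) (Rmin_r (z - x) (y - z)); intros.
    apply Rabs_def2 in Ht. rewrite clamp_id; [reflexivity | lra].
  - intros z _; apply continuity_pt_filterlim, (dfn_cts a b f f' Hab H).
  - rewrite Rmin_left, Rmax_right in Hz by exact H2.
    rewrite !clamp_id in E by lra. exists z; auto.
Qed.

(** The difference of f and the integral of the constant extension of f' has derivative zero on
    [a,b], hence is constant by [dfn_MVT]. *)
Lemma dfn_FTC a b f f' x y : dfn a b f f' -> cts a b f' ->
  a <= x -> x <= y -> y <= b -> is_RInt f' x y (f y - f x).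
Proof.
  intros H C H1 H2 H3.
  assert (Hab : a <= b) by lra.
  set (g := fun z => f' (clamp a b z)).
  set (G := fun z => RInt g a z).
  assert (DG : forall z, is_derive G z (g z)).
  { intros z; apply (is_derive_RInt g G a z).
    - apply filter_forall; intros t; apply (RInt_correct (V := R_CompleteNormedModule)).
      apply (ex_RInt_continuous (V := R_CompleteNormedModule)); intros; apply C.
    - apply C. }
  assert (D : dfn a b (fun z => f z - G z) (fun z => f' z - f' z)).
  { intros z Hz; apply is_derive_on_minus; auto.
    apply (is_derive_on_of_is_derive a b G G); auto.
    replace (f' z) with (g z) by (unfold g; rewrite clamp_id; auto); apply DG. }
  destruct (dfn_MVT a b _ _ x y D H1 H2 H3) as [z [_ E]].
  replace (f y - f x) with (minus (G y) (G x)).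
  2:{ unfold minus, plus, opp; simpl. lra. }
  apply (is_RInt_ext g).
  - rewrite Rmin_left, Rmax_right by exact H2; intros t Ht.
    unfold g; rewrite clamp_id; auto; lra.
  - apply (is_RInt_derive G g); intros; [apply DG | apply C].
Qed.

Lemma dfn_nonincreasing a b f f' : dfn a b f f' ->
  (forall x, a <= x <= b -> f' x <= 0) ->
  forall x, a <= x <= b -> f x <= f a.
Proof.
  intros H N x Hx.
  destruct (dfn_MVT a b f f' a x H) as [z [Hz E]]; try lra.
  assert (f' z <= 0) by (apply N; lra). nra.
Qed.

(** The function (E + eps/C) exp(-C t) has nonpositive derivative. *)
Lemma gronwall T E E' C eps : 0 < C -> dfn 0 T E E' ->
  (forall t, 0 <= t <= T -> E' t <= C * E t + eps) ->
  forall t, 0 <= t <= T -> E t <= (E 0 + eps / C) * exp (C * t) - eps / C.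
Proof.
  intros HC H N t Ht.
  assert (D : dfn 0 T (fun s => (E s + eps / C) * exp (- C * s))
     (fun s => (E' s + 0) * exp (- C * s) + (E s + eps / C) * (- C * exp (- C * s)))).
  { intros s Hs.
    apply (is_derive_on_mult 0 T (fun s => E s + eps / C) (fun s => exp (- C * s))); auto.
    - apply is_derive_on_plus; [exact Hs | apply H, Hs | apply is_derive_on_const, Hs].
    - apply (is_derive_on_of_is_derive 0 T _ (fun s => exp (- C * s))); auto.
      auto_derive; [auto | ring]. }
  assert (K := dfn_nonincreasing _ _ _ _ D); simpl in K.
  assert (L : (E t + eps / C) * exp (- C * t) <= (E 0 + eps / C) * exp (- C * 0)).
  { apply K; auto. intros s Hs.
    assert (0 < exp (- C * s)) by apply exp_pos.
    specialize (N s Hs).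
    replace ((E' s + 0) * exp (- C * s) + (E s + eps / C) * (- C * exp (- C * s)))
      with ((E' s - (C * E s + eps)) * exp (- C * s)) by (field; lra).
    nra. }
  rewrite Rmult_0_r, exp_0, Rmult_1_r in L.
  assert (0 < exp (C * t)) by apply exp_pos.
  apply Rmult_le_compat_r with (r := exp (C * t)) in L; [| lra].
  rewrite Rmult_assoc, <- exp_plus in L.
  replace (- C * t + C * t) with 0 in L by ring.
  rewrite exp_0 in L; lra.
Qed.

(** * Finite sums and the inner product *)

Fixpoint sumn (n : nat) (f : nat -> R) : R :=
  match n with O => 0 | S k => sumn k f + f k end.

Lemma sumn_ext n f g : (forall i, (i < n)%nat -> f i = g i) -> sumn n f = sumn n g.
Proof.
  intros H; induction n; simpl; [reflexivity |].
  rewrite IHn, H by (intros; try apply H; lia); reflexivity.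
Qed.

Lemma sumn_plus n f g : sumn n (fun i => f i + g i) = sumn n f + sumn n g.
Proof. induction n; simpl; [ring | rewrite IHn; ring]. Qed.

Lemma sumn_minus n f g : sumn n (fun i => f i - g i) = sumn n f - sumn n g.
Proof. induction n; simpl; [ring | rewrite IHn; ring]. Qed.

Lemma sumn_scal n k f : sumn n (fun i => k * f i) = k * sumn n f.
Proof. induction n; simpl; [ring | rewrite IHn; ring]. Qed.

Lemma sumn_scal_r n k f : sumn n (fun i => f i * k) = sumn n f * k.
Proof. induction n; simpl; [ring | rewrite IHn; ring]. Qed.

Lemma sumn_zero n f : (forall i, (i < n)%nat -> f i = 0) -> sumn n f = 0.
Proof.
  intros H; induction n; simpl; [reflexivity |].
  rewrite IHn, H by (intros; try apply H; lia); ring.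
Qed.

Lemma sumn_const n k : sumn n (fun _ => k) = INR n * k.
Proof. induction n; [simpl; ring | simpl sumn; rewrite IHn, S_INR; ring]. Qed.

Lemma sumn_le n f g : (forall i, (i < n)%nat -> f i <= g i) -> sumn n f <= sumn n g.
Proof.
  intros H; induction n; simpl; [lra |].
  apply Rplus_le_compat; [apply IHn; intros; apply H; lia | apply H; lia].
Qed.

Lemma sumn_nonneg n f : (forall i, (i < n)%nat -> 0 <= f i) -> 0 <= sumn n f.
Proof.
  intros H; rewrite <- (sumn_zero n (fun _ => 0)) by auto; apply sumn_le, H.
Qed.

Lemma sumn_term_le n f i : (forall j, (j < n)%nat -> 0 <= f j) -> (i < n)%nat ->
  f i <= sumn n f.
Proof.
  intros H; induction n; intros Hi; [lia |]; simpl.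
  assert (0 <= sumn n f) by (apply sumn_nonneg; intros; apply H; lia).
  assert (0 <= f n) by (apply H; lia).
  destruct (Nat.eq_dec i n) as [-> | Hin]; [lra |].
  assert (f i <= sumn n f) by (apply IHn; [intros; apply H |]; lia). lra.
Qed.

Lemma sumn_Rabs n f : Rabs (sumn n f) <= sumn n (fun i => Rabs (f i)).
Proof.
  induction n; simpl; [rewrite Rabs_R0; lra |].
  eapply Rle_trans; [apply Rabs_triang | lra].
Qed.

Lemma sumn_swap n m f :
  sumn n (fun i => sumn m (fun j => f i j)) = sumn m (fun j => sumn n (fun i => f i j)).
Proof.
  induction n; simpl.
  - symmetry; apply sumn_zero; auto.
  - rewrite IHn, <- sumn_plus; reflexivity.
Qed.

Lemma sumn_split n m f : sumn (n + m) f = sumn n f + sumn m (fun i => f (n + i)%nat).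
Proof.
  induction m; simpl; [rewrite Nat.add_0_r; ring |].
  rewrite Nat.add_succ_r; simpl; rewrite IHm; ring.
Qed.

Lemma sumn_shift n f : sumn (S n) f = f O + sumn n (fun i => f (S i)).
Proof. induction n; simpl in *; [ring | rewrite IHn; ring]. Qed.

Lemma sumn_delta n k f : (k < n)%nat ->
  sumn n (fun i => f i * (if Nat.eq_dec i k then 1 else 0)) = f k.
Proof.
  induction n; intros Hk; [lia |]; simpl.
  destruct (Nat.eq_dec n k) as [-> | Hn].
  - rewrite sumn_zero; [ring |].
    intros i Hi; destruct (Nat.eq_dec i k); [lia | ring].
  - rewrite IHn by lia; ring.
Qed.

Lemma sumn_CS n f g :
  sumn n (fun i => f i * g i) ^ 2 <= sumn n (fun i => f i ^ 2) * sumn n (fun i => g i ^ 2).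
Proof.
  induction n; [simpl; lra |].
  assert (P1 : 0 <= sumn n (fun i => f i ^ 2)) by (apply sumn_nonneg; intros; apply pow2_ge_0).
  assert (P2 : 0 <= sumn n (fun i => g i ^ 2)) by (apply sumn_nonneg; intros; apply pow2_ge_0).
  cbn [sumn]. set (A := sumn n (fun i => f i ^ 2)) in *.
  set (B := sumn n (fun i => g i ^ 2)) in *. set (D := sumn n (fun i => f i * g i)) in *.
  (* Arithmetic-geometric mean: the square of the left side is at most 4 (A g^2)(B f^2) by the
     induction hypothesis D^2 <= A B. *)
  assert (K : 2 * D * (f n * g n) <= A * g n ^ 2 + B * f n ^ 2).
  { assert (sq : (2 * D * (f n * g n)) ^ 2 <= (A * g n ^ 2 + B * f n ^ 2) ^ 2).
    { assert (D ^ 2 * (f n * g n) ^ 2 <= A * B * (f n * g n) ^ 2)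
        by (apply Rmult_le_compat_r; [apply pow2_ge_0 | auto]).
      assert (0 <= (A * g n ^ 2 - B * f n ^ 2) ^ 2) by apply pow2_ge_0. nra. }
    assert (0 <= A * g n ^ 2 + B * f n ^ 2).
    { apply Rplus_le_le_0_compat; apply Rmult_le_pos; auto; apply pow2_ge_0. }
    apply Rsqr_incr_0_var; [unfold Rsqr; nra | auto]. }
  lra.
Qed.

Lemma sumn_triangle_sqrt n f g :
  sqrt (sumn n (fun i => (f i + g i) ^ 2)) <=
  sqrt (sumn n (fun i => f i ^ 2)) + sqrt (sumn n (fun i => g i ^ 2)).
Proof.
  assert (P1 : 0 <= sumn n (fun i => f i ^ 2)) by (apply sumn_nonneg; intros; apply pow2_ge_0).
  assert (P2 : 0 <= sumn n (fun i => g i ^ 2)) by (apply sumn_nonneg; intros; apply pow2_ge_0).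
  set (p := sqrt (sumn n (fun i => f i ^ 2))). set (q := sqrt (sumn n (fun i => g i ^ 2))).
  assert (Hp : 0 <= p) by apply sqrt_pos. assert (Hq : 0 <= q) by apply sqrt_pos.
  assert (Ep : p * p = sumn n (fun i => f i ^ 2)) by (apply sqrt_sqrt, P1).
  assert (Eq : q * q = sumn n (fun i => g i ^ 2)) by (apply sqrt_sqrt, P2).
  rewrite <- (sqrt_square (p + q)) by lra. apply sqrt_le_1_alt.
  rewrite (sumn_ext _ _ (fun i => (f i ^ 2 + g i ^ 2) + 2 * (f i * g i))) by (intros; ring).
  rewrite !sumn_plus, sumn_scal.
  assert (K := sumn_CS n f g). rewrite <- Ep, <- Eq in K.
  assert (sumn n (fun i => f i * g i) <= p * q).
  { apply Rsqr_incr_0_var; [unfold Rsqr; nra | nra]. }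
  nra.
Qed.

Lemma cts_sumn a b n f : (forall i, (i < n)%nat -> cts a b (f i)) ->
  cts a b (fun x => sumn n (fun i => f i x)).
Proof.
  intros H; induction n; simpl; [apply cts_const |].
  apply cts_plus; [apply IHn; intros |]; apply H; lia.
Qed.

Lemma is_derive_on_sumn a b n f f' x : a <= x <= b ->
  (forall i, (i < n)%nat -> is_derive_on a b (f i) x (f' i)) ->
  is_derive_on a b (fun y => sumn n (fun i => f i y)) x (sumn n f').
Proof.
  intros Hx H; induction n; simpl.
  - apply is_derive_on_const, Hx.
  - apply is_derive_on_plus; auto; apply IHn; intros; apply H; lia.
Qed.

Definition comb (n : nat) (a : nat -> R) (f : nat -> R -> R) (x : R) : R :=
  sumn n (fun i => a i * f i x).

Lemma cts_comb p q n a f : (forall i, (i < n)%nat -> cts p q (f i)) -> cts p q (comb n a f).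
Proof. intros H; apply cts_sumn; intros; apply cts_mult; auto with cts. Qed.

Lemma dfn_comb p q n a f f' : (forall i, (i < n)%nat -> dfn p q (f i) (f' i)) ->
  dfn p q (comb n a f) (comb n a f').
Proof.
  intros H x Hx; apply is_derive_on_sumn; auto.
  intros i Hi; apply is_derive_on_scal; auto; apply H; auto.
Qed.

Lemma RInt_cts_plus a b f g : a <= b -> cts a b f -> cts a b g ->
  RInt (fun x => f x + g x) a b = RInt f a b + RInt g a b.
Proof.
  intros; apply (RInt_plus (V := R_CompleteNormedModule)); apply cts_ex_RInt; auto.
Qed.

Lemma RInt_cts_scal a b k f : a <= b -> cts a b f ->
  RInt (fun x => k * f x) a b = k * RInt f a b.
Proof.
  intros; apply (RInt_scal (V := R_CompleteNormedModule)); apply cts_ex_RInt; auto.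
Qed.

Lemma RInt_cts_minus a b f g : a <= b -> cts a b f -> cts a b g ->
  RInt (fun x => f x - g x) a b = RInt f a b - RInt g a b.
Proof.
  intros; apply (RInt_minus (V := R_CompleteNormedModule)); apply cts_ex_RInt; auto.
Qed.

Lemma RInt_on_ext a b (f g : R -> R) : a <= b -> (forall x, a < x < b -> f x = g x) ->
  RInt f a b = RInt g a b.
Proof.
  intros Hab H; apply RInt_ext.
  rewrite Rmin_left, Rmax_right by exact Hab; exact H.
Qed.

Lemma RInt_cts_le a b f g : a <= b -> cts a b f -> cts a b g ->
  (forall x, a <= x <= b -> f x <= g x) -> RInt f a b <= RInt g a b.
Proof.
  intros; apply RInt_le; auto using cts_ex_RInt. intros; auto with real.
  apply H2; lra.
Qed.

Lemma RInt_const_R a b (k : R) : RInt (fun _ => k) a b = k * (b - a).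
Proof. rewrite RInt_const; simpl; unfold scal; simpl; unfold mult; simpl; ring. Qed.

Lemma RInt_const_len a b (k l : R) : b - a = l -> RInt (fun _ => k) a b = k * l.
Proof. intros <-; apply RInt_const_R. Qed.

Lemma RInt_cts_nonneg a b f : a <= b -> cts a b f ->
  (forall x, a <= x <= b -> 0 <= f x) -> 0 <= RInt f a b.
Proof.
  intros Hab C H. replace 0 with (RInt (fun _ => 0) a b).
  - apply RInt_cts_le; auto with cts.
  - rewrite RInt_const_R; apply Rmult_0_l.
Qed.

Lemma RInt_cts_Rabs a b f : a <= b -> cts a b f ->
  Rabs (RInt f a b) <= RInt (fun x => Rabs (f x)) a b.
Proof.
  intros Hab C; apply abs_RInt_le; auto using cts_ex_RInt.
Qed.

Lemma RInt_cts_Chasles a b c f : a <= b -> b <= c -> cts a c f ->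
  RInt f a b + RInt f b c = RInt f a c.
Proof.
  intros H1 H2 C; apply (RInt_Chasles (V := R_CompleteNormedModule));
    apply cts_ex_RInt; auto; apply (cts_sub a c); auto; lra.
Qed.

Lemma RInt_cts_sumn a b n f : a <= b -> (forall i, (i < n)%nat -> cts a b (f i)) ->
  RInt (fun x => sumn n (fun i => f i x)) a b = sumn n (fun i => RInt (f i) a b).
Proof.
  intros Hab H; induction n; simpl.
  - rewrite RInt_const_R; apply Rmult_0_l.
  - assert (H' : forall i, (i < n)%nat -> cts a b (f i)) by (intros; apply H; lia).
    rewrite RInt_cts_plus; auto using cts_sumn. rewrite IHn; auto.
Qed.

Lemma RInt_cts_pos a b f y : a < b -> cts a b f ->
  (forall x, a <= x <= b -> 0 <= f x) -> a <= y <= b -> 0 < f y -> 0 < RInt f a b.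
Proof.
  intros Hab C N Hy P.
  assert (Hd : exists d : posreal, forall x, Rabs (x - y) < d -> a <= x <= b -> f y / 2 < f x).
  { assert (He : 0 < f y / 2) by lra.
    assert (K := C y). apply filterlim_locally with (eps := mkposreal _ He) in K.
    destruct K as [d K]; exists d; intros x Hx Hx'.
    specialize (K x Hx). change (Rabs (f (clamp a b x) - f (clamp a b y)) < f y / 2) in K.
    rewrite !clamp_id in K by auto. apply Rabs_def2 in K; lra. }
  destruct Hd as [d Hd].
  set (s := Rmin (d / 2) ((b - a) / 2)).
  assert (Hs : 0 < s) by (apply Rmin_pos; [destruct d; simpl |]; lra).
  assert (Hsd : s <= d / 2) by apply Rmin_l. assert (Hsb : s <= (b - a) / 2) by apply Rmin_r.
  (* If y is in the left half the interval [p,q] extends to the right of y, otherwise to the left;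
     thus it never leaves [a,b]. *)
  assert (Hpq : exists p q, a <= p /\ p < q /\ q <= b /\ forall x, p <= x <= q -> Rabs (x - y) < d).
  { assert (0 < d) by apply cond_pos.
    destruct (Rle_dec y ((a + b) / 2)).
    - exists y, (y + s); repeat split; try lra. intros x Hx; apply Rabs_def1; lra.
    - exists (y - s), y; repeat split; try lra. intros x Hx; apply Rabs_def1; lra. }
  destruct Hpq as [p [q [H1 [H2 [H3 H4]]]]].
  rewrite <- (RInt_cts_Chasles a p b), <- (RInt_cts_Chasles p q b); try lra; auto.
  2:{ apply (cts_sub a b); auto; lra. }
  assert (0 <= RInt f a p).
  { apply RInt_cts_nonneg; auto; [apply (cts_sub a b); auto; lra | intros; apply N; lra]. }
  assert (0 <= RInt f q b).
  { apply RInt_cts_nonneg; auto; [apply (cts_sub a b); auto; lra | intros; apply N; lra]. }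
  assert (RInt (fun _ => f y / 2) p q <= RInt f p q).
  { apply RInt_cts_le; [lra | auto with cts | apply (cts_sub a b); auto; lra |].
    intros x Hx; left; apply Hd; [auto | lra]. }
  rewrite RInt_const_R in *. assert (0 < f y / 2 * (q - p)) by nra. lra.
Qed.

Lemma inner_cts_sym f g : inner f g = inner g f.
Proof. apply RInt_on_ext; [lra | intros; apply Rmult_comm]. Qed.

Lemma inner_ext f g f' g' : (forall x, 0 <= x <= 1 -> f x = f' x) ->
  (forall x, 0 <= x <= 1 -> g x = g' x) -> inner f g = inner f' g'.
Proof.
  intros H1 H2; apply RInt_on_ext; [lra |].
  intros x Hx; rewrite H1, H2 by lra; reflexivity.
Qed.

Lemma inner_plus_l f g h : cts 0 1 f -> cts 0 1 g -> cts 0 1 h ->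
  inner (fun x => f x + g x) h = inner f h + inner g h.
Proof.
  intros; unfold inner; rewrite <- RInt_cts_plus; auto with cts; [| lra].
  apply RInt_on_ext; [lra | intros; ring].
Qed.

Lemma inner_minus_l f g h : cts 0 1 f -> cts 0 1 g -> cts 0 1 h ->
  inner (fun x => f x - g x) h = inner f h - inner g h.
Proof.
  intros; unfold inner; rewrite <- RInt_cts_minus; auto with cts; [| lra].
  apply RInt_on_ext; [lra | intros; ring].
Qed.

Lemma inner_scal_l k f h : cts 0 1 f -> cts 0 1 h ->
  inner (fun x => k * f x) h = k * inner f h.
Proof.
  intros; unfold inner; rewrite <- RInt_cts_scal; auto with cts; [| lra].
  apply RInt_on_ext; [lra | intros; ring].
Qed.

Lemma inner_comb_l n a f h : (forall i, (i < n)%nat -> cts 0 1 (f i)) -> cts 0 1 h ->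
  inner (comb n a f) h = sumn n (fun i => a i * inner (f i) h).
Proof.
  intros Hf Hh; unfold inner, comb.
  rewrite (RInt_on_ext 0 1 _ (fun x => sumn n (fun i => a i * (f i x * h x)))); [| lra |].
  - rewrite RInt_cts_sumn; [| lra | auto with cts].
    apply sumn_ext; intros; rewrite RInt_cts_scal; auto with cts; lra.
  - intros x _; rewrite <- sumn_scal_r; apply sumn_ext; intros; simpl; ring.
Qed.

Lemma inner_comb_r n a f h : (forall i, (i < n)%nat -> cts 0 1 (f i)) -> cts 0 1 h ->
  inner h (comb n a f) = sumn n (fun i => a i * inner h (f i)).
Proof.
  intros Hf Hh; rewrite inner_cts_sym, inner_comb_l by auto.
  apply sumn_ext; intros; rewrite inner_cts_sym; reflexivity.
Qed.

Lemma inner_nonneg f : cts 0 1 f -> 0 <= inner f f.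
Proof.
  intros; apply RInt_cts_nonneg; auto with cts; [lra |]. intros; nra.
Qed.

Lemma inner_young f g : cts 0 1 f -> cts 0 1 g -> 2 * inner f g <= inner f f + inner g g.
Proof.
  intros Cf Cg.
  assert (0 <= inner (fun x => f x - g x) (fun x => f x - g x)) by (apply inner_nonneg; auto with cts).
  rewrite inner_minus_l in H by auto with cts.
  rewrite (inner_cts_sym f), (inner_cts_sym g), !inner_minus_l in H by auto with cts.
  rewrite (inner_cts_sym g f) in H; lra.
Qed.

Lemma inner_add_sq f g : cts 0 1 f -> cts 0 1 g ->
  inner (fun x => f x + g x) (fun x => f x + g x) = inner f f + 2 * inner f g + inner g g.
Proof.
  intros Cf Cg. rewrite inner_plus_l by auto with cts.
  rewrite (inner_cts_sym f), (inner_cts_sym g), !inner_plus_l by auto with cts.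
  rewrite (inner_cts_sym g f); ring.
Qed.

Lemma inner_sum_sq f g : cts 0 1 f -> cts 0 1 g ->
  inner (fun x => f x + g x) (fun x => f x + g x) <= 2 * inner f f + 2 * inner g g.
Proof.
  intros Cf Cg. assert (K := inner_young f g Cf Cg). rewrite inner_add_sq by auto. lra.
Qed.

(** * Inverse inequalities for polynomials *)

(** Horner form: inductions on the degree peel off one factor x, and division by x - y in
    [Pol_factor] needs no manipulation of coefficients. *)
Fixpoint Pol (m : nat) (p : R -> R) : Prop :=
  match m with
  | O => exists c, forall x, p x = c
  | S k => exists c q, Pol k q /\ forall x, p x = c + x * q x
  end.

Lemma Pol_ext m p q : (forall x, p x = q x) -> Pol m p -> Pol m q.
Proof.
  intros E; destruct m; simpl.
  - intros [c H]; exists c; intros; rewrite <- E; auto.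
  - intros [c [r [H1 H2]]]; exists c, r; split; auto; intros; rewrite <- E; auto.
Qed.

Lemma Pol_const m c : Pol m (fun _ => c).
Proof.
  revert c; induction m; intros c; simpl; [exists c; auto |].
  exists c, (fun _ => 0); split; auto; intros; ring.
Qed.

Lemma Pol_plus m p q : Pol m p -> Pol m q -> Pol m (fun x => p x + q x).
Proof.
  revert p q; induction m; simpl; intros p q.
  - intros [c H] [c' H']; exists (c + c'); intros; rewrite H, H'; auto.
  - intros [c [r [H1 H2]]] [c' [r' [H1' H2']]].
    exists (c + c'), (fun x => r x + r' x); split; auto.
    intros; rewrite H2, H2'; ring.
Qed.

Lemma Pol_scal m k p : Pol m p -> Pol m (fun x => k * p x).
Proof.
  revert p; induction m; simpl; intros p.
  - intros [c H]; exists (k * c); intros; rewrite H; auto.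
  - intros [c [r [H1 H2]]]; exists (k * c), (fun x => k * r x); split; auto.
    intros; rewrite H2; ring.
Qed.

Lemma Pol_S m p : Pol m p -> Pol (S m) p.
Proof.
  revert p; induction m; intros p.
  - intros [c H]; exists c, (fun _ => 0); split; [exists 0; auto |].
    intros; rewrite H; ring.
  - intros [c [r [H1 H2]]]; exists c, r; split; auto.
Qed.

Lemma Pol_mul_affine m p a b : Pol m p -> Pol (S m) (fun x => (a * x + b) * p x).
Proof.
  intros H; apply (Pol_ext _ (fun x => x * (a * p x) + b * p x)); [intros; ring |].
  apply Pol_plus; [| apply Pol_S, Pol_scal, H].
  exists 0, (fun x => a * p x); split; [apply Pol_scal, H | intros; ring].
Qed.

Lemma poly_on_Pol a b m f : poly_on a b m f <->
  exists p, Pol m p /\ forall x, a <= x <= b -> f x = p x.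
Proof.
  split.
  - intros [c H]; exists (fun x => sum_f_R0 (fun i => c i * x ^ i) m); split; auto.
    clear H; revert c; induction m; intros c; [exists (c O); intros; simpl; ring |].
    exists (c O), (fun x => sum_f_R0 (fun i => c (S i) * x ^ i) m); split.
    + apply (IHm (fun i => c (S i))).
    + intros x; rewrite decomp_sum by lia; simpl pred.
      rewrite scal_sum; simpl pow; rewrite Rmult_1_r; f_equal.
      apply sum_eq; intros; simpl; ring.
  - intros [p [H E]].
    assert (K : exists c, forall x, p x = sum_f_R0 (fun i => c i * x ^ i) m).
    { clear E; revert p H; induction m; simpl; intros p.
      - intros [c H]; exists (fun _ => c); intros; rewrite H; ring.
      - intros [c [q [H1 H2]]]; destruct (IHm q H1) as [c' Hc'].
        exists (fun i => match i with O => c | S j => c' j end); intros x.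
        change (p x = sum_f_R0 (fun i => match i with O => c | S j => c' j end * x ^ i) (S m)).
        rewrite decomp_sum by lia; simpl pred; rewrite H2, Hc', scal_sum.
        simpl pow; rewrite Rmult_1_r; f_equal. apply sum_eq; intros; simpl; ring. }
    destruct K as [c Hc]; exists c; intros; rewrite E by auto; apply Hc.
Qed.

Lemma Pol_derive m p : Pol (S m) p ->
  exists p', Pol m p' /\ forall x, is_derive p x (p' x).
Proof.
  revert p; induction m; intros p [c [q [Hq E]]].
  - destruct Hq as [k Hk]; exists (fun _ => k); split; [exists k; auto |].
    intros x; apply (is_derive_ext (fun x => c + x * k)); [intros; rewrite E, Hk; auto |].
    auto_derive; auto; ring.
  - destruct (IHm q Hq) as [q' [Hq' D]]; exists (fun x => q x + x * q' x); split.
    + apply Pol_plus; auto. exists 0, q'; split; auto; intros; ring.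
    + intros x; apply (is_derive_ext (fun x => c + x * q x)); [intros; rewrite E; auto |].
      auto_derive; [exists (q' x); apply D |].
      replace (Derive _ x) with (q' x) by (symmetry; apply is_derive_unique, D); ring.
Qed.

Lemma Pol_continuous m p x : Pol m p -> continuous p x.
Proof.
  intros H; apply Pol_S in H; destruct (Pol_derive m p H) as [p' [_ D]].
  apply (ex_derive_continuous (V := R_NormedModule)); exists (p' x); apply D.
Qed.

Lemma Pol_cts m p a b : Pol m p -> cts a b p.
Proof.
  intros H x; apply (continuous_comp (clamp a b) p); [apply continuous_clamp |].
  apply (Pol_continuous m), H.
Qed.

Lemma Pol_factor m p y : Pol (S m) p ->
  exists q, Pol m q /\ forall x, p x = p y + (x - y) * q x.
Proof.
  revert p; induction m; intros p [c [q [Hq E]]].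
  - destruct Hq as [k Hk]; exists (fun _ => k); split; [exists k; auto |].
    intros x; rewrite !E, !Hk; ring.
  - destruct (IHm q Hq) as [r [Hr Er]]; exists (fun x => q x + y * r x); split.
    + apply Pol_plus; auto; apply Pol_S, Pol_scal, Hr.
    + intros x; rewrite !E, (Er x); ring.
Qed.

(* Write p(x) = p(y) + (x-y) q(x), with y a minimum point of p^2 on the first third of the
   interval, and apply the induction hypothesis to q on the last third, where |x-y| is
   bounded below. *)
Lemma Pol_sup_L2 m : forall r, 0 <= r -> exists K, 0 < K /\
  forall p al be x, Pol m p -> al < be -> Rabs (x - al) <= r * (be - al) ->
    p x ^ 2 <= K / (be - al) * RInt (fun z => p z ^ 2) al be.
Proof.
  induction m; intros r Hr.
  - exists 1; split; [lra |]; intros p al be x [c Hc] Hab _.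
    rewrite (RInt_on_ext al be _ (fun _ => c ^ 2)); [| lra | intros; rewrite Hc; auto].
    rewrite RInt_const_R, Hc. right; field; lra.
  (* The induction hypothesis is used on the last third, of length d/3, from whose left end x is at
     distance at most r d + 2d/3 <= 3 (r+1) (d/3). This change of base interval is the reason why x
     may lie outside [al,be] in the statement. *)
  - destruct (IHm (3 * (r + 1))) as [K [HK IH]]; [lra |].
    (* The value is bounded by p(x)^2 <= 2 p(y)^2 + 2 (x-y)^2 q(x)^2, where p(y)^2 <= 3 J/d, (x-y)^2
       <= (r+1)^2 d^2 and q(x)^2 <= 108 K J/d^3, with J the integral of p^2. *)
    exists (6 + 216 * (r + 1) ^ 2 * K); split; [nra |].
    intros p al be x Hp Hab Hx.
    set (d := be - al) in *. assert (Hd : 0 < d) by (unfold d; lra).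
    assert (exists J : R, J = RInt (fun z => p z ^ 2) al be) as [J EJ] by eauto.
    rewrite <- EJ.
    assert (Cp : forall u v, cts u v (fun z => p z ^ 2)).
    { intros; apply cts_pow, (Pol_cts (S m)), Hp. }
    assert (Np : forall z, 0 <= p z ^ 2) by (intros; apply pow2_ge_0).
    destruct (continuity_ab_min (fun z => p z ^ 2) al (al + d / 3)) as [y [Hmin Hy]]; [lra | |].
    { intros c _; apply continuity_pt_filterlim.
      apply (continuous_mult (K := R_AbsRing) p (fun z => p z * 1));
        [| apply (continuous_mult (K := R_AbsRing) p (fun z => 1)); [| apply continuous_const]];
        apply (Pol_continuous (S m)), Hp. }
    assert (Hsplit : RInt (fun z => p z ^ 2) al (al + d / 3)
              + (RInt (fun z => p z ^ 2) (al + d / 3) (al + 2 * d / 3)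
              + RInt (fun z => p z ^ 2) (al + 2 * d / 3) be) = J).
    { rewrite EJ, RInt_cts_Chasles, RInt_cts_Chasles; auto; unfold d; lra. }
    assert (J2 : 0 <= RInt (fun z => p z ^ 2) (al + d / 3) (al + 2 * d / 3))
      by (apply RInt_cts_nonneg; auto; lra).
    assert (J3 : 0 <= RInt (fun z => p z ^ 2) (al + 2 * d / 3) be)
      by (apply RInt_cts_nonneg; auto; unfold d; lra).
    assert (J1 : p y ^ 2 * (d / 3) <= RInt (fun z => p z ^ 2) al (al + d / 3)).
    { replace (p y ^ 2 * (d / 3)) with (RInt (fun _ => p y ^ 2) al (al + d / 3))
        by (apply RInt_const_len; field).
      apply RInt_cts_le; auto with cts; lra. }
    assert (J0 : 0 <= J) by (specialize (Np y); nra).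
    assert (Hpy : p y ^ 2 <= 3 / d * J).
    { apply (Rmult_le_reg_r (d / 3)); [lra |].
      replace (3 / d * J * (d / 3)) with J by (field; lra). lra. }
    destruct (Pol_factor m p y Hp) as [q [Hq E]].
    assert (Q : RInt (fun z => q z ^ 2) (al + 2 * d / 3) be <= 36 / d ^ 2 * J).
    { apply Rle_trans with (RInt (fun z => 18 / d ^ 2 * (p z ^ 2 + p y ^ 2)) (al + 2 * d / 3) be).
      - apply RInt_cts_le.
        + unfold d; lra.
        + apply cts_pow, (Pol_cts m), Hq.
        + apply cts_mult; [apply cts_const | apply cts_plus; [apply Cp | apply cts_const]].
        + intros z Hz.
          assert (Ez : (z - y) * q z = p z - p y) by (rewrite (E z); ring).
          assert (Hzy : (d / 3) ^ 2 <= (z - y) ^ 2) by (apply pow_incr; lra).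
          assert (H1 : (d / 3) ^ 2 * q z ^ 2 <= 2 * (p z ^ 2 + p y ^ 2)).
          { assert ((z - y) ^ 2 * q z ^ 2 <= 2 * (p z ^ 2 + p y ^ 2)).
            { rewrite <- Rpow_mult_distr, Ez.
              assert (0 <= (p z + p y) ^ 2) by apply pow2_ge_0. nra. }
            assert (0 <= q z ^ 2) by apply pow2_ge_0. nra. }
          apply (Rmult_le_reg_l ((d / 3) ^ 2)); [apply pow_lt; lra |].
          replace ((d / 3) ^ 2 * (18 / d ^ 2 * (p z ^ 2 + p y ^ 2)))
            with (2 * (p z ^ 2 + p y ^ 2)) by (field; lra). exact H1.
      - rewrite RInt_cts_scal, RInt_cts_plus, RInt_const_R; auto with cts; try (unfold d; lra).
        replace (be - (al + 2 * d / 3)) with (d / 3) by (unfold d; field).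
        assert (0 < / d ^ 2) by (apply Rinv_0_lt_compat, pow_lt, Hd).
        assert (0 <= RInt (fun z => p z ^ 2) al (al + d / 3)).
        { apply RInt_cts_nonneg; auto; lra. }
        replace (36 / d ^ 2 * J) with (18 / d ^ 2 * (2 * J)) by (field; lra).
        apply Rmult_le_compat_l; [unfold Rdiv; lra |]. lra. }
    assert (Hq2 : q x ^ 2 <= 108 * K / d ^ 3 * J).
    { eapply Rle_trans.
      - apply (IH q (al + 2 * d / 3) be x Hq); [unfold d; lra |].
        replace (be - (al + 2 * d / 3)) with (d / 3) by (unfold d; field).
        replace (x - (al + 2 * d / 3)) with ((x - al) - 2 * d / 3) by ring.
        apply Rabs_le_between in Hx. apply Rabs_le_between. nra.
      - replace (be - (al + 2 * d / 3)) with (d / 3) by (unfold d; field).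
        replace (108 * K / d ^ 3 * J) with (K / (d / 3) * (36 / d ^ 2 * J)) by (field; lra).
        apply Rmult_le_compat_l; [| exact Q].
        apply Rlt_le, Rdiv_lt_0_compat; lra. }
    assert (Hxy : (x - y) ^ 2 <= (r + 1) ^ 2 * d ^ 2).
    { rewrite <- Rpow_mult_distr. apply pow_maj_Rabs.
      apply Rabs_le_between in Hx. apply Rabs_le_between. nra. }
    assert (H2 : p x ^ 2 <= 2 * p y ^ 2 + 2 * ((x - y) ^ 2 * q x ^ 2)).
    { rewrite (E x). assert (0 <= (p y - (x - y) * q x) ^ 2) by apply pow2_ge_0. nra. }
    assert (H3 : (x - y) ^ 2 * q x ^ 2 <= (r + 1) ^ 2 * d ^ 2 * (108 * K / d ^ 3 * J)).
    { apply Rmult_le_compat; auto; apply pow2_ge_0. }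
    replace ((6 + 216 * (r + 1) ^ 2 * K) / d * J)
      with (2 * (3 / d * J) + 2 * ((r + 1) ^ 2 * d ^ 2 * (108 * K / d ^ 3 * J))) by (field; lra).
    lra.
Qed.

(* p'(y) is the value at y of the quotient (p(x)-p(y))/(x-y), a polynomial of smaller degree
   that is controlled by sup|p| on the third of the interval farthest from y. *)
Lemma Pol_markov m : exists K, 0 < K /\
  forall p p' al be M, Pol m p -> (forall x, is_derive p x (p' x)) -> al < be ->
    (forall x, al <= x <= be -> Rabs (p x) <= M) ->
    forall y, al <= y <= be -> Rabs (p' y) <= K / (be - al) * M.
Proof.
  destruct m as [| m].
  - exists 1; split; [lra |]; intros p p' al be M [c Hc] D Hab HM y Hy.
    assert (E : p' y = 0).
    { rewrite <- (is_derive_unique _ _ _ (D y)).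
      apply is_derive_unique, (is_derive_ext (fun _ => c)); [intros; rewrite Hc; auto |].
      apply (is_derive_const (V := R_NormedModule)). }
    rewrite E, Rabs_R0. apply Rmult_le_pos; [apply Rlt_le, Rdiv_lt_0_compat; lra |].
    eapply Rle_trans; [apply Rabs_pos | apply (HM y Hy)].
  (* The point y is at distance at most d = 3 (d/3) from the left end of any third of the
     interval. *)
  - destruct (Pol_sup_L2 m 3) as [K [HK IH]]; [lra |].
    assert (HsK : 0 < sqrt K) by (apply sqrt_lt_R0, HK).
    exists (12 * sqrt K); split; [lra |].
    intros p p' al be M Hp D Hab HM y Hy.
    set (d := be - al) in *. assert (Hd : 0 < d) by (unfold d; lra).
    assert (M0 : 0 <= M) by (eapply Rle_trans; [apply Rabs_pos | apply (HM y Hy)]).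
    destruct (Pol_factor m p y Hp) as [q [Hq E]].
    assert (Eq : p' y = q y).
    { rewrite <- (is_derive_unique _ _ _ (D y)); apply is_derive_unique.
      apply (is_derive_ext (fun x => p y + (x - y) * q x)); [intros; rewrite <- E; auto |].
      destruct (Pol_derive m q (Pol_S _ _ Hq)) as [q' [_ Dq]].
      auto_derive; [exists (q' y); apply Dq | ring]. }
    (* Here u is the left end of the chosen third. Since |z - y| >= d/6 there, |q| <= 2M/(d/6) = 12
       M/d, whence the constant 12. *)
    assert (Main : forall u, (u = al \/ u = al + 2 * d / 3) ->
      (forall z, u <= z <= u + d / 3 -> d / 6 <= Rabs (z - y)) -> Rabs (p' y) <= 12 * sqrt K / d * M).
    { intros u Hu Hz.
      assert (B : q y ^ 2 <= K / (u + d / 3 - u) * RInt (fun z => q z ^ 2) u (u + d / 3)).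
      { apply IH; [exact Hq | lra |]. apply Rabs_le_between. unfold d in *; lra. }
      assert (B2 : RInt (fun z => q z ^ 2) u (u + d / 3) <= (12 * M / d) ^ 2 * (d / 3)).
      { replace ((12 * M / d) ^ 2 * (d / 3)) with (RInt (fun _ => (12 * M / d) ^ 2) u (u + d / 3))
          by (apply RInt_const_len; field).
        apply RInt_cts_le; [lra | apply cts_pow, (Pol_cts m), Hq | apply cts_const |].
        intros z Hzz; apply pow_maj_Rabs.
        specialize (Hz z Hzz).
        assert (Ez : (z - y) * q z = p z - p y) by (rewrite (E z); ring).
        assert (Ea : Rabs (z - y) * Rabs (q z) <= 2 * M).
        { rewrite <- Rabs_mult, Ez. unfold Rminus.
          eapply Rle_trans; [apply Rabs_triang |]. rewrite Rabs_Ropp.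
          assert (Rabs (p z) <= M) by (apply HM; unfold d in *; lra).
          specialize (HM y Hy); lra. }
        apply (Rmult_le_reg_l (d / 6)); [lra |].
        replace (d / 6 * (12 * M / d)) with (2 * M) by (field; lra).
        assert (0 <= Rabs (q z)) by apply Rabs_pos. nra. }
      rewrite Eq. apply (Rle_trans _ (Rabs (12 * sqrt K / d * M))).
      2:{ rewrite Rabs_right; [lra |]. apply Rle_ge, Rmult_le_pos; auto.
          apply Rlt_le, Rdiv_lt_0_compat; lra. }
      apply Rsqr_le_abs_0. rewrite !Rsqr_pow2.
      eapply Rle_trans; [exact B |].
      replace ((12 * sqrt K / d * M) ^ 2) with (K / (u + d / 3 - u) * ((12 * M / d) ^ 2 * (d / 3))).
      - apply Rmult_le_compat_l; auto. apply Rlt_le, Rdiv_lt_0_compat; lra.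
      - rewrite <- (sqrt_sqrt K) at 1 by lra. field; lra. }
    destruct (Rle_dec y (al + d / 2)).
    + apply (Main (al + 2 * d / 3)); auto. intros z Hz; rewrite Rabs_right; lra.
    + apply (Main al); auto. intros z Hz; rewrite Rabs_left; lra.
Qed.

(** * B-splines *)

(* Cox-de Boor recursion: [bspl t k i] is the B-spline of degree k supported on
   [t_i, t_(i+k+1)]. *)
Fixpoint bspl (t : nat -> R) (k i : nat) (x : R) : R :=
  match k with
  | O => if Rle_dec (t i) x then if Rlt_dec x (t (S i)) then 1 else 0 else 0
  | S k' =>
      (x - t i) / (t (i + S k')%nat - t i) * bspl t k' i x +
      (t (S i + S k')%nat - x) / (t (S i + S k')%nat - t (S i)) * bspl t k' (S i) x
  end.

Definition knots (t : nat -> R) : Prop := forall j, t j < t (S j).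

Lemma knots_lt t i j : knots t -> (i < j)%nat -> t i < t j.
Proof.
  intros K H; induction H; [apply K |]. specialize (K m); lra.
Qed.

Lemma knots_le t i j : knots t -> (i <= j)%nat -> t i <= t j.
Proof.
  intros K H; destruct (Nat.eq_dec i j) as [-> | E]; [lra |].
  left; apply knots_lt; auto; lia.
Qed.

Lemma bspl_support t k i x : knots t -> x < t i \/ t (i + k + 1)%nat <= x -> bspl t k i x = 0.
Proof.
  intros K; revert i; induction k; intros i H; simpl.
  - replace (i + 0 + 1)%nat with (S i) in H by lia.
    destruct (Rle_dec (t i) x), (Rlt_dec x (t (S i))); lra.
  - assert (t i < t (S i)) by apply K.
    assert (t (i + k + 1)%nat < t (i + S k + 1)%nat) by (apply knots_lt; auto; lia).
    rewrite (IHk i), (IHk (S i)); [ring | |].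
    + replace (S i + k + 1)%nat with (i + S k + 1)%nat by lia. lra.
    + lra.
Qed.

Lemma bspl_nonneg t k i x : knots t -> 0 <= bspl t k i x.
Proof.
  intros K; revert i; induction k; intros i; simpl.
  - destruct (Rle_dec (t i) x), (Rlt_dec x (t (S i))); lra.
  - assert (H1 : t i < t (i + S k)%nat) by (apply knots_lt; auto; lia).
    assert (H2 : t (S i) < t (S (i + S k))) by (apply knots_lt; auto; lia).
    apply Rplus_le_le_0_compat.
    + destruct (Rlt_dec x (t i)) as [H | H].
      * rewrite (bspl_support t k i x K) by auto; lra.
      * apply Rmult_le_pos; auto. apply Rdiv_le_0_compat; lra.
    + destruct (Rlt_dec x (t (S (i + S k)))) as [H | H].
      * apply Rmult_le_pos; auto. apply Rdiv_le_0_compat; lra.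
      * rewrite (bspl_support t k (S i) x K); [lra |].
        right; replace (S i + k + 1)%nat with (S (i + S k)) by lia; lra.
Qed.

(** In the recursion [bspl t k i] receives the weight [al i] from index i and 1 - [al i] from index
    i - 1, so the sum is inherited from degree k. The two unmatched boundary terms vanish by the
    supports and the range of x. *)
Lemma bspl_partition t k n x : knots t -> t k <= x < t n -> sumn n (fun i => bspl t k i x) = 1.
Proof.
  intros K; revert n; induction k; intros n Hx.
  - destruct Hx as [H0 Hn]; induction n; [lra |]; cbn [sumn].
    destruct (Rlt_dec x (t n)) as [H | H].
    + rewrite IHn by auto. rewrite bspl_support; auto; ring.
    + rewrite sumn_zero; [simpl; destruct (Rle_dec (t n) x), (Rlt_dec x (t (S n))); lra |].
      intros i Hi; apply bspl_support; auto.
      right; apply Rle_trans with (t n); [apply knots_le; auto; lia | lra].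
  - assert (Hk : t k < t (S k)) by apply K.
    set (al := fun i => (x - t i) / (t (i + S k)%nat - t i)).
    assert (Hden : forall i, t (i + S k)%nat - t i <> 0).
    { intros i; assert (t i < t (i + S k)%nat) by (apply knots_lt; auto; lia); lra. }
    rewrite (sumn_ext n _ (fun i => al i * bspl t k i x + (1 - al (S i)) * bspl t k (S i) x)).
    2:{ intros i _; assert (H := Hden (S i)); unfold al; cbn [bspl]; field; split; auto. }
    rewrite sumn_plus.
    assert (E : sumn n (fun i => (1 - al (S i)) * bspl t k (S i) x)
              = sumn (S n) (fun i => (1 - al i) * bspl t k i x)).
    { rewrite sumn_shift. rewrite (bspl_support t k 0 x K); [ring |].
      right; replace (0 + k + 1)%nat with (S k) by lia; lra. }
    rewrite E; cbn [sumn]. rewrite (bspl_support t k n x K) by (left; lra).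
    rewrite Rmult_0_r, Rplus_0_r, <- sumn_plus.
    transitivity (sumn n (fun i => bspl t k i x)); [| apply IHk; lra].
    apply sumn_ext; intros; ring.
Qed.

Definition dbspl (t : nat -> R) (k i : nat) (x : R) : R :=
  match k with
  | O => 0
  | S k' => INR (S k') * (bspl t k' i x / (t (i + S k')%nat - t i)
                          - bspl t k' (S i) x / (t (S i + S k')%nat - t (S i)))
  end.

(** Induction by differentiating the Cox-de Boor recursion. Staying away from the knots covers the
    jumps in degree 0 and the kinks in degree 1; [is_derive_of_punctured] fills in the knots for
    higher degrees. *)
Lemma is_derive_bspl_off_knots t k i x : knots t ->
  (forall j, (i <= j <= i + k + 1)%nat -> x <> t j) -> is_derive (bspl t k i) x (dbspl t k i x).
Proof.
  intros K; revert i; induction k; intros i H.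
  - cbn [dbspl]. apply (is_derive_ext_loc (fun _ => bspl t 0 i x)).
    2: apply (is_derive_const (V := R_NormedModule)).
    assert (H1 : x <> t i) by (apply H; lia). assert (H2 : x <> t (S i)) by (apply H; lia).
    assert (P : 0 < Rmin (Rabs (x - t i)) (Rabs (x - t (S i))))
      by (apply Rmin_pos; apply Rabs_pos_lt; lra).
    exists (mkposreal _ P); intros y Hy.
    change (Rabs (y - x) < Rmin (Rabs (x - t i)) (Rabs (x - t (S i)))) in Hy.
    assert (A1 := Rlt_le_trans _ _ _ Hy (Rmin_l _ _)).
    assert (A2 := Rlt_le_trans _ _ _ Hy (Rmin_r _ _)).
    revert A1 A2; unfold Rabs; repeat destruct Rcase_abs; simpl;
      repeat destruct Rle_dec; repeat destruct Rlt_dec; lra.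
  - assert (D0 : is_derive (bspl t k i) x (dbspl t k i x)) by (apply IHk; intros; apply H; lia).
    assert (D1 : is_derive (bspl t k (S i)) x (dbspl t k (S i) x))
      by (apply IHk; intros; apply H; lia).
    assert (N0 : t i < t (i + S k)%nat) by (apply knots_lt; auto; lia).
    assert (N1 : t (S i) < t (S i + S k)%nat) by (apply knots_lt; auto; lia).
    assert (L0 : is_derive (fun x => (x - t i) / (t (i + S k)%nat - t i)) x
                   (/ (t (i + S k)%nat - t i))).
    { auto_derive; auto; ring. }
    assert (L1 : is_derive (fun x => (t (S i + S k)%nat - x) / (t (S i + S k)%nat - t (S i))) x
                   (- / (t (S i + S k)%nat - t (S i)))).
    { auto_derive; auto; change (S i + S k)%nat with (S (i + S k)); ring. }
    assert (P0 := is_derive_mult _ _ _ _ _ L0 D0 Rmult_comm).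
    assert (P1 := is_derive_mult _ _ _ _ _ L1 D1 Rmult_comm).
    assert (P := is_derive_plus _ _ _ _ _ P0 P1).
    cbn [bspl]. evar_last; [exact P |].
    clear P P0 P1 L0 L1 D0 D1 IHk.
    change plus with Rplus; change mult with Rmult. unfold dbspl at 3.
      destruct k as [| k].
    * cbn [dbspl]. replace (INR 1) with 1 by reflexivity. field; lra.
      (* Both sides are combinations of the three B-splines of degree k with indices i, i+1, i+2.
         Once these and the knots are made atoms, the equality is an identity between rational
         coefficients. *)
      * unfold dbspl. cbn [bspl].
        replace (INR (S (S k))) with (INR (S k) + 1) by (symmetry; apply S_INR).
        assert (M0 : t i < t (i + S k)%nat) by (apply knots_lt; auto; lia).
        assert (M1 : t (S i) < t (S i + S k)%nat) by (apply knots_lt; auto; lia).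
        assert (M2 : t (S (S i)) < t (S (S i) + S k)%nat) by (apply knots_lt; auto; lia).
        replace (i + S (S k))%nat with (S i + S k)%nat in * by lia.
        replace (S i + S (S k))%nat with (S (S i) + S k)%nat in * by lia.
        generalize dependent (INR (S k)); intros m.
        generalize dependent (bspl t k i x); intros b0.
        generalize dependent (bspl t k (S i) x); intros b1.
        generalize dependent (bspl t k (S (S i)) x); intros b2.
        change (S (i + S k)) with (S i + S k)%nat in *.
        change (S (S (i + S k))) with (S (S i) + S k)%nat in *.
        generalize dependent (t (S (S i) + S k)%nat); intros g.
        generalize dependent (t (S i + S k)%nat); intros f.
        generalize dependent (t (i + S k)%nat); intros e. intros.
        field. repeat split; lra.
Qed.

(** The hat function is a rising ramp minus the next one; continuity at the knots can be read off
    this form. *)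
Lemma bspl1_clamp t i x : knots t ->
  bspl t 1 i x = clamp 0 1 ((x - t i) / (t (S i) - t i))
               - clamp 0 1 ((x - t (S i)) / (t (S (S i)) - t (S i))).
Proof.
  intros K. assert (K0 := K i). assert (K1 := K (S i)).
  assert (C0 : forall a b y, a < b -> y <= a -> clamp 0 1 ((y - a) / (b - a)) = 0).
  { intros a b y H H'. assert ((y - a) / (b - a) <= 0).
    { apply (Rmult_le_reg_r (b - a)); [lra |]. unfold Rdiv; rewrite Rmult_assoc, Rinv_l; lra. }
    unfold clamp; rewrite Rmin_right, Rmax_left; lra. }
  assert (C1 : forall a b y, a < b -> b <= y -> clamp 0 1 ((y - a) / (b - a)) = 1).
  { intros a b y H H'. assert (1 <= (y - a) / (b - a)).
    { apply (Rmult_le_reg_r (b - a)); [lra |]. unfold Rdiv; rewrite Rmult_assoc, Rinv_l; lra. }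
    unfold clamp; rewrite Rmin_left, Rmax_right; lra. }
  assert (Ci : forall a b y, a < b -> a <= y <= b ->
     clamp 0 1 ((y - a) / (b - a)) = (y - a) / (b - a)).
  { intros a b y H H'; apply clamp_id; split.
    - apply Rdiv_le_0_compat; lra.
    - apply (Rmult_le_reg_r (b - a)); [lra |]. unfold Rdiv; rewrite Rmult_assoc, Rinv_l; lra. }
  cbn [bspl]. replace (i + 1)%nat with (S i) by lia. replace (S i + 1)%nat with (S (S i)) by lia.
  destruct (Rle_dec (t i) x), (Rlt_dec x (t (S i))), (Rle_dec (t (S i)) x),
    (Rlt_dec x (t (S (S i)))); try lra.
  - rewrite Ci, C0 by lra; field; lra.
  - rewrite C1, Ci by lra; field; lra.
  - rewrite C1, C1 by lra; field; lra.
  - rewrite C0, C0 by lra; field; lra.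
Qed.

Lemma continuous_bspl t k i x : knots t -> continuous (bspl t (S k) i) x.
Proof.
  intros K; revert i; induction k; intros i.
  - apply (continuous_ext (fun x => clamp 0 1 ((x - t i) / (t (S i) - t i))
               - clamp 0 1 ((x - t (S i)) / (t (S (S i)) - t (S i))))).
    { intros y; rewrite bspl1_clamp; auto. }
    assert (A : forall a c, continuous (fun x => clamp 0 1 ((x - a) / c)) x).
    { intros a c; apply (continuous_comp (fun x => (x - a) / c) (clamp 0 1));
        [| apply continuous_clamp].
      apply (ex_derive_continuous (V := R_NormedModule)); auto_derive; auto. }
    apply (continuous_minus (V := R_NormedModule)); apply A.
  - set (k' := S k) in *; cbn [bspl].
    assert (A : forall f, ex_derive (V := R_NormedModule) f x -> continuous f x)
      by (intros; apply (ex_derive_continuous (V := R_NormedModule)); auto).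
    apply (continuous_plus (V := R_NormedModule)); apply (continuous_mult (K := R_AbsRing));
      auto; apply A; auto_derive; auto.
Qed.

(** The degree is at least 1, so that continuity lets the polynomial piece match at the right knot
    too; in degree 0 the pieces are half-open. *)
Lemma bspl_Pol t k i j : knots t -> exists p, Pol (S k) p /\
  forall x, t j <= x <= t (S j) -> bspl t (S k) i x = p x.
Proof.
  intros K; revert i; induction k; intros i.
  - assert (K0 := K i). assert (K1 := K (S i)). assert (Kj := K j).
    assert (A : forall a b, Pol 1 (fun x => (x - a) / b)).
    { intros a b; exists (- a / b), (fun _ => / b); split; [exists (/ b); auto |].
      intros; unfold Rdiv; ring. }
    destruct (Nat.lt_trichotomy j i) as [H | [H | H]].
    + exists (fun _ => 0); split; [apply Pol_const |].
      intros x Hx; assert (t (S j) <= t i) by (apply knots_le; auto).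
      rewrite bspl1_clamp by auto. unfold clamp.
      assert (forall a b, x <= a -> a < b -> (x - a) / (b - a) <= 0).
      { intros a b ? ?; apply (Rmult_le_reg_r (b - a)); [lra |].
        unfold Rdiv; rewrite Rmult_assoc, Rinv_l; lra. }
      assert (H2 := H1 (t i) (t (S i))). assert (H3 := H1 (t (S i)) (t (S (S i)))).
      rewrite !Rmin_right, !Rmax_left; try lra; try (apply H2; lra); try (apply H3; lra).
    + subst j; exists (fun x => (x - t i) / (t (S i) - t i)); split; [apply A |].
      intros x Hx. cbn [bspl]. replace (i + 1)%nat with (S i) by lia.
      replace (S i + 1)%nat with (S (S i)) by lia.
      destruct (Rle_dec (t i) x), (Rlt_dec x (t (S i))), (Rle_dec (t (S i)) x),
        (Rlt_dec x (t (S (S i)))); try lra.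
      assert (x = t (S i)) by lra; subst x; field; lra.
    + destruct (Nat.eq_dec j (S i)) as [-> | Hn].
      * exists (fun x => (t (S (S i)) - x) / (t (S (S i)) - t (S i))); split.
        { apply (Pol_ext _ (fun x => (x - t (S (S i))) / (- (t (S (S i)) - t (S i))))); [| apply A].
          intros; field; lra. }
        intros x Hx. cbn [bspl]. replace (i + 1)%nat with (S i) by lia.
        replace (S i + 1)%nat with (S (S i)) by lia.
        destruct (Rle_dec (t i) x), (Rlt_dec x (t (S i))), (Rle_dec (t (S i)) x),
          (Rlt_dec x (t (S (S i)))); try lra.
        assert (x = t (S (S i))) by lra; subst x; field; lra.
      * exists (fun _ => 0); split; [apply Pol_const |].
        intros x Hx; apply bspl_support; auto. right.
        apply Rle_trans with (t j); [apply knots_le; auto; lia | lra].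
  - destruct (IHk i) as [p [Hp Ep]]. destruct (IHk (S i)) as [q [Hq Eq]].
    set (k' := S k) in *.
    exists (fun x => (x - t i) / (t (i + S k')%nat - t i) * p x +
      (t (S i + S k')%nat - x) / (t (S i + S k')%nat - t (S i)) * q x); split.
    + apply Pol_plus.
      * apply (Pol_ext _ (fun x => (/ (t (i + S k')%nat - t i) * x + - t i / (t (i + S k')%nat - t i)) * p x)).
        { intros; unfold Rdiv; ring. }
        apply Pol_mul_affine, Hp.
      * apply (Pol_ext _ (fun x => (- / (t (S i + S k')%nat - t (S i)) * x
           + t (S i + S k')%nat / (t (S i + S k')%nat - t (S i))) * q x)).
        { intros; unfold Rdiv; ring. }
        apply Pol_mul_affine, Hq.
    + intros x Hx; cbn [bspl]; rewrite Ep, Eq by auto; reflexivity.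
Qed.

(** By the mean value theorem each difference quotient at x is a value of g at an intermediate
    point, and g is continuous at x. *)
Lemma is_derive_of_punctured (f g : R -> R) x (d : posreal) :
  (forall y, Rabs (y - x) < d -> y <> x -> is_derive f y (g y)) ->
  continuous f x -> continuous g x -> is_derive f x (g x).
Proof.
  intros H Cf Cg; apply is_derive_eps; intros eps.
  apply filterlim_locally with (eps := eps) in Cg; destruct Cg as [e He].
  assert (P : 0 < Rmin d e) by (apply Rmin_pos; apply cond_pos).
  exists (mkposreal _ P); intros y Hy Hyx; simpl in Hy.
  assert (Hd := Rlt_le_trans _ _ _ Hy (Rmin_l _ _)).
  assert (Hee := Rlt_le_trans _ _ _ Hy (Rmin_r _ _)).
  assert (B : forall z, Rmin x y <= z <= Rmax x y -> Rabs (z - x) <= Rabs (y - x)).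
  { intros z; unfold Rmin, Rmax; destruct (Rle_dec x y);
      unfold Rabs; repeat destruct Rcase_abs; lra. }
  destruct (MVT_gen f x y g) as [c [Hc E]].
  - intros z Hz; apply H.
    + apply Rle_lt_trans with (Rabs (y - x)); auto; apply B; lra.
    + intros ->; revert Hz; unfold Rmin, Rmax; destruct (Rle_dec x y); lra.
  - intros z Hz; apply continuity_pt_filterlim.
    destruct (Req_dec z x) as [-> | Hzx]; [exact Cf |].
    apply (ex_derive_continuous (V := R_NormedModule)); exists (g z); apply H; auto.
    apply Rle_lt_trans with (Rabs (y - x)); auto.
  - replace ((f y - f x) / (y - x)) with (g c) by (rewrite E; field; lra).
    apply (He c). apply Rle_lt_trans with (Rabs (y - x)); auto.
Qed.

Lemma knots_isolated (t : nat -> R) n x : exists d : posreal,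
  forall y j, (j < n)%nat -> Rabs (y - x) < d -> y <> x -> y <> t j.
Proof.
  induction n as [| n [d Hd]].
  - exists (mkposreal 1 Rlt_0_1); intros; lia.
  - destruct (Req_dec (t n) x) as [E | E].
    + exists d; intros y j Hj Hy Hyx. destruct (Nat.eq_dec j n) as [-> | Hn]; [lra |].
      apply Hd; auto; lia.
    + assert (P : 0 < Rmin d (Rabs (t n - x))).
      { apply Rmin_pos; [apply cond_pos | apply Rabs_pos_lt; lra]. }
      exists (mkposreal _ P); intros y j Hj Hy Hyx; simpl in Hy.
      assert (H1 := Rlt_le_trans _ _ _ Hy (Rmin_l _ _)).
      assert (H2 := Rlt_le_trans _ _ _ Hy (Rmin_r _ _)).
      destruct (Nat.eq_dec j n) as [-> | Hn]; [intros ->; lra |].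
      apply Hd; auto; lia.
Qed.

Lemma is_derive_bspl t k i x : knots t ->
  is_derive (bspl t (S (S k)) i) x (dbspl t (S (S k)) i x).
Proof.
  intros K. destruct (knots_isolated t (i + S (S k) + 2) x) as [d Hd].
  apply (is_derive_of_punctured _ (dbspl t (S (S k)) i) x d).
  - intros y Hy Hyx; apply is_derive_bspl_off_knots; auto.
    intros j Hj; apply Hd; auto; lia.
  - apply continuous_bspl, K.
  - unfold dbspl. apply (continuous_mult (K := R_AbsRing)); [apply continuous_const |].
    apply (continuous_minus (V := R_NormedModule)); unfold Rdiv;
      apply (continuous_mult (K := R_AbsRing));
      auto using continuous_const, continuous_bspl.
Qed.

(** The convention c_(-1) = c_0 makes the first difference zero, so bounds on consecutive
    differences hold at index 0 as well. *)
Definition prev (c : nat -> R) (i : nat) : R := match i with O => c O | S j => c j end.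

(* Coefficients, in degree k, of the derivative of [comb n c (bspl t (S k))]. *)
Definition dcoef (t : nat -> R) (k : nat) (c : nat -> R) (i : nat) : R :=
  INR (S k) * (c i - prev c i) / (t (i + S k)%nat - t i).

Lemma sumn_by_parts n (c u : nat -> R) : u O = 0 ->
  sumn n (fun i => c i * (u i - u (S i)))
  = sumn n (fun i => (c i - prev c i) * u i) - prev c n * u n.
Proof.
  intros H; induction n; cbn [sumn]; [rewrite H; ring |].
  rewrite IHn; simpl prev; destruct n; simpl prev; rewrite ?H; ring.
Qed.

Lemma is_derive_sumn n (f : nat -> R -> R) f' x :
  (forall i, (i < n)%nat -> is_derive (f i) x (f' i)) ->
  is_derive (fun y => sumn n (fun i => f i y)) x (sumn n f').
Proof.
  intros H; induction n; cbn [sumn]; [apply (is_derive_const (V := R_NormedModule)) |].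
  apply (is_derive_plus (V := R_NormedModule)); [apply IHn; intros |]; apply H; lia.
Qed.

(** Summation by parts moves the differences from the B-splines to the coefficients. The range of x
    lies to the right of the support with index 0 and to the left of that with index n, which
    removes the boundary terms. *)
Lemma is_derive_comb_bspl t k n c x : knots t -> t (S (S k)) <= x < t n ->
  is_derive (comb n c (bspl t (S (S k)))) x (comb n (dcoef t (S k) c) (bspl t (S k)) x).
Proof.
  intros K Hx.
  set (u := fun i => INR (S (S k)) * bspl t (S k) i x / (t (i + S (S k))%nat - t i)).
  assert (Hden : forall i, t (i + S (S k))%nat - t i <> 0).
  { intros i; assert (t i < t (i + S (S k))%nat) by (apply knots_lt; auto; lia); lra. }
  evar_last.
  - apply is_derive_sumn. intros i _.
    apply (is_derive_scal (bspl t (S (S k)) i)), is_derive_bspl, K.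
  - rewrite (sumn_ext n _ (fun i => c i * (u i - u (S i)))).
    2:{ intros i _; unfold u, dbspl. change mult with Rmult. unfold Rdiv; ring. }
    rewrite sumn_by_parts.
    2:{ unfold u; rewrite bspl_support; auto; [unfold Rdiv; ring |].
        right; replace (0 + S k + 1)%nat with (S (S k)) by lia; lra. }
    unfold u at 2; rewrite (bspl_support t (S k) n x K) by (left; lra).
    unfold comb, dcoef, u, Rdiv.
    rewrite Rmult_0_r, Rmult_0_l, Rmult_0_r, Rminus_0_r.
    apply sumn_ext; intros; ring.
Qed.

(** * Splines on quasiuniform partitions *)

(* Knots of a quasiuniform partition of [0,1] = [t_d, t_(d+N)], continued on both sides.
   On [0,1] the splines of degree k <= d are spanned by [bspl t k i], i <= d+N. *)
Definition grid (t : nat -> R) (d N : nat) (h c0 : R) : Prop :=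
  0 < h /\ 1 <= c0 /\ (forall j, h <= c0 * (t (S j) - t j) /\ t (S j) - t j <= h) /\
  t d = 0 /\ t (d + N)%nat = 1.

Definition spl (t : nat -> R) (d N k : nat) (c : nat -> R) : R -> R :=
  comb (S (d + N)) c (bspl t k).

Lemma grid_knots t d N h c0 : grid t d N h c0 -> knots t.
Proof. intros [H [H0 [H1 _]]] j; specialize (H1 j); nra. Qed.

Lemma grid_gap t d N h c0 i m : grid t d N h c0 -> t (i + m)%nat - t i <= INR m * h.
Proof.
  intros [H [H0 [H1 _]]]; induction m; [rewrite Nat.add_0_r; simpl; lra |].
  rewrite S_INR, Nat.add_succ_r. specialize (H1 (i + m)%nat); lra.
Qed.

Lemma knots_find t d m x : t d <= x < t (d + m)%nat ->
  exists j, (d <= j < d + m)%nat /\ t j <= x < t (S j).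
Proof.
  induction m; intros H; [rewrite Nat.add_0_r in H; lra |].
  destruct (Rlt_dec x (t (d + m)%nat)) as [L | L].
  - destruct IHm as [j [H1 H2]]; [lra |]. exists j; split; [lia | lra].
  - exists (d + m)%nat; split; [lia |]. rewrite Nat.add_succ_r in H; lra.
Qed.

Lemma grid_find t d N h c0 x : grid t d N h c0 -> 0 <= x <= 1 ->
  exists j, (d <= j <= d + N)%nat /\ t j <= x < t (S j).
Proof.
  intros G Hx; assert (K := grid_knots _ _ _ _ _ G).
  destruct G as [_ [_ [_ [E0 E1]]]].
  (* One cell beyond the partition is included, because x = 1 belongs to the half-open cell that
     starts at t_(d+N). *)
  destruct (knots_find t d (S N) x) as [j [H1 H2]].
  - rewrite Nat.add_succ_r; specialize (K (d + N)%nat); lra.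
  - exists j; split; [lia | auto].
Qed.

Lemma bspl_active t k i j x : knots t -> t j <= x < t (S j) -> bspl t k i x <> 0 ->
  (i <= j <= i + k)%nat.
Proof.
  intros K Hx H.
  destruct (Nat.le_gt_cases i j) as [L1 | L1].
  2:{ exfalso; apply H, bspl_support; auto; left.
      assert (t (S j) <= t i) by (apply knots_le; auto); lra. }
  destruct (Nat.le_gt_cases j (i + k)) as [L2 | L2]; [lia |].
  exfalso; apply H, bspl_support; auto; right.
  assert (t (i + k + 1)%nat <= t j) by (apply knots_le; auto; lia); lra.
Qed.

(** The value is a convex combination of the coefficients, and only those active on the cell of x
    enter. This is the local stability on which approximation and superapproximation rest. *)
Lemma comb_bspl_bound t k n e j x E : knots t -> (k <= j < n)%nat -> t j <= x < t (S j) ->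
  (forall i, (i < n)%nat -> (i <= j <= i + k)%nat -> Rabs (e i) <= E) ->
  Rabs (comb n e (bspl t k) x) <= E.
Proof.
  intros K Hj Hx He.
  eapply Rle_trans; [apply sumn_Rabs |].
  apply Rle_trans with (sumn n (fun i => E * bspl t k i x)).
  - apply sumn_le; intros i Hi; rewrite Rabs_mult.
    assert (P := bspl_nonneg t k i x K).
    rewrite (Rabs_right (bspl t k i x)) by lra.
    destruct (Req_dec (bspl t k i x) 0) as [Z | Z]; [rewrite Z; lra |].
    apply Rmult_le_compat_r; auto. apply He; auto. apply (bspl_active t k i j x); auto.
  - rewrite sumn_scal, (bspl_partition t k n x K); [lra |].
    assert (t k <= t j) by (apply knots_le; auto; lia).
    assert (t (S j) <= t n) by (apply knots_le; auto; lia). lra.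
Qed.

Lemma grid_partition t d N h c0 k x : grid t d N h c0 -> (k <= d)%nat -> 0 <= x <= 1 ->
  sumn (S (d + N)) (fun i => bspl t k i x) = 1.
Proof.
  intros G Hk Hx; assert (K := grid_knots _ _ _ _ _ G).
  destruct G as [_ [_ [_ [E0 E1]]]]. apply bspl_partition; auto.
  assert (t k <= t d) by (apply knots_le; auto).
  specialize (K (d + N)%nat). lra.
Qed.

Lemma spl_add_const t d N h c0 k c y x : grid t d N h c0 -> (k <= d)%nat -> 0 <= x <= 1 ->
  spl t d N k (fun i => c i + y) x = spl t d N k c x + y.
Proof.
  intros G Hk Hx; unfold spl, comb.
  rewrite (sumn_ext _ _ (fun i => c i * bspl t k i x + y * bspl t k i x)) by (intros; ring).
  rewrite sumn_plus, sumn_scal, (grid_partition t d N h c0) by auto. ring.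
Qed.

Lemma spl_Pol t d N k c j : knots t -> exists p, Pol (S k) p /\
  forall x, t j <= x <= t (S j) -> spl t d N (S k) c x = p x.
Proof.
  intros K. unfold spl. induction (S (d + N)) as [| n [p [Hp E]]].
  - exists (fun _ => 0); split; [apply Pol_const | reflexivity].
  - destruct (bspl_Pol t k n j K) as [q [Hq Eq]].
    exists (fun x => p x + c n * q x); split.
    + apply Pol_plus, Pol_scal; auto.
    + intros x Hx; unfold comb in *; cbn [sumn]; rewrite E, Eq; auto.
Qed.

Lemma continuous_spl t d N k c x : knots t -> continuous (spl t d N (S k) c) x.
Proof.
  intros K; unfold spl. induction (S (d + N)) as [| n IH].
  - apply continuous_const.
  - apply (continuous_plus (V := R_NormedModule)); [exact IH |].
    apply (continuous_mult (K := R_AbsRing)); [apply continuous_const | apply continuous_bspl, K].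
Qed.

Lemma spl_cts t d N k c a b : knots t -> cts a b (spl t d N (S k) c).
Proof.
  intros K x; apply (continuous_comp (clamp a b) (spl t d N (S k) c));
    [apply continuous_clamp | apply continuous_spl, K].
Qed.

Lemma is_derive_spl t d N h c0 k c x : grid t d N h c0 -> (S (S k) <= d)%nat -> 0 <= x <= 1 ->
  is_derive (spl t d N (S (S k)) c) x (spl t d N (S k) (dcoef t (S k) c) x).
Proof.
  intros G Hk Hx; assert (K := grid_knots _ _ _ _ _ G).
  destruct G as [_ [_ [_ [E0 E1]]]]. apply is_derive_comb_bspl; auto.
  assert (t (S (S k)) <= t d) by (apply knots_le; auto).
  specialize (K (d + N)%nat). lra.
Qed.

Lemma dfn_spl t d N h c0 k c : grid t d N h c0 -> (S (S k) <= d)%nat ->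
  dfn 0 1 (spl t d N (S (S k)) c) (spl t d N (S k) (dcoef t (S k) c)).
Proof.
  intros G Hk x Hx; apply (is_derive_on_of_is_derive 0 1 _ (spl t d N (S (S k)) c)); auto.
  eapply is_derive_spl; eauto.
Qed.

(** Partial sums of a invert [dcoef]. The coefficient with index 0 multiplies a B-spline that
    vanishes on [0,1], and the partition of unity allows a constant to be added in order to
    prescribe the value at 0. *)
Lemma spl_antiderivative t d N h c0 k a y : grid t d N h c0 -> (S (S k) <= d)%nat ->
  exists c, dfn 0 1 (spl t d N (S (S k)) c) (spl t d N (S k) a) /\ spl t d N (S (S k)) c 0 = y.
Proof.
  intros G Hk; assert (K := grid_knots _ _ _ _ _ G).
  set (c1 := fix c1 i := match i with
    | O => 0
    | S j => c1 j + a (S j) * (t (S j + S (S k))%nat - t (S j)) / INR (S (S k)) end).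
  set (c := fun i => c1 i + (y - spl t d N (S (S k)) c1 0)).
  exists c; split.
  - intros x Hx. apply (is_derive_on_of_is_derive 0 1 _ (spl t d N (S (S k)) c)); auto.
    replace (spl t d N (S k) a x) with (spl t d N (S k) (dcoef t (S k) c) x).
    { eapply is_derive_spl; eauto. }
    apply sumn_ext; intros i _. destruct i as [| i].
    + rewrite (bspl_support t (S k) 0 x K); [ring |]. right.
      replace (0 + S k + 1)%nat with (S (S k)) by lia.
      destruct G as [_ [_ [_ [E0 E1]]]].
      assert (t (S (S k)) <= t d) by (apply knots_le; auto). lra.
    + f_equal. unfold dcoef, c; simpl prev. cbn [c1].
      assert (t (S i) < t (S i + S (S k))%nat) by (apply knots_lt; auto; lia).
      assert (INR (S (S k)) <> 0) by (apply not_0_INR; lia).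
      fold (c1 i). set (n := INR (S (S k))) in *.
      field. split; lra.
  - unfold c; rewrite (spl_add_const t d N h c0); auto; [ring | lra].
Qed.

Lemma sumn_two n j f : (S j < n)%nat -> (forall i, (i < n)%nat -> i <> j -> i <> S j -> f i = 0) ->
  sumn n f = f j + f (S j).
Proof.
  intros Hj H. replace n with (S (S j) + (n - S (S j)))%nat by lia.
  rewrite sumn_split. cbn [sumn].
  rewrite (sumn_zero j), (sumn_zero (n - S (S j))); [ring | |]; intros; apply H; lia.
Qed.

(** Piecewise linear interpolation: the coefficient with index j is the value at t_(j+1). The base
    cases of stability, span and approximation use this. *)
Lemma spl1_eq t d N c j x : knots t -> (S j <= d + N)%nat -> t (S j) <= x < t (S (S j)) ->
  spl t d N 1 c x = (c j * (t (S (S j)) - x) + c (S j) * (x - t (S j))) / (t (S (S j)) - t (S j)).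
Proof.
  intros K Hj Hx; unfold spl, comb. rewrite (sumn_two _ j); [| lia |].
  - assert (K0 := K j). assert (K1 := K (S (S j))). cbn [bspl].
    replace (j + 1)%nat with (S j) by lia. replace (S j + 1)%nat with (S (S j)) by lia.
    replace (S (S j) + 1)%nat with (S (S (S j))) by lia.
    destruct (Rle_dec (t j) x), (Rlt_dec x (t (S j))), (Rle_dec (t (S j)) x),
        (Rlt_dec x (t (S (S j)))), (Rle_dec (t (S (S j))) x), (Rlt_dec x (t (S (S (S j)))));
      try lra.
  - intros i Hi H1 H2.
    destruct (Req_dec (bspl t 1 i x) 0) as [Z | Z]; [rewrite Z; ring |].
    apply (bspl_active t 1 i (S j) x K Hx) in Z; lia.
Qed.

(* Consecutive differences of the coefficients are coefficients of the derivative, to which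
   the induction hypothesis and Markov's inequality apply. *)
Lemma spl_stable k c0 : exists K, 0 < K /\ forall t d N h, grid t d N h c0 -> (S k <= d)%nat ->
  forall j c M, (d <= j < d + N)%nat ->
  (forall x, t j <= x <= t (S j) -> Rabs (spl t d N (S k) c x) <= M) ->
  forall i, (i <= j <= i + S k)%nat -> Rabs (c i) <= K * M.
Proof.
  induction k.
  - exists 1; split; [lra |]; intros t d N h G Hk j c M Hj HM i Hi.
    assert (K := grid_knots _ _ _ _ _ G). rewrite Rmult_1_l.
    destruct (Nat.eq_dec i j) as [-> | Hn].
    + assert (Kj := K j). assert (Kj' := K (S j)).
      replace (c j) with (spl t d N 1 c (t (S j))); [apply HM; lra |].
      rewrite (spl1_eq t d N c j) by (auto; try lia; lra). field; lra.
    + assert (j = S i) as -> by lia.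
      assert (Kj := K (S i)).
      replace (c i) with (spl t d N 1 c (t (S i))); [apply HM; lra |].
      rewrite (spl1_eq t d N c i) by (auto; try lia; lra). field; lra.
  - destruct IHk as [K1 [HK1 IH]].
    destruct (Pol_markov (S (S k))) as [K2 [HK2 Mk]].
    set (s := INR (S (S k))).
    assert (Hs : 1 <= s).
    { unfold s; replace 1 with (INR 1) by reflexivity; apply le_INR; lia. }
    (* The absolute value is taken because the constant is chosen before [grid] provides 1 <= c0. *)
    exists (1 + 2 * s * (K1 * K2 * Rabs c0)).
    assert (0 <= K1 * K2 * Rabs c0).
    { apply Rmult_le_pos; [nra | apply Rabs_pos]. }
    split; [nra |].
    intros t d N h G Hk j c M Hj HM.
    assert (K := grid_knots _ _ _ _ _ G).
    assert (G' := G). destruct G' as [Hh [Hc0 [Gj [E0 E1]]]].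
    rewrite (Rabs_right c0) in * by lra.
    assert (Kj := K j). destruct (Gj j) as [Gj1 Gj2].
    set (de := t (S j) - t j) in *. assert (Hde : 0 < de) by (unfold de; lra).
    assert (M0 : 0 <= M).
    { eapply Rle_trans; [apply Rabs_pos | apply (HM (t j)); lra]. }
    assert (Hel : 0 <= t j /\ t (S j) <= 1).
    { split; [rewrite <- E0 | rewrite <- E1]; apply knots_le; auto; lia. }
    set (D := K1 * K2 * c0 * M).
    assert (HD : 0 <= D) by (unfold D; apply Rmult_le_pos; auto).
    assert (Hdiff : forall i, (i < j <= i + S (S k))%nat -> Rabs (c (S i) - c i) <= D).
    { intros i Hi.
      destruct (spl_Pol t d N (S k) c j K) as [p [Hp Ep]].
      destruct (Pol_derive (S k) p Hp) as [p' [_ Dp]].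
      assert (Hd : forall x, t j <= x <= t (S j) ->
         Rabs (spl t d N (S k) (dcoef t (S k) c) x) <= K2 / de * M).
      { intros x Hx. replace (spl t d N (S k) (dcoef t (S k) c) x) with (p' x).
        - apply (Mk p p' (t j) (t (S j)) M); auto.
          intros y Hy; rewrite <- Ep by auto; apply HM, Hy.
        - apply (is_derive_on_unique (t j) (t (S j)) (spl t d N (S (S k)) c) x); auto.
          + apply (is_derive_on_of_is_derive _ _ _ p); auto. intros; symmetry; auto.
          + apply (is_derive_on_of_is_derive _ _ _ (spl t d N (S (S k)) c)); auto.
            eapply is_derive_spl; eauto; lra. }
      assert (B := IH t d N h G ltac:(lia) j _ _ Hj Hd (S i) ltac:(lia)).
      unfold dcoef in B; simpl prev in B. fold s in B.
      assert (Q : t (S i) < t (S i + S (S k))%nat) by (apply knots_lt; auto; lia).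
      assert (Q2 := grid_gap t d N h c0 (S i) (S (S k)) G). fold s in Q2.
      set (q := t (S i + S (S k))%nat - t (S i)) in *.
      assert (Hq : 0 < q) by (unfold q; lra).
      unfold Rdiv in B. rewrite !Rabs_mult, (Rabs_right s), (Rabs_right (/ q)) in B.
      2:{ apply Rle_ge, Rlt_le, Rinv_0_lt_compat, Hq. }
      2: lra.
      apply (Rmult_le_reg_l s); [lra |].
      apply Rle_trans with (K1 * (K2 / de * M) * q).
      - apply (Rmult_le_reg_r (/ q)); [apply Rinv_0_lt_compat, Hq |].
        replace (K1 * (K2 / de * M) * q * / q) with (K1 * (K2 / de * M)) by (field; split; lra).
        exact B.
      - apply Rle_trans with (K1 * (K2 / de * M) * (s * h)).
        + apply Rmult_le_compat_l; auto. apply Rmult_le_pos; [lra |].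
          apply Rmult_le_pos; auto. apply Rlt_le, Rdiv_lt_0_compat; auto; lra.
        + unfold D. replace (K1 * (K2 / de * M) * (s * h)) with (s * (K1 * K2 * (h / de) * M))
            by (field; unfold de; lra).
          apply Rmult_le_compat_l; [lra |]. apply Rmult_le_compat_r; auto.
          apply Rmult_le_compat_l; [nra |].
          apply (Rmult_le_reg_r de); [unfold de; lra |].
          replace (h / de * de) with h by (field; unfold de; lra). exact Gj1. }
    assert (Hfar : forall m i, (i + m = j)%nat -> (m <= S (S k))%nat ->
       Rabs (c i - c j) <= INR m * D).
    { induction m; intros i Hi Hm.
      - replace j with i by lia. rewrite Rminus_diag, Rabs_R0; simpl; lra.
      - assert (B1 := IHm (S i) ltac:(lia) ltac:(lia)).
        assert (B2 := Hdiff i ltac:(lia)).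
        rewrite S_INR. replace (c i - c j) with ((c (S i) - c j) - (c (S i) - c i)) by ring.
        eapply Rle_trans; [apply Rabs_triang |]. rewrite Rabs_Ropp. lra. }
    assert (Hfar' : forall i, (i <= j <= i + S (S k))%nat -> Rabs (c i - c j) <= s * D).
    { intros i Hi. eapply Rle_trans; [apply (Hfar (j - i)%nat); lia |].
      apply Rmult_le_compat_r; auto. apply le_INR; lia. }
    (* Subtracting the constant c_j leaves a spline whose active coefficients are at most s D; hence
       c_j differs from the value at t_j, which is at most M, by no more than s D. *)
    assert (Hcj : Rabs (c j) <= M + s * D).
    { assert (B : Rabs (spl t d N (S (S k)) (fun i => c i - c j) (t j)) <= s * D).
      { apply (comb_bspl_bound t (S (S k)) _ _ j); auto; [lia | lra]. }
      unfold Rminus in B.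
      rewrite (spl_add_const t d N h c0 (S (S k)) c (- c j)) in B by (auto; lra).
      specialize (HM (t j) ltac:(lra)).
      apply Rabs_le_between in B. apply Rabs_le_between in HM. apply Rabs_le_between. lra. }
    intros i Hi. specialize (Hfar' i Hi).
    replace ((1 + 2 * s * (K1 * K2 * c0)) * M) with (M + 2 * (s * D)) by (unfold D; ring).
    apply Rabs_le_between in Hfar'. apply Rabs_le_between in Hcj. apply Rabs_le_between. lra.
Qed.

(** * Splines as the smooth piecewise polynomials *)

Lemma Cm_on_ext a b m f g : a < b -> (forall x, a <= x <= b -> f x = g x) ->
  Cm_on a b m f -> Cm_on a b m g.
Proof.
  intros Hab; revert f g; induction m; intros f g E [H1 H2]; split.
  1, 3: apply continuous_on_cts; [lra |]; apply continuous_on_cts in H1; [| lra];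
    apply (cts_ext a b f); auto; lra.
  - exact I.
  - destruct H2 as [H2 H3]; split.
    + intros x Hx; destruct (H2 x Hx) as [l Hl]; exists l.
      apply (is_derive_on_ext a b f); auto.
    + apply (IHm (Derive_on a b f)); auto.
      intros x Hx; symmetry; apply Derive_on_eq; auto.
      apply (is_derive_on_ext a b f); auto. apply Derive_on_correct; auto.
Qed.

Lemma spl_Cm_on t d N h c0 k c : grid t d N h c0 -> (S k <= d)%nat ->
  Cm_on 0 1 k (spl t d N (S k) c).
Proof.
  intros G; assert (K := grid_knots _ _ _ _ _ G).
  revert c; induction k; intros c Hk; split.
  1, 3: apply continuous_on_cts; [lra |]; apply spl_cts, K.
  - exact I.
  - assert (D := dfn_spl t d N h c0 k c G Hk). split.
    + intros x Hx; eexists; apply D, Hx.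
    + apply (Cm_on_ext 0 1 k (spl t d N (S k) (dcoef t (S k) c))); [lra | | apply IHk; lia].
      intros x Hx; symmetry; apply Derive_on_eq; [lra | auto | apply D, Hx].
Qed.

(** The Curry-Schoenberg theorem, by induction on the degree: the derivative of phi is a spline, and
    the antiderivative with the value phi(0) at 0 has the same derivative as phi, so it equals
    phi. *)
Lemma spl_span t d N h c0 k phi : grid t d N h c0 -> (S k <= d)%nat -> Cm_on 0 1 k phi ->
  (forall j, (d <= j < d + N)%nat -> exists p, Pol (S k) p /\
     forall x, t j <= x <= t (S j) -> phi x = p x) ->
  exists c, forall x, 0 <= x <= 1 -> phi x = spl t d N (S k) c x.
Proof.
  intros G; assert (K := grid_knots _ _ _ _ _ G).
  revert phi; induction k; intros phi Hk C P.
  - exists (fun i => phi (t (S i))); intros x Hx.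
    destruct (grid_find t d N h c0 x G Hx) as [j [Hj Hxj]].
    destruct j as [| j]; [lia |]. rewrite (spl1_eq t d N _ j) by (auto; lia).
    destruct (Nat.eq_dec (S j) (d + N)) as [E | E].
    + destruct G as [_ [_ [_ [_ E1]]]]. rewrite <- E in E1.
      assert (x = t (S j)) by lra. subst x. field. lra.
    + destruct (P (S j) ltac:(lia)) as [p [[a [q [[b Hb] Hq]]] Ep]].
      rewrite !Ep by lra. rewrite !Hq, !Hb. field; lra.
  - destruct C as [_ [C1 C2]].
    assert (D : dfn 0 1 phi (Derive_on 0 1 phi)).
    { intros x Hx; apply Derive_on_correct; auto; lra. }
    destruct (IHk (Derive_on 0 1 phi)) as [a Ha]; [lia | auto | |].
    { intros j Hj; destruct (P j Hj) as [p [Hp Ep]].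
      destruct (Pol_derive _ p Hp) as [p' [Hp' Dp]].
      exists p'; split; auto. intros x Hx.
      assert (Hel : 0 <= t j /\ t (S j) <= 1).
      { destruct G as [_ [_ [_ [E0 E1]]]].
        split; [rewrite <- E0 | rewrite <- E1]; apply knots_le; auto; lia. }
      apply (is_derive_on_unique (t j) (t (S j)) phi x); [apply K | auto | |].
      - apply (is_derive_on_sub 0 1); try lra. apply D; lra.
      - apply (is_derive_on_of_is_derive _ _ _ p); auto. intros; symmetry; auto. }
    destruct (spl_antiderivative t d N h c0 k a (phi 0) G Hk) as [c [Dc Ec]].
    exists c; intros x Hx.
    assert (Dd : dfn 0 1 (fun y => phi y - spl t d N (S (S k)) c y)
       (fun y => Derive_on 0 1 phi y - spl t d N (S k) a y)).
    { intros y Hy; apply is_derive_on_minus; auto. }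
    destruct (dfn_MVT 0 1 _ _ 0 x Dd) as [z [Hz E]]; try lra.
    rewrite Ha in E by lra. lra.
Qed.

(** * Approximation by splines *)

Lemma spl_plus t d N k c e x :
  spl t d N k (fun i => c i + e i) x = spl t d N k c x + spl t d N k e x.
Proof.
  unfold spl, comb; rewrite <- sumn_plus; apply sumn_ext; intros; ring.
Qed.

Lemma spl_scal t d N k c y x : spl t d N k (fun i => y * c i) x = y * spl t d N k c x.
Proof.
  unfold spl, comb; rewrite <- sumn_scal; apply sumn_ext; intros; ring.
Qed.

Lemma spl_minus t d N k c e x :
  spl t d N k (fun i => c i - e i) x = spl t d N k c x - spl t d N k e x.
Proof.
  unfold spl, comb; rewrite <- sumn_minus; apply sumn_ext; intros; ring.
Qed.

(* Sampling point of the i-th B-spline; it is 0 for all B-splines that do not vanish at 0. *)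
Definition node (t : nat -> R) (i : nat) : R := clamp 0 1 (t i).

Lemma node_in t i : 0 <= node t i <= 1.
Proof. apply clamp_in; lra. Qed.

Lemma node_close t d N h c0 k i j x : grid t d N h c0 -> 0 <= x <= 1 -> t j <= x < t (S j) ->
  (i <= j <= i + k)%nat -> Rabs (x - node t i) <= INR (S k) * h.
Proof.
  intros G Hx Hxj Hi; assert (K := grid_knots _ _ _ _ _ G).
  rewrite <- (clamp_id 0 1 x Hx) at 1.
  eapply Rle_trans; [apply clamp_lipschitz |].
  assert (t i <= t j) by (apply knots_le; auto; lia).
  rewrite Rabs_right by lra.
  assert (Q := grid_gap t d N h c0 i (S k) G).
  assert (t (S j) <= t (i + S k)%nat) by (apply knots_le; auto; lia). lra.
Qed.

Lemma node_at_0 t d N h c0 i : grid t d N h c0 -> (i <= d)%nat -> node t i = 0.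
Proof.
  intros G Hi; assert (K := grid_knots _ _ _ _ _ G). destruct G as [_ [_ [_ [E0 _]]]].
  assert (t i <= t d) by (apply knots_le; auto).
  unfold node, clamp; rewrite Rmin_right, Rmax_left; lra.
Qed.

Lemma dcoef_plus t k c e i : dcoef t k (fun i => c i + e i) i = dcoef t k c i + dcoef t k e i.
Proof. unfold dcoef, Rdiv; destruct i; simpl prev; ring. Qed.

(* The antiderivative of the approximation of f' leaves an error with derivative of size eps,
   which is removed up to O(eps h) by sampling at the nodes. *)
Lemma spl_approx_step t d N h c0 k f f' a eps : grid t d N h c0 -> (S (S k) <= d)%nat ->
  dfn 0 1 f f' -> (forall x, 0 <= x <= 1 -> Rabs (f' x - spl t d N (S k) a x) <= eps) ->
  exists c, (forall x, 0 <= x <= 1 ->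
      Rabs (f x - spl t d N (S (S k)) c x) <= INR (S (S (S k))) * h * eps) /\
    (forall x, 0 <= x <= 1 ->
      Rabs (f' x - spl t d N (S k) (dcoef t (S k) c) x) <= (1 + INR (S (S k)) * c0) * eps) /\
    spl t d N (S (S k)) c 0 = f 0.
Proof.
  intros G Hk D Ha; assert (K := grid_knots _ _ _ _ _ G).
  assert (G' := G); destruct G' as [Hh [Hc0 [Gj [E0 E1]]]].
  assert (He : 0 <= eps) by (eapply Rle_trans; [apply Rabs_pos | apply (Ha 0); lra]).
  destruct (spl_antiderivative t d N h c0 k a (f 0) G Hk) as [c1 [D1 E]].
  set (g := fun x => f x - spl t d N (S (S k)) c1 x).
  assert (Dg : dfn 0 1 g (fun x => f' x - spl t d N (S k) a x)).
  { intros x Hx; apply is_derive_on_minus; auto. }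
  assert (Lg : forall x y, 0 <= x <= 1 -> 0 <= y <= 1 -> Rabs (g x - g y) <= Rabs (x - y) * eps).
  { assert (Lg' : forall x y, 0 <= x -> x <= y -> y <= 1 -> Rabs (g y - g x) <= (y - x) * eps).
    { intros x y H1 H2 H3; destruct (dfn_MVT 0 1 _ _ x y Dg H1 H2 H3) as [z [Hz Ez]].
      rewrite Ez, Rabs_mult, (Rabs_right (y - x)), Rmult_comm by lra.
      apply Rmult_le_compat_l; [lra | apply Ha; lra]. }
    intros x y Hx Hy; destruct (Rle_dec x y).
    - rewrite Rabs_minus_sym, (Rabs_minus_sym x), (Rabs_right (y - x)) by lra.
      apply Lg'; lra.
    - rewrite (Rabs_right (x - y)) by lra. apply Lg'; lra. }
  set (e := fun i => g (node t i)).
  exists (fun i => c1 i + e i); repeat split.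
  - intros x Hx; rewrite spl_plus.
    (* By the partition of unity the error is minus the spline with coefficients g(node_i) - g(x),
       of which only nodes within (k+3) h of x are active. *)
    replace (f x - (spl t d N (S (S k)) c1 x + spl t d N (S (S k)) e x))
      with (- (spl t d N (S (S k)) e x + - g x)) by (unfold g; ring).
    rewrite Rabs_Ropp, <- (spl_add_const t d N h c0) by auto.
    destruct (grid_find t d N h c0 x G Hx) as [j [Hj Hxj]].
    apply (comb_bspl_bound t (S (S k)) _ _ j); auto; [lia |].
    intros i Hi Hij. unfold e. fold (g (node t i) - g x).
    eapply Rle_trans; [apply Lg; auto using node_in |].
    rewrite Rabs_minus_sym. apply Rmult_le_compat_r; auto.
    apply (node_close t d N h c0 (S (S k)) i j); auto.
  - intros x Hx.
    replace (spl t d N (S k) (dcoef t (S k) (fun i => c1 i + e i)) x)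
      with (spl t d N (S k) (fun i => dcoef t (S k) c1 i + dcoef t (S k) e i) x)
      by (apply sumn_ext; intros; rewrite dcoef_plus; reflexivity).
    rewrite spl_plus.
    replace (spl t d N (S k) (dcoef t (S k) c1) x) with (spl t d N (S k) a x).
    2:{ apply (is_derive_on_unique 0 1 (spl t d N (S (S k)) c1) x); [lra | auto | |].
        - apply D1, Hx.
        - apply (dfn_spl t d N h c0); auto. }
    destruct (grid_find t d N h c0 x G Hx) as [j [Hj Hxj]].
    assert (B : Rabs (spl t d N (S k) (dcoef t (S k) e) x) <= INR (S (S k)) * c0 * eps).
    { apply (comb_bspl_bound t (S k) _ _ j); auto; [lia |].
      intros i _ _. unfold dcoef.
      (* Neighbouring nodes are at most h apart and g has Lipschitz constant eps, while the knot
         difference dividing in [dcoef] is at least h/c0. So sampling g changes the derivative only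
         by O(eps). *)
      assert (Hp : Rabs (e i - prev e i) <= h * eps).
      { destruct i as [| i]; simpl prev; [rewrite Rminus_diag, Rabs_R0; nra |].
        eapply Rle_trans; [apply Lg; apply node_in |].
        apply Rmult_le_compat_r; auto. eapply Rle_trans; [apply clamp_lipschitz |].
        destruct (Gj i). specialize (K i). rewrite Rabs_right; lra. }
      assert (Q : t (S i) <= t (i + S (S k))%nat) by (apply knots_le; auto; lia).
      assert (Ki := K i). destruct (Gj i) as [Gi _].
      set (q := t (i + S (S k))%nat - t i). assert (Hq : 0 < q) by (unfold q; lra).
      assert (Hhq : h <= c0 * q) by (unfold q; nra).
      unfold Rdiv; rewrite !Rabs_mult, (Rabs_right (/ q)).
      2:{ apply Rle_ge, Rlt_le, Rinv_0_lt_compat, Hq. }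
      assert (Hs : 0 <= INR (S (S k))) by apply pos_INR.
      rewrite (Rabs_right (INR _)) by lra.
      apply (Rmult_le_reg_r q); auto. rewrite Rmult_assoc, Rinv_l by lra.
      rewrite Rmult_1_r, !Rmult_assoc. apply Rmult_le_compat_l; auto. nra. }
    replace (f' x - (spl t d N (S k) a x + spl t d N (S k) (dcoef t (S k) e) x))
      with ((f' x - spl t d N (S k) a x) - spl t d N (S k) (dcoef t (S k) e) x) by ring.
    specialize (Ha x Hx). apply Rabs_le_between in Ha. apply Rabs_le_between in B.
    apply Rabs_le_between. lra.
  - rewrite spl_plus, E.
    (* All B-splines active at 0 have the node 0, where g vanishes; the correction therefore
       preserves the boundary value. *)
    assert (B : Rabs (spl t d N (S (S k)) e 0) <= 0).
    { apply (comb_bspl_bound t (S (S k)) _ _ d); auto; [lia | specialize (K d); lra |].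
      intros i _ Hi. unfold e. rewrite (node_at_0 t d N h c0) by (auto; lia).
      unfold g; rewrite E, Rminus_diag, Rabs_R0; lra. }
    apply Rabs_le_between in B; lra.
Qed.

(** F j plays the part of the j-th derivative. The base case is linear interpolation; each further
    degree approximates F 1 first, integrates, and gains a factor h by [spl_approx_step]. *)
Lemma spl_approx k : exists K, 0 < K /\ forall t d N h c0, grid t d N h c0 -> (S k <= d)%nat ->
  forall F M, (forall j, (j <= S k)%nat -> dfn 0 1 (F j) (F (S j))) ->
  (forall x, 0 <= x <= 1 -> Rabs (F (S (S k)) x) <= M) ->
  exists c, forall x, 0 <= x <= 1 -> Rabs (F O x - spl t d N (S k) c x) <= K * M * h ^ (S (S k)).
Proof.
  induction k.
  - exists 1; split; [lra |]; intros t d N h c0 G Hk F M D HM.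
    assert (K := grid_knots _ _ _ _ _ G).
    exists (fun i => F O (t (S i))); intros x Hx.
    assert (M0 : 0 <= M) by (eapply Rle_trans; [apply Rabs_pos | apply (HM x Hx)]).
    destruct (grid_find t d N h c0 x G Hx) as [j [Hj Hxj]].
    destruct j as [| j]; [lia |]. rewrite (spl1_eq t d N _ j) by (auto; lia).
    assert (G' := G); destruct G' as [Hh [Hc0 [Gj [E0 E1]]]].
    destruct (Nat.eq_dec (S j) (d + N)) as [E | E].
    + rewrite <- E in E1. assert (x = t (S j)) by lra. subst x.
      match goal with |- Rabs ?z <= _ => replace z with 0 by (field; lra) end.
      rewrite Rabs_R0. simpl; nra.
    + set (u := t (S j)) in *. set (v := t (S (S j))) in *.
      assert (Hu : 0 <= u) by (unfold u; rewrite <- E0; apply knots_le; auto; lia).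
      assert (Hv : v <= 1) by (unfold v; rewrite <- E1; apply knots_le; auto; lia).
      destruct (Gj (S j)) as [_ Hg]; fold u v in Hg.
      destruct (dfn_MVT 0 1 _ _ u x (D O ltac:(lia))) as [z1 [Hz1 Ez1]]; try lra.
      destruct (dfn_MVT 0 1 _ _ x v (D O ltac:(lia))) as [z2 [Hz2 Ez2]]; try lra.
      destruct (dfn_MVT 0 1 _ _ z1 z2 (D 1%nat ltac:(lia))) as [z3 [Hz3 Ez3]]; try lra.
      (* Mean value points on either side of x express the interpolation error through a difference
         of first derivatives, and that difference is a second derivative times at most h. *)
      replace (F O x - (F O u * (v - x) + F O v * (x - u)) / (v - u))
        with (- ((x - u) * (v - x) / (v - u) * (F 1%nat z2 - F 1%nat z1))).
      2:{ replace (F O u) with (F O x - F 1%nat z1 * (x - u)) by lra.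
          replace (F O v) with (F O x + F 1%nat z2 * (v - x)) by lra. field; lra. }
      rewrite Rabs_Ropp, Ez3, !Rabs_mult.
      specialize (HM z3 ltac:(lra)).
      assert (B1 : Rabs ((x - u) * (v - x) / (v - u)) <= h).
      { rewrite Rabs_right.
        - apply (Rmult_le_reg_r (v - u)); [lra |].
          unfold Rdiv; rewrite Rmult_assoc, Rinv_l by lra. nra.
        - apply Rle_ge, Rdiv_le_0_compat; [apply Rmult_le_pos |]; lra. }
      assert (B2 : Rabs (z2 - z1) <= h) by (rewrite Rabs_right; lra).
      replace (1 * M * h ^ 2) with (h * (M * h)) by ring.
      apply Rmult_le_compat; auto using Rabs_pos.
      + apply Rmult_le_pos; apply Rabs_pos.
      + apply Rmult_le_compat; auto using Rabs_pos.
  - destruct IHk as [K [HK IH]].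
    exists (INR (S (S (S k))) * K); split.
    { apply Rmult_lt_0_compat; auto. apply lt_0_INR; lia. }
    intros t d N h c0 G Hk F M D HM.
    destruct (IH t d N h c0 G ltac:(lia) (fun j => F (S j)) M) as [a Ha]; auto.
    { intros j Hj; apply D; lia. }
    destruct (spl_approx_step t d N h c0 k (F O) (F 1%nat) a _ G Hk (D O ltac:(lia)) Ha)
      as [c [Hc _]].
    exists c; intros x Hx. eapply Rle_trans; [apply Hc, Hx |].
    right; simpl pow; ring.
Qed.

(** A last step, started from an approximation of F 1, also bounds the derivative and reproduces the
    value at 0; the latter puts the approximant in S_h when F 0 vanishes there. *)
Lemma spl_approx_C1 k c0 : exists K, 0 < K /\
  forall t d N h, grid t d N h c0 -> (S (S k) <= d)%nat ->
  forall F M, (forall j, (j <= S (S k))%nat -> dfn 0 1 (F j) (F (S j))) ->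
  (forall x, 0 <= x <= 1 -> Rabs (F (S (S (S k))) x) <= M) ->
  exists c, (forall x, 0 <= x <= 1 ->
      Rabs (F O x - spl t d N (S (S k)) c x) <= K * M * h ^ (S (S (S k)))) /\
    (forall x, 0 <= x <= 1 ->
      Rabs (F 1%nat x - spl t d N (S k) (dcoef t (S k) c) x) <= K * M * h ^ (S (S k))) /\
    spl t d N (S (S k)) c 0 = F O 0.
Proof.
  destruct (spl_approx k) as [K [HK A]].
  set (s := INR (S (S (S k)))). set (s' := INR (S (S k))).
  assert (Hs : 0 <= s) by apply pos_INR. assert (Hs' : 0 <= s') by apply pos_INR.
  assert (Hc := Rabs_pos c0).
  exists ((s + (1 + s' * Rabs c0)) * K); split; [apply Rmult_lt_0_compat; nra |].
  intros t d N h G Hk F M D HM.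
  destruct (A t d N h c0 G ltac:(lia) (fun j => F (S j)) M) as [a Ha]; auto.
  { intros j Hj; apply D; lia. }
  destruct (spl_approx_step t d N h c0 k (F O) (F 1%nat) a _ G Hk (D O ltac:(lia)) Ha)
    as [c [H1 [H2 H3]]].
  assert (Hh : 0 < h) by apply G. assert (Hc0 : 1 <= c0) by apply G.
  assert (M0 : 0 <= M) by (eapply Rle_trans; [apply Rabs_pos | apply (HM 0); lra]).
  rewrite (Rabs_right c0) in * by lra.
  assert (P : 0 <= K * M * h ^ S (S k)).
  { apply Rmult_le_pos; [nra | apply pow_le; lra]. }
  exists c; repeat split; auto; intros x Hx.
  - eapply Rle_trans; [apply H1, Hx |]. fold s.
    replace (s * h * (K * M * h ^ S (S k))) with (s * (h * (K * M * h ^ S (S k)))) by ring.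
    replace ((s + (1 + s' * c0)) * K * M * h ^ S (S (S k)))
      with ((s + (1 + s' * c0)) * (h * (K * M * h ^ S (S k)))) by (simpl pow; ring).
    apply Rmult_le_compat_r; [nra |]. nra.
  - eapply Rle_trans; [apply H2, Hx |]. fold s'.
    replace ((s + (1 + s' * c0)) * K * M * h ^ S (S k))
      with ((s + (1 + s' * c0)) * (K * M * h ^ S (S k))) by ring.
    apply Rmult_le_compat_r; nra.
Qed.

(** * Inverse inequalities and superapproximation *)

Lemma RInt_cts_le_interior a b f g : a <= b -> cts a b f -> cts a b g ->
  (forall x, a < x < b -> f x <= g x) -> RInt f a b <= RInt g a b.
Proof. intros; apply RInt_le; auto using cts_ex_RInt. Qed.

Lemma grid_elements t d N h c0 j : grid t d N h c0 -> (d <= j < d + N)%nat ->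
  0 <= t j /\ t (S j) <= 1.
Proof.
  intros G Hj; assert (K := grid_knots _ _ _ _ _ G). destruct G as [_ [_ [_ [E0 E1]]]].
  split; [rewrite <- E0 | rewrite <- E1]; apply knots_le; auto; lia.
Qed.

Lemma RInt_elements t d N h c0 f : grid t d N h c0 -> cts 0 1 f ->
  RInt f 0 1 = sumn N (fun m => RInt f (t (d + m)%nat) (t (S (d + m)))).
Proof.
  intros G C; assert (K := grid_knots _ _ _ _ _ G). assert (G' := G).
  destruct G' as [_ [_ [_ [E0 E1]]]]. rewrite <- E0 at 1. rewrite <- E1 at 1.
  assert (H : forall m, (m <= N)%nat ->
     RInt f (t d) (t (d + m)%nat) = sumn m (fun m => RInt f (t (d + m)%nat) (t (S (d + m))))).
  { induction m; intros Hm.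
    - rewrite Nat.add_0_r, RInt_point; reflexivity.
    - cbn [sumn]. rewrite <- IHm by lia. rewrite Nat.add_succ_r.
      symmetry; apply RInt_cts_Chasles.
      + apply knots_le; auto; lia.
      + left; apply K.
      + apply (cts_sub 0 1); auto; [lra | apply knots_le; auto; lia |].
        rewrite <- E1; apply knots_le; auto; lia. }
  apply H; lia.
Qed.

(** Integrating the pointwise bound over an element cancels the length in the denominator, so no
    power of h is lost in the passage from local to global. *)
Lemma L2_from_elements t d N h c0 f g A : grid t d N h c0 -> cts 0 1 f -> cts 0 1 g ->
  (forall j, (d <= j < d + N)%nat -> forall x, t j < x < t (S j) ->
     g x ^ 2 <= A / (t (S j) - t j) * RInt (fun z => f z ^ 2) (t j) (t (S j))) ->
  RInt (fun z => g z ^ 2) 0 1 <= A * RInt (fun z => f z ^ 2) 0 1.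
Proof.
  intros G Cf Cg H; assert (K := grid_knots _ _ _ _ _ G).
  rewrite !(RInt_elements t d N h c0 _ G) by auto with cts.
  rewrite <- sumn_scal. apply sumn_le; intros m Hm.
  set (j := (d + m)%nat). assert (Hj : (d <= j < d + N)%nat) by (unfold j; lia).
  assert (Kj := K j). destruct (grid_elements t d N h c0 j G Hj).
  set (J := RInt (fun z => f z ^ 2) (t j) (t (S j))).
  eapply Rle_trans.
  - apply (RInt_cts_le_interior _ _ _ (fun _ => A / (t (S j) - t j) * J)); [lra | | | apply H, Hj].
    + apply (cts_sub 0 1); auto with cts; lra.
    + apply cts_const.
  - rewrite (RInt_const_len _ _ _ (t (S j) - t j)) by reflexivity.
    right. change (A / (t (S j) - t j) * (J : R) * (t (S j) - t j) = A * (J : R)). field; lra.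
Qed.

Lemma spl_sup_element k c0 : exists K, 0 < K /\ forall t d N h, grid t d N h c0 ->
  forall c j x, t j <= x <= t (S j) ->
  spl t d N (S k) c x ^ 2 <=
    K / (t (S j) - t j) * RInt (fun z => spl t d N (S k) c z ^ 2) (t j) (t (S j)).
Proof.
  destruct (Pol_sup_L2 (S k) 1) as [K [HK B]]; [lra |].
  exists K; split; auto. intros t d N h G c j x Hx.
  assert (Kn := grid_knots _ _ _ _ _ G). assert (Kj := Kn j).
  destruct (spl_Pol t d N k c j Kn) as [p [Hp E]].
  rewrite (RInt_on_ext _ _ _ (fun z => p z ^ 2)); [| lra | intros; rewrite E; auto; lra].
  rewrite E by lra. apply B; auto. rewrite Rabs_right; lra.
Qed.

Lemma L2_element_le t d N h c0 f j : grid t d N h c0 -> (d <= j < d + N)%nat -> cts 0 1 f ->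
  RInt (fun z => f z ^ 2) (t j) (t (S j)) <= RInt (fun z => f z ^ 2) 0 1.
Proof.
  intros G Hj C. destruct (grid_elements t d N h c0 j G Hj).
  assert (Kj := grid_knots _ _ _ _ _ G j).
  rewrite <- (RInt_cts_Chasles 0 (t j) 1), <- (RInt_cts_Chasles (t j) (t (S j)) 1);
    auto with cts; try lra; [| apply (cts_sub 0 1); auto with cts; lra].
  assert (0 <= RInt (fun z => f z ^ 2) 0 (t j)).
  { apply RInt_cts_nonneg; auto; [apply (cts_sub 0 1); auto with cts; lra |].
    intros; apply pow2_ge_0. }
  assert (0 <= RInt (fun z => f z ^ 2) (t (S j)) 1).
  { apply RInt_cts_nonneg; auto; [apply (cts_sub 0 1); auto with cts; lra |].
    intros; apply pow2_ge_0. }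
  lra.
Qed.

Lemma L2_element_nonneg t j f : knots t -> cts (t j) (t (S j)) f ->
  0 <= RInt (fun z => f z ^ 2) (t j) (t (S j)).
Proof.
  intros K C; apply RInt_cts_nonneg; [left; apply K | auto with cts | intros; apply pow2_ge_0].
Qed.

Lemma grid_find_element t d N h c0 x : grid t d N h c0 -> 0 <= x <= 1 ->
  exists j, (d <= j < d + N)%nat /\ t j <= x <= t (S j).
Proof.
  intros G Hx; assert (K := grid_knots _ _ _ _ _ G).
  destruct (grid_find t d N h c0 x G Hx) as [j [Hj Hxj]].
  destruct (Nat.eq_dec j (d + N)) as [E | E]; [| exists j; split; [lia | lra]].
  destruct G as [_ [_ [_ [E0 E1]]]]. subst j.
  destruct N as [| N]; [rewrite Nat.add_0_r in *; lra |].
  exists (d + N)%nat; split; [lia |]. rewrite Nat.add_succ_r in *.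
  specialize (K (d + N)%nat); lra.
Qed.

Lemma spl_sup_element_markov k c0 : exists K, 0 < K /\ forall t d N h, grid t d N h c0 ->
  (S (S k) <= d)%nat -> forall c j x, (d <= j < d + N)%nat -> t j <= x <= t (S j) ->
  spl t d N (S k) (dcoef t (S k) c) x ^ 2 <=
    K / h ^ 2 / (t (S j) - t j)
      * RInt (fun z => spl t d N (S (S k)) c z ^ 2) (t j) (t (S j)).
Proof.
  destruct (spl_sup_element (S k) c0) as [K1 [HK1 B1]].
  destruct (Pol_markov (S (S k))) as [K2 [HK2 B2]].
  (* The summand 1 keeps the constant positive before [grid] excludes c0 = 0. The rest comes from
     Markov's inequality applied to the supremum bound on one element, with 1/de <= c0/h. *)
  exists ((K2 * Rabs c0) ^ 2 * K1 + 1). split.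
  { assert (0 <= (K2 * Rabs c0) ^ 2) by apply pow2_ge_0. nra. }
  intros t d N h G Hk c j x Hj Hx.
  assert (Kn := grid_knots _ _ _ _ _ G). assert (Kj := Kn j).
  destruct (grid_elements t d N h c0 j G Hj) as [L0 L1].
  assert (G' := G); destruct G' as [Hh [Hc0 [Gj _]]]. destruct (Gj j) as [Gj1 Gj2].
  rewrite (Rabs_right c0) by lra.
  assert (J0 : exists J : R, J = RInt (fun z => spl t d N (S (S k)) c z ^ 2) (t j) (t (S j)))
    by eauto.
  destruct J0 as [J EJ].
  assert (J0 : 0 <= J).
  { rewrite EJ; apply L2_element_nonneg; auto; apply spl_cts, Kn. }
  set (de := t (S j) - t j) in *. assert (Hde : 0 < de) by (unfold de; lra).
  assert (KJ : 0 <= K1 / de * J).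
  { apply Rmult_le_pos; auto. apply Rlt_le, Rdiv_lt_0_compat; lra. }
  set (M := sqrt (K1 / de * J)).
  assert (HM : M ^ 2 = K1 / de * J) by (unfold M; apply pow2_sqrt, KJ).
  assert (M0 : 0 <= M) by apply sqrt_pos.
  destruct (spl_Pol t d N (S k) c j Kn) as [p [Hp Ep]].
  destruct (Pol_derive (S k) p Hp) as [p' [_ Dp]].
  assert (Hpx : Rabs (p' x) <= K2 / de * M).
  { apply (B2 p p' (t j) (t (S j)) M); auto.
    intros y Hy. rewrite <- Ep by auto.
    apply Rsqr_incr_0_var; auto. rewrite <- Rsqr_abs, !Rsqr_pow2, HM, EJ.
    apply (B1 t d N h G c j y Hy). }
  replace (spl t d N (S k) (dcoef t (S k) c) x) with (p' x).
  2:{ apply (is_derive_on_unique (t j) (t (S j)) (spl t d N (S (S k)) c) x); auto.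
      + apply (is_derive_on_of_is_derive _ _ _ p); auto. intros; symmetry; auto.
      + apply (is_derive_on_of_is_derive _ _ _ (spl t d N (S (S k)) c)); auto.
        eapply is_derive_spl; eauto; lra. }
  rewrite <- EJ.
  assert (Hi : K2 / de <= K2 * c0 / h).
  { apply (Rmult_le_reg_r (de * h)); [nra |].
    replace (K2 / de * (de * h)) with (K2 * h) by (field; lra).
    replace (K2 * c0 / h * (de * h)) with (K2 * (c0 * de)) by (field; lra). nra. }
  apply Rle_trans with ((K2 * c0 / h * M) ^ 2).
  - apply pow_maj_Rabs. eapply Rle_trans; [exact Hpx |].
    apply Rmult_le_compat_r; auto.
  - rewrite Rpow_mult_distr, HM.
    replace ((K2 * c0 / h) ^ 2 * (K1 / de * J)) with ((K2 * c0) ^ 2 * K1 * (J / h ^ 2 / de))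
      by (field; lra).
    replace (((K2 * c0) ^ 2 * K1 + 1) / h ^ 2 / de * J)
      with (((K2 * c0) ^ 2 * K1 + 1) * (J / h ^ 2 / de)) by (field; lra).
    apply Rmult_le_compat_r; [| lra].
    apply Rdiv_le_0_compat; auto. apply Rdiv_le_0_compat; auto. apply pow_lt, Hh.
Qed.

(** The supremum bounds come from a single element and pay a factor 1/h for its length; the L^2
    bound sums over all elements and pays nothing beyond Markov's 1/h^2. *)
Lemma spl_inverse k c0 : exists K, 0 < K /\ forall t d N h, grid t d N h c0 ->
  (S (S k) <= d)%nat -> forall c,
  let J := RInt (fun z => spl t d N (S (S k)) c z ^ 2) 0 1 in
  (forall x, 0 <= x <= 1 -> spl t d N (S (S k)) c x ^ 2 <= K / h * J) /\
  (forall x, 0 <= x <= 1 -> spl t d N (S k) (dcoef t (S k) c) x ^ 2 <= K / h ^ 3 * J) /\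
  RInt (fun z => spl t d N (S k) (dcoef t (S k) c) z ^ 2) 0 1 <= K / h ^ 2 * J.
Proof.
  destruct (spl_sup_element (S k) c0) as [K1 [HK1 B1]].
  destruct (spl_sup_element_markov k c0) as [K2 [HK2 B2]].
  exists ((K1 + K2) * Rmax 1 c0).
  assert (Hm1 := Rmax_l 1 c0). assert (Hm2 := Rmax_r 1 c0). set (m := Rmax 1 c0) in *.
  split; [nra |].
  intros t d N h G Hk c J0.
  assert (exists J : R, J = RInt (fun z => spl t d N (S (S k)) c z ^ 2) 0 1) as [J EJ] by eauto.
  unfold J0; rewrite <- EJ; clear J0.
  assert (Kn := grid_knots _ _ _ _ _ G).
  assert (G' := G); destruct G' as [Hh [Hc0 [Gj _]]].
  assert (Cs : cts 0 1 (spl t d N (S (S k)) c)) by apply spl_cts, Kn.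
  assert (J0 : 0 <= J).
  { rewrite EJ; apply RInt_cts_nonneg; auto with cts; [lra | intros; apply pow2_ge_0]. }
  assert (El : forall j A, (d <= j < d + N)%nat -> 0 <= A ->
    A / (t (S j) - t j) * RInt (fun z => spl t d N (S (S k)) c z ^ 2) (t j) (t (S j))
    <= A * m / h * J).
  { intros j A Hj HA. assert (Kj := Kn j). destruct (Gj j) as [Gj1 Gj2].
    assert (B := L2_element_le t d N h c0 _ j G Hj Cs). rewrite <- EJ in B.
    apply Rle_trans with (A / (t (S j) - t j) * J).
    - apply Rmult_le_compat_l; auto. apply Rdiv_le_0_compat; lra.
    - apply Rmult_le_compat_r; auto.
      apply (Rmult_le_reg_r ((t (S j) - t j) * h)); [apply Rmult_lt_0_compat; lra |].
      replace (A / (t (S j) - t j) * ((t (S j) - t j) * h)) with (A * h) by (field; lra).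
      replace (A * m / h * ((t (S j) - t j) * h)) with (A * (m * (t (S j) - t j))) by (field; lra).
      apply Rmult_le_compat_l; auto. nra. }
  assert (Hh2 : 0 < h ^ 2) by (apply pow_lt, Hh).
  split; [| split].
  - intros x Hx. destruct (grid_find_element t d N h c0 x G Hx) as [j [Hj Hxj]].
    eapply Rle_trans; [apply (B1 t d N h G c j x Hxj) |].
    eapply Rle_trans; [apply (El j K1 Hj); lra |].
    apply Rmult_le_compat_r; auto. apply Rmult_le_compat_r; [apply Rlt_le, Rinv_0_lt_compat, Hh |].
    nra.
  - intros x Hx. destruct (grid_find_element t d N h c0 x G Hx) as [j [Hj Hxj]].
    eapply Rle_trans; [apply (B2 t d N h G Hk c j x Hj Hxj) |].
    eapply Rle_trans; [apply (El j _ Hj); apply Rdiv_le_0_compat; lra |].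
    replace (K2 / h ^ 2 * m / h * J) with (K2 * m * (J / h ^ 3)) by (field; lra).
    replace ((K1 + K2) * m / h ^ 3 * J) with ((K1 + K2) * m * (J / h ^ 3)) by (field; lra).
    apply Rmult_le_compat_r; [| nra].
    apply Rdiv_le_0_compat; auto. apply pow_lt, Hh.
  - apply Rle_trans with (K2 / h ^ 2 * J).
    + rewrite EJ. apply (L2_from_elements t d N h c0); auto; [apply spl_cts, Kn |].
      intros j Hj x Hx. apply (B2 t d N h G Hk c j x Hj); lra.
    + apply Rmult_le_compat_r; auto. apply Rmult_le_compat_r; [apply Rlt_le, Rinv_0_lt_compat, Hh2 |].
      nra.
Qed.

(* Superapproximation: freezing w at the node of each B-spline costs O(h) relative to the
   coefficients, which are controlled locally by the spline itself. *)
Lemma spl_superapprox k c0 : exists K, 0 < K /\ forall t d N h, grid t d N h c0 ->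
  (S k <= d)%nat -> forall w L c, 0 <= L -> cts 0 1 w ->
  (forall x y, 0 <= x <= 1 -> 0 <= y <= 1 -> Rabs (w x - w y) <= L * Rabs (x - y)) ->
  exists c', spl t d N (S k) c' 0 = w 0 * spl t d N (S k) c 0 /\
    RInt (fun x => (w x * spl t d N (S k) c x - spl t d N (S k) c' x) ^ 2) 0 1
    <= K * (L * h) ^ 2 * RInt (fun x => spl t d N (S k) c x ^ 2) 0 1.
Proof.
  destruct (spl_sup_element k c0) as [K1 [HK1 B1]].
  destruct (spl_stable k c0) as [K2 [HK2 B2]].
  set (s := INR (S (S k))).
  assert (Hs : 0 < s) by (apply lt_0_INR; lia).
  (* On an element, w varies by at most L s h between x and an active node, the active coefficients
     are at most K2 M, and M^2 is K1 times the mean of the squared spline. *)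
  exists ((s * K2) ^ 2 * K1). split; [apply Rmult_lt_0_compat; auto; apply pow_lt; nra |].
  intros t d N h G Hk w L c HL Cw Lw.
  assert (Kn := grid_knots _ _ _ _ _ G).
  assert (G' := G); destruct G' as [Hh [Hc0 [Gj [E0 E1]]]].
  exists (fun i => w (node t i) * c i).
  assert (Eq : forall x, w x * spl t d N (S k) c x - spl t d N (S k) (fun i => w (node t i) * c i) x
     = spl t d N (S k) (fun i => (w x - w (node t i)) * c i) x).
  { intros x; rewrite <- spl_scal, <- spl_minus.
    apply sumn_ext; intros; ring. }
  split.
  (* At 0 every active node is 0, so freezing w there is exact and the boundary condition
     survives. *)
  - assert (B : Rabs (spl t d N (S k) (fun i => (w 0 - w (node t i)) * c i) 0) <= 0).
    { apply (comb_bspl_bound t (S k) _ _ d); auto; [lia | specialize (Kn d); lra |].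
      intros i _ Hi. rewrite (node_at_0 t d N h c0) by (auto; lia).
      rewrite Rminus_diag, Rmult_0_l, Rabs_R0; lra. }
    rewrite <- Eq in B. apply Rabs_le_between in B; lra.
  - apply (L2_from_elements t d N h c0); auto.
    { apply spl_cts, Kn. }
    { apply cts_minus; [apply cts_mult; auto |]; apply spl_cts, Kn. }
    intros j Hj x Hx. destruct (grid_elements t d N h c0 j G Hj) as [L0 L1].
    assert (Kj := Kn j).
    assert (exists J : R, J = RInt (fun z => spl t d N (S k) c z ^ 2) (t j) (t (S j)))
      as [J EJ] by eauto.
    assert (J0 : 0 <= J).
    { rewrite EJ; apply L2_element_nonneg; auto; apply spl_cts, Kn. }
    set (de := t (S j) - t j) in *. assert (Hde : 0 < de) by (unfold de; lra).
    assert (KJ : 0 <= K1 / de * J).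
    { apply Rmult_le_pos; auto. apply Rlt_le, Rdiv_lt_0_compat; lra. }
    set (M := sqrt (K1 / de * J)).
    assert (HM : M ^ 2 = K1 / de * J) by (unfold M; apply pow2_sqrt, KJ).
    assert (M0 : 0 <= M) by apply sqrt_pos.
    assert (Bc : forall i, (i <= j <= i + S k)%nat -> Rabs (c i) <= K2 * M).
    { intros i Hi. apply (B2 t d N h G Hk j c M Hj); auto.
      intros y Hy. apply Rsqr_incr_0_var; auto. rewrite <- Rsqr_abs, !Rsqr_pow2, HM, EJ.
      apply (B1 t d N h G c j y Hy). }
    rewrite <- EJ.
    apply Rle_trans with ((s * K2 * (L * h) * M) ^ 2).
    2:{ rewrite Rpow_mult_distr, HM. right; field; lra. }
    apply pow_maj_Rabs. rewrite Eq.
    apply (comb_bspl_bound t (S k) _ _ j); auto; [lia | lra |].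
    intros i _ Hi. rewrite Rabs_mult.
    replace (s * K2 * (L * h) * M) with (L * (s * h) * (K2 * M)) by ring.
    apply Rmult_le_compat; auto using Rabs_pos.
    eapply Rle_trans; [apply Lw; [lra | apply node_in] |].
    apply Rmult_le_compat_l; auto.
    apply (node_close t d N h c0 (S k) i j); auto; lra.
Qed.

(** * The finite element space *)

Lemma mesh_size_ge xs N j : (1 <= j <= N)%nat -> xs (j + 1)%nat - xs j <= mesh_size xs N.
Proof.
  induction N; intros Hj; [lia |]. cbn [mesh_size].
  destruct (Nat.eq_dec j (S N)) as [-> | Hn]; [apply Rmax_r |].
  eapply Rle_trans; [apply IHN; lia | apply Rmax_l].
Qed.

(* The index d corresponds to the node xs 1 = 0. *)
Definition ext_knots (d N : nat) (xs : nat -> R) (j : nat) : R :=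
  if Nat.ltb j d then - (mesh_size xs N * INR (d - j))
  else if Nat.leb j (d + N) then xs (j - d + 1)%nat
  else 1 + mesh_size xs N * INR (j - (d + N)).

Lemma ext_knots_left d N xs j : (j < d)%nat ->
  ext_knots d N xs j = - (mesh_size xs N * INR (d - j)).
Proof. intros H; unfold ext_knots. rewrite (proj2 (Nat.ltb_lt j d) H); auto. Qed.

Lemma ext_knots_mid d N xs m : (m <= N)%nat -> ext_knots d N xs (d + m) = xs (m + 1)%nat.
Proof.
  intros H; unfold ext_knots. rewrite (proj2 (Nat.ltb_ge (d + m) d)) by lia.
  rewrite (proj2 (Nat.leb_le (d + m) (d + N))) by lia. f_equal; lia.
Qed.

Lemma ext_knots_right d N xs m :
  xs (N + 1)%nat = 1 -> ext_knots d N xs (d + N + m) = 1 + mesh_size xs N * INR m.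
Proof.
  intros E; destruct m as [| m].
  - rewrite Nat.add_0_r, ext_knots_mid by lia. rewrite E; simpl; ring.
  - unfold ext_knots. rewrite (proj2 (Nat.ltb_ge (d + N + S m) d)) by lia.
    rewrite (proj2 (Nat.leb_gt (d + N + S m) (d + N))) by lia.
    do 3 f_equal; lia.
Qed.

(** The artificial gaps have length exactly h, so the extended family stays quasiuniform once the
    constant is at least 1. *)
Lemma ext_knots_grid d N xs c : partition01 N xs -> quasiuniform c N xs ->
  grid (ext_knots d N xs) d N (mesh_size xs N) (Rmax 1 c).
Proof.
  intros [E1 [EN P]] Q. set (h := mesh_size xs N).
  assert (HN : (1 <= N)%nat).
  { destruct N; [simpl in EN; lra | lia]. }
  assert (Hh : 0 < h).
  { assert (A := P 1%nat ltac:(lia)). assert (B := mesh_size_ge xs N 1 ltac:(lia)).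
    unfold h; lra. }
  assert (M1 := Rmax_l 1 c). assert (M2 := Rmax_r 1 c).
  split; [auto | split; [auto | split; [| split]]].
  - intros j.
    destruct (Nat.lt_ge_cases j d) as [H | H].
    { rewrite (ext_knots_left d N xs j H). fold h.
      replace (ext_knots d N xs (S j)) with (- (h * INR (d - S j))).
      - replace (d - j)%nat with (S (d - S j)) by lia. rewrite S_INR. split; nra.
      - destruct (Nat.eq_dec (S j) d) as [E | E].
        + subst d. rewrite Nat.sub_diag. replace (S j) with (S j + 0)%nat at 2 by lia.
          rewrite ext_knots_mid by lia. simpl Nat.add. rewrite E1; simpl; ring.
        + rewrite ext_knots_left by lia. reflexivity. }
    destruct (Nat.lt_ge_cases j (d + N)) as [H' | H'].
    { replace j with (d + (j - d))%nat by lia. set (m := (j - d)%nat).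
      replace (S (d + m)) with (d + S m)%nat by lia.
      rewrite !ext_knots_mid by (unfold m; lia).
      assert (A := P (m + 1)%nat ltac:(unfold m; lia)).
      assert (B := mesh_size_ge xs N (m + 1) ltac:(unfold m; lia)). fold h in B.
      assert (C := Q (m + 1)%nat ltac:(unfold m; lia)). fold h in C.
      replace (S m + 1)%nat with (m + 1 + 1)%nat by lia.
      split; [| exact B]. eapply Rle_trans; [exact C |]. apply Rmult_le_compat_r; lra. }
    replace j with (d + N + (j - (d + N)))%nat by lia. set (m := (j - (d + N))%nat).
    replace (S (d + N + m)) with (d + N + S m)%nat by lia.
    rewrite !ext_knots_right by auto. fold h. rewrite S_INR. split; nra.
  - replace d with (d + 0)%nat at 2 by lia. rewrite ext_knots_mid by lia. exact E1.
  - rewrite ext_knots_mid by lia. exact EN.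
Qed.

(** Here r - 1 = d and r - 2 = d - 1. The j-th element of the partition is [t_(d+j-1), t_(d+j)],
    since the numbering of the nodes starts at 1. *)
Lemma Sh_spl k N xs c phi : let d := S (S k) in let t := ext_knots d N xs in
  partition01 N xs -> quasiuniform c N xs ->
  Sh (S d) N xs phi <->
  phi 0 = 0 /\ exists a, forall x, 0 <= x <= 1 -> phi x = spl t d N d a x.
Proof.
  intros d t P Q. assert (G := ext_knots_grid d N xs c P Q). fold t in G.
  assert (K := grid_knots _ _ _ _ _ G).
  unfold Sh. replace (S d - 2)%nat with (S k) by (unfold d; lia).
  replace (S d - 1)%nat with d by lia.
  split.
  - intros [H1 [H2 H3]]; split; auto.
    apply (spl_span t d N _ _ (S k) phi G); auto.
    intros j Hj. assert (Hm := H3 (j - d + 1)%nat ltac:(lia)).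
    apply poly_on_Pol in Hm. destruct Hm as [p [Hp Ep]]; exists p; split; auto.
    unfold t in *. intros x Hx; apply Ep.
    replace j with (d + (j - d))%nat in Hx by lia.
    replace (S (d + (j - d))) with (d + S (j - d))%nat in Hx by lia.
    rewrite !ext_knots_mid in Hx by lia.
    replace (j - d + 1 + 1)%nat with (S (j - d) + 1)%nat by lia. exact Hx.
  - intros [H0 [a Ha]]; split; [| split]; auto.
    + apply (Cm_on_ext 0 1 (S k) (spl t d N d a)); [lra | |].
      * intros; symmetry; auto.
      * eapply spl_Cm_on; eauto.
    + intros j Hj; apply poly_on_Pol.
      destruct (spl_Pol t d N (S k) a (d + (j - 1)) K) as [p [Hp Ep]].
      exists p; split; auto. intros x Hx.
      destruct (grid_elements t d N _ _ (d + (j - 1)) G ltac:(lia)) as [L0 L1].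
      assert (Hx' : t (d + (j - 1))%nat <= x <= t (S (d + (j - 1)))).
      { unfold t. replace (S (d + (j - 1))) with (d + j)%nat by lia.
        rewrite !ext_knots_mid by lia. replace (j - 1 + 1)%nat with j by lia. exact Hx. }
      rewrite Ha by lra. apply Ep, Hx'.
Qed.

(** The interface between splines and error analysis: from here on S_h is used only through these
    properties, with one K for the whole family of partitions. [fem_inverse_sup] fixes the radius of
    the cutoff, and [fem_superapprox] balances the 1/h of [fem_inverse]. *)
Record fem_space (r : nat) (K h : R) (V : (R -> R) -> Prop) : Prop := {
  fem_derive : forall f, V f -> dfn 0 1 f (Derive_on 0 1 f);
  fem_derive_cts : forall f, V f -> cts 0 1 (Derive_on 0 1 f);
  fem_zero : forall f, V f -> f 0 = 0;
  fem_null : V (fun _ => 0);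
  fem_ext : forall f g, (forall x, 0 <= x <= 1 -> f x = g x) -> V f -> V g;
  fem_lin : forall f g k, V f -> V g -> V (fun x => f x + k * g x);
  fem_sup : forall f x, V f -> 0 <= x <= 1 -> f x ^ 2 <= K / h * inner f f;
  fem_inverse_sup : forall f x, V f -> 0 <= x <= 1 ->
    Derive_on 0 1 f x ^ 2 <= K / h ^ 3 * inner f f;
  fem_inverse : forall f, V f ->
    inner (Derive_on 0 1 f) (Derive_on 0 1 f) <= K / h ^ 2 * inner f f;
  fem_superapprox : forall w L f, 0 <= L -> cts 0 1 w ->
    (forall x y, 0 <= x <= 1 -> 0 <= y <= 1 -> Rabs (w x - w y) <= L * Rabs (x - y)) -> V f ->
    exists g, V g /\ inner (fun x => w x * f x - g x) (fun x => w x * f x - g x)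
                     <= K * (L * h) ^ 2 * inner f f;
  fem_approx : forall F M, (forall j, (j < r)%nat -> dfn 0 1 (F j) (F (S j))) -> F O 0 = 0 ->
    (forall x, 0 <= x <= 1 -> Rabs (F r x) <= M) ->
    exists g, V g /\
      (forall x, 0 <= x <= 1 -> Rabs (F O x - g x) <= K * M * h ^ r) /\
      (forall x, 0 <= x <= 1 -> Rabs (F 1%nat x - Derive_on 0 1 g x) <= K * M * h ^ (r - 1))
}.

Lemma inner_sq f : inner f f = RInt (fun x => f x ^ 2) 0 1.
Proof. apply RInt_on_ext; [lra | intros; simpl; ring]. Qed.

Lemma Sh_fem_space r c : (3 <= r)%nat -> exists K, 0 < K /\
  forall N xs, partition01 N xs -> quasiuniform c N xs ->
  0 < mesh_size xs N /\ fem_space r K (mesh_size xs N) (Sh r N xs).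
Proof.
  intros Hr; destruct r as [| [| [| k]]]; try lia; clear Hr.
  set (c0 := Rmax 1 c).
  destruct (spl_inverse k c0) as [K1 [HK1 I1]].
  destruct (spl_superapprox (S k) c0) as [K2 [HK2 I2]].
  destruct (spl_approx_C1 k c0) as [K3 [HK3 I3]].
  exists (K1 + K2 + K3); split; [lra |].
  intros N xs P Q. set (d := S (S k)). set (t := ext_knots d N xs).
  assert (G := ext_knots_grid d N xs c P Q). fold t c0 in G.
  assert (Kn := grid_knots _ _ _ _ _ G).
  assert (S0 := fun phi => Sh_spl k N xs c phi P Q). cbv zeta in S0. fold d t in S0.
  set (h := mesh_size xs N) in *. assert (Hh : 0 < h) by apply G.
  assert (Hd : forall phi a, (forall x, 0 <= x <= 1 -> phi x = spl t d N d a x) ->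
     dfn 0 1 phi (spl t d N (S k) (dcoef t (S k) a))).
  { intros phi a E x Hx. apply (is_derive_on_ext 0 1 (spl t d N d a)); auto.
    - intros; symmetry; auto.
    - apply (dfn_spl t d N h c0); auto. }
  assert (Hd' : forall phi a, (forall x, 0 <= x <= 1 -> phi x = spl t d N d a x) ->
     forall x, 0 <= x <= 1 -> Derive_on 0 1 phi x = spl t d N (S k) (dcoef t (S k) a) x).
  { intros phi a E x Hx. apply Derive_on_eq; [lra | auto | apply Hd; auto]. }
  assert (Hin : forall phi a, (forall x, 0 <= x <= 1 -> phi x = spl t d N d a x) ->
     inner phi phi = RInt (fun x => spl t d N d a x ^ 2) 0 1).
  { intros phi a E. rewrite inner_sq. apply RInt_on_ext; [lra |]. intros; rewrite E; auto; lra. }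
  assert (Hn : forall phi, Sh (S d) N xs phi -> 0 <= inner phi phi).
  { intros phi H; apply S0 in H; destruct H as [_ [a Ha]].
    rewrite (Hin _ _ Ha). apply RInt_cts_nonneg; [lra | | intros; apply pow2_ge_0].
    apply cts_pow, spl_cts, Kn. }
  assert (Hmon : forall (f : R -> R) e, Sh (S d) N xs f -> 0 < e ->
     K1 / e * inner f f <= (K1 + K2 + K3) / e * inner f f).
  { intros f e Hf He. apply Rmult_le_compat_r; [auto |].
    apply Rmult_le_compat_r; [apply Rlt_le, Rinv_0_lt_compat, He | lra]. }
  split; [exact Hh |]. constructor.
  - intros f Hf. apply S0 in Hf. destruct Hf as [_ [a Ha]].
    intros x Hx; rewrite (Hd' f a Ha x Hx); apply Hd; auto.
  - intros f Hf. apply S0 in Hf. destruct Hf as [_ [a Ha]].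
    apply (cts_ext 0 1 (spl t d N (S k) (dcoef t (S k) a))); [lra | | apply spl_cts, Kn].
    intros; symmetry; apply Hd'; auto.
  - intros f Hf; apply S0 in Hf; apply Hf.
  - apply S0; split; auto. exists (fun _ => 0); intros; unfold spl, comb.
    rewrite sumn_zero; auto; intros; ring.
  - intros f g E Hf; apply S0 in Hf; apply S0. destruct Hf as [H0 [a Ha]]; split.
    + rewrite <- E by lra; auto.
    + exists a; intros; rewrite <- E; auto.
  - intros f g y Hf Hg; apply S0 in Hf; apply S0 in Hg; apply S0.
    destruct Hf as [Hf0 [a Ha]]; destruct Hg as [Hg0 [b Hb]]; split.
    + rewrite Hf0, Hg0; ring.
    + exists (fun i => a i + y * b i); intros; rewrite spl_plus, spl_scal, Ha, Hb; auto.
  - intros f x Hf Hx. eapply Rle_trans; [| apply Hmon; auto].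
    apply S0 in Hf; destruct Hf as [_ [a Ha]].
    rewrite (Hin _ _ Ha), Ha by auto. apply (I1 t d N h G); auto.
  - intros f x Hf Hx. eapply Rle_trans; [| apply Hmon; auto; apply pow_lt, Hh].
    apply S0 in Hf; destruct Hf as [_ [a Ha]].
    rewrite (Hin _ _ Ha), (Hd' f a Ha) by auto. apply (I1 t d N h G); auto.
  - intros f Hf. eapply Rle_trans; [| apply Hmon; auto; apply pow_lt, Hh].
    apply S0 in Hf; destruct Hf as [_ [a Ha]].
    rewrite (Hin _ _ Ha), inner_sq.
    rewrite (RInt_on_ext _ _ _ (fun z => spl t d N (S k) (dcoef t (S k) a) z ^ 2));
      [| lra | intros; rewrite (Hd' f a Ha); auto; lra].
    apply (I1 t d N h G); auto.
  - intros w L f HL Cw Lw Hf. assert (Nf := Hn f Hf).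
    apply S0 in Hf; destruct Hf as [Hf0 [a Ha]].
    destruct (I2 t d N h G ltac:(auto) w L a HL Cw Lw) as [b [Hb0 Hb]].
    exists (spl t d N d b); split.
    + apply S0; split; [| exists b; auto].
      transitivity (w 0 * spl t d N d a 0); [exact Hb0 |].
      rewrite <- Ha, Hf0 by lra. ring.
    + rewrite inner_sq.
      rewrite (RInt_on_ext _ _ _ (fun x => (w x * spl t d N d a x - spl t d N d b x) ^ 2));
        [| lra | intros; rewrite Ha; auto; lra].
      eapply Rle_trans; [exact Hb |]. fold d. rewrite <- (Hin _ _ Ha).
      apply Rmult_le_compat_r; auto. apply Rmult_le_compat_r; [apply pow2_ge_0 | lra].
  - intros F M HF F0 HM.
    destruct (I3 t d N h G ltac:(auto) F M) as [a [A1 [A2 A3]]]; auto.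
    { intros j Hj; apply HF; lia. }
    assert (M0 : 0 <= M) by (eapply Rle_trans; [apply Rabs_pos | apply (HM 0); lra]).
    assert (B : forall e, 0 <= e -> K3 * M * e <= (K1 + K2 + K3) * M * e).
    { intros; apply Rmult_le_compat_r; auto. apply Rmult_le_compat_r; lra. }
    exists (spl t d N d a); split; [| split].
    + apply S0; split; [| exists a; auto]. transitivity (F O 0); [exact A3 | exact F0].
    + intros x Hx. eapply Rle_trans; [apply A1, Hx |]. apply B, pow_le; lra.
    + intros x Hx. rewrite (Hd' _ a) by auto.
      eapply Rle_trans; [apply A2, Hx |]. apply B, pow_le; lra.
Qed.

(** * Orthonormal bases of the finite element space *)

Definition orthonormal (V : (R -> R) -> Prop) (n : nat) (e : nat -> R -> R) : Prop :=
  (forall i, (i < n)%nat -> V (e i)) /\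
  forall i j, (i < n)%nat -> (j < n)%nat ->
    inner (e i) (e j) = if Nat.eq_dec i j then 1 else 0.

Lemma fem_cts r K h V f : fem_space r K h V -> V f -> cts 0 1 f.
Proof. intros F Hf; eapply dfn_cts; [lra |]. eapply fem_derive; eauto. Qed.

Lemma fem_comb r K h V n a e : fem_space r K h V -> (forall i, (i < n)%nat -> V (e i)) ->
  V (comb n a e).
Proof.
  intros F; induction n; intros H; [exact (fem_null _ _ _ _ F) |].
  unfold comb; cbn [sumn]. apply (fem_lin _ _ _ _ F (comb n a e)); [apply IHn |]; auto.
Qed.

Lemma inner_comb_orthonormal r K h V n e a j : fem_space r K h V -> orthonormal V n e ->
  (j < n)%nat -> inner (comb n a e) (e j) = a j.
Proof.
  intros F [H1 H2] Hj. rewrite inner_comb_l; [| intros; eapply fem_cts; eauto | eapply fem_cts; eauto].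
  rewrite <- (sumn_delta n j a Hj). apply sumn_ext; intros i Hi; rewrite H2; auto.
Qed.

Lemma inner_comb_comb r K h V n e a b : fem_space r K h V -> orthonormal V n e ->
  inner (comb n a e) (comb n b e) = sumn n (fun i => a i * b i).
Proof.
  intros F O. assert (O' := O); destruct O' as [H1 H2].
  rewrite inner_comb_r; [| intros; eapply fem_cts; eauto
    | eapply fem_cts; eauto; eapply fem_comb; eauto].
  apply sumn_ext; intros i Hi. rewrite (inner_comb_orthonormal r K h V) by auto. ring.
Qed.

(* Evaluating the inverse inequality at the reproducing kernel bounds sum e_i(x)^2. *)
Lemma orthonormal_size r K h V n e : 0 < h -> 0 < K -> fem_space r K h V -> orthonormal V n e ->
  INR n <= K / h.
Proof.
  intros Hh HK F O. assert (O' := O); destruct O' as [H1 H2].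
  assert (Ce : forall i, (i < n)%nat -> cts 0 1 (e i)) by (intros; eapply fem_cts; eauto).
  assert (P : forall x, 0 <= x <= 1 -> sumn n (fun i => e i x * e i x) <= K / h).
  { intros x Hx.
    assert (B := fem_sup _ _ _ _ F (comb n (fun i => e i x) e) x
      ltac:(eapply fem_comb; eauto) Hx).
    rewrite (inner_comb_comb r K h V) in B by auto. unfold comb in B.
    set (s := sumn n (fun i => e i x * e i x)) in *.
    assert (0 <= s) by (apply sumn_nonneg; intros; nra).
    assert (0 < K / h) by (apply Rdiv_lt_0_compat; auto).
    destruct (Rle_dec s (K / h)); auto. nra. }
  replace (INR n) with (RInt (fun x => sumn n (fun i => e i x * e i x)) 0 1).
  - replace (K / h) with (RInt (fun _ => K / h) 0 1) by (rewrite (RInt_const_len 0 1 _ 1) by ring; apply Rmult_1_r).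
    apply RInt_cts_le; auto with cts; [lra |]. apply cts_sumn; auto with cts.
  - rewrite RInt_cts_sumn; [| lra | auto with cts].
    rewrite (sumn_ext n _ (fun _ => 1)), sumn_const; [apply Rmult_1_r |].
    intros i Hi. change (inner (e i) (e i) = 1). rewrite H2 by auto.
    destruct (Nat.eq_dec i i); auto; lia.
Qed.

(** A Gram-Schmidt step. The remainder of f has positive norm because it is continuous and nonzero
    at some point. *)
Lemma orthonormal_extend r K h V n e f : fem_space r K h V -> orthonormal V n e -> V f ->
  (exists x, 0 <= x <= 1 /\ f x <> comb n (fun i => inner f (e i)) e x) ->
  exists e', orthonormal V (S n) e'.
Proof.
  intros F O Hf [x [Hx Hne]]. assert (O' := O); destruct O' as [H1 H2].
  set (p := comb n (fun i => inner f (e i)) e).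
  set (g := fun y => f y + (-1) * p y).
  assert (Hp : V p) by (eapply fem_comb; eauto).
  assert (Hg : V g) by (eapply fem_lin; eauto).
  assert (Cf : cts 0 1 f) by (eapply fem_cts; eauto).
  assert (Cp : cts 0 1 p) by (eapply fem_cts; eauto).
  assert (Cg : cts 0 1 g) by (eapply fem_cts; eauto).
  assert (Ce : forall i, (i < n)%nat -> cts 0 1 (e i)) by (intros; eapply fem_cts; eauto).
  assert (Pg : 0 < inner g g).
  { apply (RInt_cts_pos 0 1 _ x); auto with cts; [lra | intros; nra |].
    assert (g x <> 0) by (unfold g; fold p in Hne; lra). nra. }
  assert (Og : forall i, (i < n)%nat -> inner g (e i) = 0).
  { intros i Hi; unfold g. rewrite inner_plus_l, inner_scal_l by auto with cts.
    unfold p; rewrite (inner_comb_orthonormal r K h V) by auto. ring. }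
  set (s := sqrt (inner g g)). assert (Hs : 0 < s) by (apply sqrt_lt_R0, Pg).
  assert (Es : s * s = inner g g) by (apply sqrt_sqrt; lra).
  set (u := fun y => 0 + / s * g y).
  assert (Hu : V u) by (apply (fem_lin _ _ _ _ F); auto; eapply fem_null; eauto).
  assert (Iu : forall q, cts 0 1 q -> inner u q = / s * inner g q).
  { intros q Cq. rewrite <- inner_scal_l by auto. apply inner_ext; intros; unfold u; ring. }
  assert (Cu : cts 0 1 u) by (eapply fem_cts; eauto).
  exists (fun i => if Nat.eq_dec i n then u else e i); split.
  - intros i Hi. destruct (Nat.eq_dec i n); auto. apply H1; lia.
  - intros i j Hi Hj.
    destruct (Nat.eq_dec i n) as [-> | Ei], (Nat.eq_dec j n) as [-> | Ej].
    + destruct (Nat.eq_dec n n); [| lia]. rewrite Iu, inner_cts_sym, Iu, <- Es by auto. field; lra.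
    + destruct (Nat.eq_dec n j); [lia |]. rewrite Iu, Og by (auto; try apply Ce; lia). ring.
    + destruct (Nat.eq_dec i n); [lia |].
      rewrite inner_cts_sym, Iu, Og by (auto; try apply Ce; lia). ring.
    + apply H2; lia.
Qed.

(** A maximal orthonormal family spans, by [orthonormal_extend], and it exists because
    [orthonormal_size] bounds the cardinality. Finite dimension thus follows from the inverse
    inequality, without counting B-splines. *)
Lemma fem_basis r K h V : 0 < h -> 0 < K -> fem_space r K h V ->
  exists n e, orthonormal V n e /\ forall f, V f -> forall x, 0 <= x <= 1 ->
    f x = comb n (fun i => inner f (e i)) e x.
Proof.
  intros Hh HK F.
  assert (M : exists n, (exists e, orthonormal V n e) /\ ~ exists e, orthonormal V (S n) e).
  { apply NNPP; intros N.
    assert (A : forall n, exists e, orthonormal V n e).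
    { induction n.
      - exists (fun _ _ => 0); split; intros; lia.
      - apply NNPP; intros H; apply N; exists n; auto. }
    destruct (nfloor_ex (K / h)) as [m [_ Hm]].
    { apply Rlt_le, Rdiv_lt_0_compat; auto. }
    destruct (A (S m)) as [e He].
    apply (orthonormal_size r K h V) in He; auto. rewrite S_INR in He; lra. }
  destruct M as [n [[e O] N]]; exists n, e; split; auto.
  intros f Hf x Hx. apply NNPP; intros H; apply N.
  apply (orthonormal_extend r K h V n e f); eauto.
Qed.

(** * Picard iteration *)

Lemma half_pow_pos k : 0 < (1 / 2) ^ k.
Proof. apply pow_lt; lra. Qed.

Lemma geometric_small B eps : 0 <= B -> 0 < eps -> exists k, B * (1 / 2) ^ k < eps.
Proof.
  intros HB He.
  destruct (pow_lt_1_zero (1 / 2)) with (y := eps / (B + 1)) as [k Hk].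
  - rewrite Rabs_right; lra.
  - apply Rdiv_lt_0_compat; lra.
  - exists k. specialize (Hk k (le_n k)). assert (P := half_pow_pos k).
    rewrite Rabs_right in Hk by lra.
    apply (Rmult_lt_compat_r (B + 1)) in Hk; [| lra].
    replace (eps / (B + 1) * (B + 1)) with eps in Hk by (field; lra). nra.
Qed.

Lemma geometric_limit (u : nat -> R) B : (forall k, Rabs (u (S k) - u k) <= B * (1 / 2) ^ k) ->
  exists l : R, is_lim_seq u l /\ forall k, Rabs (u k - l) <= 2 * B * (1 / 2) ^ k.
Proof.
  intros H.
  assert (B0 : 0 <= B).
  { specialize (H O). simpl in H. assert (Q := Rabs_pos (u 1%nat - u O)). lra. }
  assert (T : forall p k, Rabs (u (k + p)%nat - u k) <= 2 * B * (1 / 2) ^ k).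
  { assert (T' : forall p k, Rabs (u (k + p)%nat - u k)
        <= 2 * B * (1 / 2) ^ k - 2 * B * (1 / 2) ^ (k + p)).
    { induction p; intros k.
      - rewrite Nat.add_0_r, !Rminus_diag, Rabs_R0; lra.
      - rewrite Nat.add_succ_r. specialize (H (k + p)%nat). specialize (IHp k).
        replace (u (S (k + p)) - u k) with ((u (S (k + p)) - u (k + p)%nat) + (u (k + p)%nat - u k)) by ring.
        eapply Rle_trans; [apply Rabs_triang |]. simpl pow. lra. }
    intros p k; eapply Rle_trans; [apply T' |].
    assert (P := half_pow_pos (k + p)). nra. }
  destruct (Rcomplete.R_complete u) as [l Hl].
  - intros eps He. destruct (geometric_small (4 * B) eps) as [k Hk]; [lra | auto |].
    exists k; intros p q Hp Hq. unfold Rdist.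
    replace (u p - u q) with ((u p - u k) - (u q - u k)) by ring.
    eapply Rle_lt_trans; [apply Rabs_triang |]. rewrite Rabs_Ropp.
    assert (T1 := T (p - k)%nat k). assert (T2 := T (q - k)%nat k).
    replace (k + (p - k))%nat with p in T1 by lia. replace (k + (q - k))%nat with q in T2 by lia.
    lra.
  - exists l; split; [apply is_lim_seq_Reals, Hl |].
    intros k. apply le_epsilon; intros eps He.
    destruct (Hl eps He) as [n Hn]. specialize (Hn (k + n)%nat ltac:(lia)). unfold Rdist in Hn.
    specialize (T n k).
    apply Rabs_le_between in T. apply Rabs_def2 in Hn. apply Rabs_le_between. lra.
Qed.

Lemma RInt_cont_Rabs_le (g f : R -> R) t : 0 <= t -> (forall s, continuous g s) -> (forall s, continuous f s) ->
  (forall s, 0 <= s <= t -> Rabs (g s) <= f s) -> Rabs (RInt g 0 t) <= RInt f 0 t.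
Proof.
  intros Ht Cg Cf H.
  assert (Cg' : cts 0 t g) by (apply cts_of_continuous; auto).
  assert (Cf' : cts 0 t f) by (apply cts_of_continuous; auto).
  eapply Rle_trans; [apply RInt_cts_Rabs; auto |]. apply RInt_cts_le; auto with cts.
Qed.

Lemma is_derive_integral g y t : (forall s, continuous g s) ->
  is_derive (fun t => y + RInt g 0 t) t (g t).
Proof.
  intros C. replace (g t) with (plus 0 (g t)) by (unfold plus; simpl; ring).
  apply (is_derive_plus (V := R_NormedModule) (fun _ => y) (fun t => RInt g 0 t));
    [apply (is_derive_const (V := R_NormedModule)) |].
  apply (is_derive_RInt g (fun t => RInt g 0 t) 0 t); [| apply C].
  apply filter_forall; intros s; apply (RInt_correct (V := R_CompleteNormedModule)).
  apply (ex_RInt_continuous (V := R_CompleteNormedModule)); auto.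
Qed.

Lemma continuous_clamp_comp a b (f : R -> R) t : (forall s, continuous f s) ->
  continuous (fun s => f (clamp a b s)) t.
Proof.
  intros C; apply (continuous_comp (clamp a b) f); [apply continuous_clamp | apply C].
Qed.

Lemma continuous_uniform_limit (f : nat -> R -> R) (g : R -> R) B :
  (forall k t, continuous (f k) t) -> 0 <= B ->
  (forall k t, Rabs (f k t - g t) <= B * (1 / 2) ^ k) -> forall t, continuous g t.
Proof.
  intros C HB H t; apply filterlim_locally; intros eps.
  assert (E3 : 0 < eps / 3) by (destruct eps; simpl; lra).
  destruct (geometric_small B (eps / 3)) as [k Hk]; auto.
  specialize (C k t). apply filterlim_locally with (eps := mkposreal _ E3) in C.
  destruct C as [d Hd]; exists d; intros s Hs. specialize (Hd s Hs).
  change (Rabs (f k s - f k t) < eps / 3) in Hd. change (Rabs (g s - g t) < eps).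
  assert (H1 := H k s). assert (H2 := H k t).
  replace (g s - g t) with ((f k s - f k t) - (f k s - g s) + (f k t - g t)) by ring.
  eapply Rle_lt_trans; [apply Rabs_triang |].
  assert (Q := Rabs_triang (f k s - f k t) (- (f k s - g s))). rewrite Rabs_Ropp in Q.
  unfold Rminus in *. lra.
Qed.

(* Picard iteration; the weight exp(2 c t) makes the iteration contract by 1/2 on [0,T]. *)
Lemma ode_exists m (F : nat -> R -> (nat -> R) -> R) L T (y0 : nat -> R) : 0 <= T -> 0 <= L ->
  (forall i t y z, (i < m)%nat ->
     Rabs (F i t y - F i t z) <= L * sumn m (fun j => Rabs (y j - z j))) ->
  (forall i (Y : nat -> R -> R), (i < m)%nat -> (forall j t, (j < m)%nat -> continuous (Y j) t) ->
     forall t, continuous (fun t => F i t (fun j => Y j t)) t) ->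
  exists Y : nat -> R -> R, forall i, (i < m)%nat ->
    (forall t, continuous (Y i) t) /\ Y i 0 = y0 i /\
    forall t, 0 <= t <= T -> is_derive (Y i) t (F i t (fun j => Y j t)).
Proof.
  intros HT HL Lip Cont.
  (* Freezing the iterate outside [0,T] keeps the integrands continuous on the whole line while only
     values on [0,T] have to be estimated. *)
  set (step := fun (Y : nat -> R -> R) i t =>
    y0 i + RInt (fun s => F i s (fun j => Y j (clamp 0 T s))) 0 t).
  set (P := fix P k := match k with O => fun i _ => y0 i | S k => step (P k) end).
  set (ok := fun Y : nat -> R -> R => forall j t, (j < m)%nat -> continuous (Y j) t).
  assert (Ci : forall Y i t, ok Y -> (i < m)%nat ->
     continuous (fun s => F i s (fun j => Y j (clamp 0 T s))) t).
  { intros Y i t HY Hi; apply (Cont i (fun j s => Y j (clamp 0 T s)) Hi).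
    intros; apply continuous_clamp_comp; auto. }
  assert (Cs : forall Y, ok Y -> ok (step Y)).
  { intros Y HY j t Hj. apply (ex_derive_continuous (V := R_NormedModule)).
    eexists; apply is_derive_integral. intros; apply Ci; auto. }
  assert (CP : forall k, ok (P k)).
  { induction k; [intros j t _; apply continuous_const | apply Cs, IHk]. }
  assert (Diff : forall Y Z i t, ok Y -> ok Z -> (i < m)%nat -> 0 <= t -> t <= T ->
     forall g, (forall s, continuous g s) ->
     (forall s, 0 <= s <= T -> sumn m (fun j => Rabs (Y j s - Z j s)) <= g s) ->
     Rabs (step Y i t - step Z i t) <= RInt (fun s => L * g s) 0 t).
  { intros Y Z i t HY HZ Hi H0 H1 g Cg Hg. unfold step.
    assert (Eq : forall a b c : R, a + b - (a + c) = b - c) by (intros; ring).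
    rewrite Eq, <- RInt_cts_minus; auto;
      try (apply cts_of_continuous; auto; intros; apply Ci; auto).
    apply RInt_cont_Rabs_le; auto.
    - intros s; apply (continuous_minus (V := R_NormedModule)); apply Ci; auto.
    - intros s; apply (continuous_mult (K := R_AbsRing)); [apply continuous_const | apply Cg].
    - intros s Hs. rewrite clamp_id by lra. eapply Rle_trans; [apply Lip, Hi |].
      apply Rmult_le_compat_l; auto. apply Hg; lra. }
  (* One iteration multiplies the weighted distance by m L/(2c) <= 1/2; the 1 keeps c positive when
     m L = 0. *)
  set (c := INR m * L + 1).
  assert (Hm : 0 <= INR m * L) by (apply Rmult_le_pos; auto using pos_INR).
  assert (Hc : 0 < c) by (unfold c; lra).
  set (D := fun k t => sumn m (fun i => Rabs (P (S k) i t - P k i t))).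
  assert (HA : exists A, 0 <= A /\ forall t, 0 <= t <= T -> D O t <= A).
  { destruct (cts_bounded 0 T (D O) HT) as [A [HA B]].
    - apply cts_sumn. intros i Hi. apply cts_Rabs, cts_minus; apply cts_of_continuous; auto;
        intros; apply CP; auto.
    - exists A; split; auto. intros t Ht; specialize (B t Ht).
      eapply Rle_trans; [apply RRle_abs | exact B]. }
  destruct HA as [A [HA HD0]].
  assert (Ce : forall a s, continuous (fun s => a * exp (2 * c * s)) s).
  { intros; apply (ex_derive_continuous (V := R_NormedModule)); auto_derive; auto. }
  assert (HD : forall k t, 0 <= t <= T -> D k t <= A * (1 / 2) ^ k * exp (2 * c * t)).
  { induction k; intros t Ht.
    - rewrite pow_O, Rmult_1_r. eapply Rle_trans; [apply HD0, Ht |].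
      assert (1 <= exp (2 * c * t)).
      { rewrite <- exp_0. destruct (Req_dec t 0) as [-> |]; [rewrite Rmult_0_r; lra |].
        left; apply exp_increasing; nra. }
      nra.
    - assert (Di : forall i, (i < m)%nat -> Rabs (P (S (S k)) i t - P (S k) i t)
          <= L * (A * (1 / 2) ^ k * exp (2 * c * t)) / (2 * c)).
      { intros i Hi.
        apply Rle_trans with (RInt (fun s => L * (A * (1 / 2) ^ k * exp (2 * c * s))) 0 t).
        { apply (Diff (P (S k)) (P k)); auto; lra. }
        assert (E : is_RInt (fun s => L * (A * (1 / 2) ^ k * exp (2 * c * s))) 0 t
           (L * (A * (1 / 2) ^ k * exp (2 * c * t)) / (2 * c)
            - L * (A * (1 / 2) ^ k * exp (2 * c * 0)) / (2 * c))).
        { apply (is_RInt_derive (V := R_CompleteNormedModule)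
            (fun s => L * (A * (1 / 2) ^ k * exp (2 * c * s)) / (2 * c))).
          - intros s _. auto_derive; auto. field; lra.
          - intros s _. apply (continuous_mult (K := R_AbsRing)); [apply continuous_const | apply Ce]. }
        rewrite (is_RInt_unique _ _ _ _ E). assert (P2 := half_pow_pos k).
        assert (0 < exp (2 * c * 0)) by apply exp_pos.
        assert (0 <= L * (A * (1 / 2) ^ k * exp (2 * c * 0)) / (2 * c)).
        { apply Rdiv_le_0_compat; [| lra]. apply Rmult_le_pos; auto. apply Rmult_le_pos; nra. }
        lra. }
      unfold D. eapply Rle_trans; [apply sumn_le, Di |]. rewrite sumn_const.
      assert (P2 := half_pow_pos k). assert (E0 := exp_pos (2 * c * t)).
      set (X := A * (1 / 2) ^ k * exp (2 * c * t)).
      assert (HX : 0 <= X) by (unfold X; apply Rmult_le_pos; nra).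
      replace (A * (1 / 2) ^ S k * exp (2 * c * t)) with (X / 2) by (unfold X; simpl; field).
      replace (INR m * (L * X / (2 * c))) with (X / 2 * (INR m * L / c)) by (field; lra).
      assert (INR m * L / c <= 1).
      { apply (Rmult_le_reg_r c); auto. unfold Rdiv; rewrite Rmult_assoc, Rinv_l by lra.
        unfold c; lra. }
      nra. }
  set (B := A * exp (2 * c * T)).
  assert (HB : 0 <= B) by (apply Rmult_le_pos; auto; apply Rlt_le, exp_pos).
  assert (Hinc : forall i k t, (i < m)%nat ->
     Rabs (P (S k) i (clamp 0 T t) - P k i (clamp 0 T t)) <= B * (1 / 2) ^ k).
  { intros i k t Hi. assert (Ht := clamp_in 0 T t HT). set (u := clamp 0 T t) in *.
    apply Rle_trans with (D k u).
    - apply (sumn_term_le m (fun i => Rabs (P (S k) i u - P k i u)) i); auto using Rabs_pos.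
    - eapply Rle_trans; [apply HD, Ht |]. unfold B.
      assert (P2 := half_pow_pos k).
      assert (exp (2 * c * u) <= exp (2 * c * T)).
      { destruct (Req_dec u T) as [-> |]; [lra |]. left; apply exp_increasing; nra. }
      replace (A * exp (2 * c * T) * (1 / 2) ^ k) with (A * (1 / 2) ^ k * exp (2 * c * T)) by ring.
      apply Rmult_le_compat_l; auto. nra. }
  clearbody B.
  set (Z := fun i t => real (Lim_seq (fun k => P k i (clamp 0 T t)))).
  assert (HZ : forall i k t, (i < m)%nat ->
     Rabs (P k i (clamp 0 T t) - Z i t) <= 2 * B * (1 / 2) ^ k).
  { intros i k t Hi. destruct (geometric_limit (fun k => P k i (clamp 0 T t)) B) as [l [Hl Hk]].
    - intros; apply Hinc; auto.
    - unfold Z; rewrite (is_lim_seq_unique _ _ Hl). apply Hk. }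
  assert (CZ : ok Z).
  { intros i t Hi.
    apply (continuous_uniform_limit (fun k t => P k i (clamp 0 T t)) (Z i) (2 * B)); [| lra |].
    - intros; apply continuous_clamp_comp; intros; apply CP; auto.
    - intros; apply HZ; auto. }
  (* The limit Z is constant outside [0,T] and may have kinks at the ends. Its image under [step] is
     an integral, hence differentiable on both sides, and agrees with Z on [0,T]. *)
  exists (step Z). intros i Hi.
  assert (E : forall j t, (j < m)%nat -> 0 <= t <= T -> step Z j t = Z j t).
  { intros j t Hj Ht. apply cond_eq; intros eps He.
    destruct (geometric_small ((T * (L * (INR m * (2 * B)))) + 2 * B) eps) as [k Hk]; auto.
    { assert (0 <= INR m) by apply pos_INR.
      assert (0 <= T * (L * (INR m * (2 * B)))) by (repeat apply Rmult_le_pos; lra). lra. }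
    assert (H1 := HZ j (S k) t Hj). rewrite clamp_id in H1 by auto.
    assert (H2 : Rabs (P (S k) j t - step Z j t) <= T * (L * (INR m * (2 * B))) * (1 / 2) ^ k).
    { set (q := INR m * (2 * B * (1 / 2) ^ k)).
      apply Rle_trans with (RInt (fun s => L * q) 0 t).
      - apply (Diff (P k) Z); auto; try lra.
        + intros; apply continuous_const.
        + intros s Hs. unfold q; rewrite <- sumn_const. apply sumn_le; intros l Hl.
          assert (H3 := HZ l k s Hl). rewrite clamp_id in H3 by auto. exact H3.
      - rewrite (RInt_const_len _ _ _ t) by ring.
        assert (0 <= L * q).
        { unfold q. assert (P2 := half_pow_pos k). assert (0 <= INR m) by apply pos_INR.
          repeat apply Rmult_le_pos; lra. }
        apply Rle_trans with (L * q * T); [apply Rmult_le_compat_l; lra |].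
        unfold q; right; ring. }
    assert (P2 := half_pow_pos k). simpl pow in H1.
    replace (step Z j t - Z j t) with ((P (S k) j t - Z j t) - (P (S k) j t - step Z j t)) by ring.
    eapply Rle_lt_trans; [apply Rabs_triang |]. rewrite Rabs_Ropp.
    assert (0 <= B * (1 / 2) ^ k) by nra. nra. }
  split; [| split].
  - intros t; apply (Cs Z CZ i t Hi).
  - unfold step; rewrite RInt_point. apply Rplus_0_r.
  - intros t Ht.
    replace (F i t (fun j => step Z j t)) with (F i t (fun j => Z j (clamp 0 T t))).
    + apply (is_derive_integral (fun s => F i s (fun j => Z j (clamp 0 T s)))).
      intros; apply Ci; auto.
    + apply Rminus_diag_uniq. apply Rabs_eq_0. apply Rle_antisym; [| apply Rabs_pos].
      eapply Rle_trans; [apply Lip, Hi |].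
      rewrite (sumn_zero m); [lra |].
      intros j Hj. rewrite E, clamp_id, Rminus_diag, Rabs_R0 by auto. reflexivity.
Qed.

(** * Functions on the space-time rectangle *)

(** Clamping both variables gives a function continuous on the whole plane, so that uniform
    continuity on the rectangle is available. *)
Definition rect_cts (T : R) (F : R -> R -> R) : Prop :=
  forall x t, continuity_2d_pt (fun x t => F (clamp 0 1 x) (clamp 0 T t)) x t.

Lemma Cm_cyl_rect_cts T m F : 0 <= T -> Cm_cyl T m F -> rect_cts T F.
Proof.
  intros HT H x t.
  assert (C : continuous_on (fun p : R * R => 0 <= fst p <= 1 /\ 0 <= snd p <= T)
                (fun p : R * R => F (fst p) (snd p))) by (destruct m; apply H).
  intros eps.
  assert (Hx := clamp_in 0 1 x ltac:(lra)). assert (Ht := clamp_in 0 T t HT).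
  specialize (C (clamp 0 1 x, clamp 0 T t) (conj Hx Ht)).
  destruct (C (fun z => ball (F (clamp 0 1 x) (clamp 0 T t)) eps z)) as [d Hd].
  { exists eps; auto. }
  exists d; intros u v Hu Hv.
  apply (Hd (clamp 0 1 u, clamp 0 T v)).
  - split; simpl.
    + eapply Rle_lt_trans; [apply (clamp_lipschitz 0 1 x u) | exact Hu].
    + eapply Rle_lt_trans; [apply (clamp_lipschitz 0 T t v) | exact Hv].
  - simpl; split; apply clamp_in; lra.
Qed.

Lemma rect_cts_uniform T F : rect_cts T F -> forall eps : posreal, exists d : posreal,
  forall x t y s, 0 <= x <= 1 -> 0 <= t <= T -> 0 <= y <= 1 -> 0 <= s <= T ->
  Rabs (y - x) < d -> Rabs (s - t) < d -> Rabs (F y s - F x t) < eps.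
Proof.
  intros C eps.
  destruct (uniform_continuity_2d _ 0 1 0 T (fun x t _ _ => C x t) eps) as [d Hd].
  exists d; intros x t y s Hx Ht Hy Hs H1 H2.
  specialize (Hd x t y s Hx Ht Hy Hs H1 H2); simpl in Hd.
  rewrite !clamp_id in Hd by auto. exact Hd.
Qed.

Lemma rect_cts_x T F t : rect_cts T F -> 0 <= t <= T -> cts 0 1 (fun x => F x t).
Proof.
  intros C Ht x; apply filterlim_locally; intros eps.
  destruct (C x t eps) as [d Hd]; exists d; intros y Hy.
  specialize (Hd y t Hy). simpl in Hd. rewrite (clamp_id 0 T t Ht) in Hd.
  apply Hd. rewrite Rminus_diag, Rabs_R0; apply cond_pos.
Qed.

(** Starting from a bound at t = 0, each time step of length d/2 costs at most 1, by uniform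
    continuity. *)
Lemma rect_cts_bounded T F : 0 <= T -> rect_cts T F ->
  exists M, 0 <= M /\ forall x t, 0 <= x <= 1 -> 0 <= t <= T -> Rabs (F x t) <= M.
Proof.
  intros HT C.
  destruct (cts_bounded 0 1 (fun x => F x 0)) as [M0 [HM0 B0]]; [lra | apply (rect_cts_x T); auto; lra |].
  destruct (rect_cts_uniform T F C (mkposreal 1 Rlt_0_1)) as [d Hd]; simpl in Hd.
  assert (Hdp := cond_pos d).
  assert (B : forall k x t, 0 <= x <= 1 -> 0 <= t <= T -> t <= INR k * (d / 2) ->
     Rabs (F x t) <= M0 + INR k).
  { induction k; intros x t Hx Ht Hk.
    - simpl in *. assert (t = 0) by lra. subst t. specialize (B0 x Hx). lra.
    - rewrite S_INR in *. destruct (Rle_dec t (d / 2)) as [L | L].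
      + assert (Q := IHk x 0 Hx ltac:(lra) ltac:(assert (0 <= INR k) by apply pos_INR; nra)).
        assert (Q2 := Hd x 0 x t Hx ltac:(lra) Hx Ht).
        rewrite Rminus_diag, Rabs_R0, Rminus_0_r, (Rabs_right t) in Q2 by lra.
        specialize (Q2 Hdp ltac:(lra)).
        apply Rabs_def2 in Q2. apply Rabs_le_between in Q. apply Rabs_le_between. lra.
      + assert (Q := IHk x (t - d / 2) Hx ltac:(lra) ltac:(lra)).
        assert (Q2 := Hd x (t - d / 2) x t Hx ltac:(lra) Hx Ht).
        replace (t - (t - d / 2)) with (d / 2) in Q2 by ring.
        rewrite Rminus_diag, Rabs_R0, (Rabs_right (d / 2)) in Q2 by lra.
        specialize (Q2 Hdp ltac:(lra)).
        apply Rabs_def2 in Q2. apply Rabs_le_between in Q. apply Rabs_le_between. lra. }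
  destruct (nfloor_ex (T / (d / 2))) as [n [_ Hn]].
  { apply Rdiv_le_0_compat; lra. }
  exists (M0 + INR (S n)); split; [assert (0 <= INR (S n)) by apply pos_INR; lra |].
  intros x t Hx Ht; apply B; auto. rewrite S_INR.
  apply Rle_trans with T; [lra |].
  apply (Rmult_lt_compat_r (d / 2)) in Hn; [| lra].
  replace (T / (d / 2) * (d / 2)) with T in Hn by (field; lra). lra.
Qed.

(** Differentiation under the integral: the difference quotient at x is F' at an intermediate time,
    which is uniformly close to F' at time t. *)
Lemma is_derive_on_inner T F F' g t : 0 < T -> 0 <= t <= T ->
  (forall x, 0 <= x <= 1 -> dfn 0 T (F x) (F' x)) -> rect_cts T F' ->
  (forall s, 0 <= s <= T -> cts 0 1 (fun x => F x s)) -> cts 0 1 g ->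
  is_derive_on 0 T (fun s => inner (fun x => F x s) g) t (inner (fun x => F' x t) g).
Proof.
  intros HT Ht D C CF Cg; apply is_derive_on_eps; intros eps.
  destruct (cts_bounded 0 1 g) as [M [HM Bg]]; [lra | auto |].
  assert (He : 0 < eps / (M + 1)) by (apply Rdiv_lt_0_compat; [apply cond_pos | lra]).
  destruct (rect_cts_uniform T F' C (mkposreal _ He)) as [d Hd]; simpl in Hd.
  exists d; intros s Hs Hst Hs'.
  assert (Q : forall x, 0 <= x <= 1 ->
     Rabs ((F x s - F x t) / (s - t) - F' x t) <= eps / (M + 1)).
  { intros x Hx.
    assert (E : exists z, 0 <= z <= T /\ Rabs (z - t) <= Rabs (s - t) /\
                F x s - F x t = F' x z * (s - t)).
    { destruct (Rle_dec t s).
      - destruct (dfn_MVT 0 T _ _ t s (D x Hx)) as [z [Hz E]]; try lra.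
        exists z; repeat split; try lra. rewrite !Rabs_right; lra.
      - destruct (dfn_MVT 0 T _ _ s t (D x Hx)) as [z [Hz E]]; try lra.
        exists z; repeat split; try lra. rewrite !Rabs_left1; lra. }
    destruct E as [z [Hz [Hz' E]]].
    replace ((F x s - F x t) / (s - t) - F' x t) with (F' x z - F' x t) by (rewrite E; field; lra).
    assert (Z : Rabs (x - x) < d) by (rewrite Rminus_diag, Rabs_R0; apply cond_pos).
    left; apply Hd; auto.
    eapply Rle_lt_trans; eauto. }
  assert (C' : cts 0 1 (fun x => F' x t)) by (apply (rect_cts_x T); auto).
  assert (Cs := CF s Hs'). assert (Ct := CF t Ht).
  replace ((inner (fun x => F x s) g - inner (fun x => F x t) g) / (s - t)
     - inner (fun x => F' x t) g)
    with (inner (fun x => / (s - t) * (F x s - F x t) - F' x t) g).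
  2:{ rewrite inner_minus_l, inner_scal_l, inner_minus_l by auto with cts. unfold Rdiv; ring. }
  assert (Cq : cts 0 1 (fun x => / (s - t) * (F x s - F x t) - F' x t)) by auto with cts.
  unfold inner. eapply Rle_lt_trans; [apply RInt_cts_Rabs; [lra | auto with cts] |].
  apply Rle_lt_trans with (RInt (fun _ => eps / (M + 1) * M) 0 1).
  - apply RInt_cts_le; [lra | auto with cts | auto with cts |].
    intros x Hx. rewrite Rabs_mult. apply Rmult_le_compat; auto using Rabs_pos.
    specialize (Q x Hx). unfold Rdiv in Q. rewrite (Rmult_comm _ (/ (s - t))) in Q. exact Q.
  - rewrite (RInt_const_len _ _ _ 1) by ring. assert (P := cond_pos eps).
    apply (Rmult_lt_reg_r (M + 1)); [lra |].
    replace (eps / (M + 1) * M * 1 * (M + 1)) with (eps * M) by (field; lra). nra.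
Qed.

Fixpoint Dxn (j : nat) (F : R -> R -> R) : R -> R -> R :=
  match j with O => F | S k => Dxn k (Defs.Dx F) end.

Lemma Dxn_S j F : Dxn (S j) F = Defs.Dx (Dxn j F).
Proof. revert F; induction j; intros F; [reflexivity |]. apply (IHj (Defs.Dx F)). Qed.

Lemma Cm_cyl_Dxn T j m F : Cm_cyl T (j + m) F -> Cm_cyl T m (Dxn j F).
Proof.
  revert F; induction j; intros F H; [exact H |]. apply IHj. apply H.
Qed.

Lemma Cm_cyl_Dx T m F t : Cm_cyl T (S m) F -> 0 <= t <= T ->
  dfn 0 1 (fun x => F x t) (fun x => Defs.Dx F x t).
Proof.
  intros [_ [H _]] Ht x Hx. apply (Derive_on_correct 0 1 (fun y => F y t)); auto; [lra |].
  apply H; auto.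
Qed.

Lemma Cm_cyl_Dt T m F x : 0 < T -> Cm_cyl T (S m) F -> 0 <= x <= 1 ->
  dfn 0 T (F x) (fun t => Dt T F x t).
Proof.
  intros HT [_ [H _]] Hx t Ht. apply (Derive_on_correct 0 T (fun s => F x s)); auto.
  apply H; auto.
Qed.

Lemma Cm_cyl_Dxn_derive T r F j t : Cm_cyl T r F -> (j < r)%nat -> 0 <= t <= T ->
  dfn 0 1 (fun x => Dxn j F x t) (fun x => Dxn (S j) F x t).
Proof.
  intros H Hj Ht. rewrite Dxn_S. apply (Cm_cyl_Dx T (r - S j)); auto.
  apply Cm_cyl_Dxn. replace (j + S (r - S j))%nat with r by lia. exact H.
Qed.

Lemma Cm_cyl_le T m n F : (m <= n)%nat -> Cm_cyl T n F -> Cm_cyl T m F.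
Proof.
  revert n F; induction m; intros n F H C.
  - split; auto. destruct n; apply C.
  - destruct n as [| n]; [lia |]. destruct C as [C1 [C2 [C3 C4]]].
    split; [auto | split; [auto | split; apply (IHm n); auto; lia]].
Qed.

(** * Projection errors *)

Definition fem_onb (V : (R -> R) -> Prop) (n : nat) (e : nat -> R -> R) : Prop :=
  orthonormal V n e /\ forall f, V f -> forall x, 0 <= x <= 1 ->
    f x = comb n (fun i => inner f (e i)) e x.

Definition proj (n : nat) (e : nat -> R -> R) (f : R -> R) : R -> R :=
  comb n (fun i => inner f (e i)) e.

Definition de (e : nat -> R -> R) (i : nat) : R -> R := Derive_on 0 1 (e i).

Lemma onb_cts r K h V n e i : fem_space r K h V -> fem_onb V n e -> (i < n)%nat -> cts 0 1 (e i).
Proof. intros F [[H _] _] Hi; eapply fem_cts; eauto. Qed.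

Lemma onb_de_cts r K h V n e i : fem_space r K h V -> fem_onb V n e -> (i < n)%nat ->
  cts 0 1 (de e i).
Proof. intros F [[H _] _] Hi; eapply fem_derive_cts; eauto. Qed.

Lemma onb_comb_V r K h V n e a : fem_space r K h V -> fem_onb V n e -> V (comb n a e).
Proof. intros F [[H _] _]; eapply fem_comb; eauto. Qed.

Lemma onb_comb_dfn r K h V n e a : fem_space r K h V -> fem_onb V n e ->
  dfn 0 1 (comb n a e) (comb n a (de e)).
Proof. intros F [[H _] _]; apply dfn_comb; intros; eapply fem_derive; eauto. Qed.

Lemma onb_comb_cts r K h V n e a : fem_space r K h V -> fem_onb V n e -> cts 0 1 (comb n a e).
Proof. intros F O; apply cts_comb; intros; eapply onb_cts; eauto. Qed.

Lemma onb_comb_de_cts r K h V n e a : fem_space r K h V -> fem_onb V n e ->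
  cts 0 1 (comb n a (de e)).
Proof. intros F O; apply cts_comb; intros; eapply onb_de_cts; eauto. Qed.

Lemma proj_orth r K h V n e f v : fem_space r K h V -> fem_onb V n e -> cts 0 1 f -> V v ->
  inner (proj n e f) v = inner f v.
Proof.
  intros F O Cf Hv. assert (O' := O); destruct O' as [O1 O2].
  assert (Ce : forall i, (i < n)%nat -> cts 0 1 (e i)) by (intros; eapply onb_cts; eauto).
  assert (Cv : cts 0 1 v) by (eapply fem_cts; eauto).
  rewrite (inner_ext (proj n e f) v (proj n e f) (comb n (fun i => inner v (e i)) e)) by auto.
  rewrite (inner_ext f v f (comb n (fun i => inner v (e i)) e)) by auto.
  unfold proj. rewrite (inner_comb_comb r K h V), inner_comb_r by auto.
  apply sumn_ext; intros; ring.
Qed.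

Lemma proj_cts r K h V n e f : fem_space r K h V -> fem_onb V n e -> cts 0 1 (proj n e f).
Proof. intros; eapply onb_comb_cts; eauto. Qed.

(** Pythagoras: f - P f is orthogonal to P f - g, which lies in V. *)
Lemma proj_best r K h V n e f g : fem_space r K h V -> fem_onb V n e -> cts 0 1 f -> V g ->
  inner (fun x => f x - proj n e f x) (fun x => f x - proj n e f x)
  <= inner (fun x => f x - g x) (fun x => f x - g x).
Proof.
  intros F O Cf Hg. assert (Cp := proj_cts r K h V n e f F O).
  assert (Cg : cts 0 1 g) by (eapply fem_cts; eauto).
  set (a := fun x => f x - proj n e f x). set (v := fun x => proj n e f x + (-1) * g x).
  assert (Hv : V v) by (apply (fem_lin _ _ _ _ F); auto; exact (onb_comb_V r K h V n e _ F O)).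
  assert (Cv : cts 0 1 v) by (eapply fem_cts; eauto).
  assert (Ca : cts 0 1 a) by (unfold a; auto with cts).
  assert (Oa : inner a v = 0).
  { unfold a; rewrite inner_minus_l, (proj_orth r K h V) by auto. ring. }
  rewrite (inner_ext (fun x => f x - g x) (fun x => f x - g x) (fun x => a x + v x)
    (fun x => a x + v x)); [| intros; unfold a, v; ring ..].
  rewrite inner_add_sq, Oa by auto.
  assert (N := inner_nonneg v Cv). lra.
Qed.

Lemma inner_sup_bound f B : 0 <= B -> cts 0 1 f -> (forall x, 0 <= x <= 1 -> Rabs (f x) <= B) ->
  inner f f <= B ^ 2.
Proof.
  intros HB Cf H. rewrite inner_sq. replace (B ^ 2) with (B ^ 2 * 1) by ring.
  rewrite <- (RInt_const_len 0 1) by ring. apply RInt_cts_le; auto with cts; [lra |].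
  intros x Hx; apply pow_maj_Rabs; auto.
Qed.

(** The spline approximant g satisfies every bound, and P f - g lies in V with norm O(h^r), so the
    inverse inequalities carry the bounds over to P f. The derivative loses one power of h, which
    sets the final order; the supremum bound C h is needed where rho or sg meets the derivative of a
    discrete error. *)
Lemma proj_error r K M : (3 <= r)%nat -> 0 < K -> 0 <= M -> exists C, 0 < C /\
  forall h V n e, 0 < h <= 1 -> fem_space r K h V -> fem_onb V n e ->
  forall F, (forall j, (j < r)%nat -> dfn 0 1 (F j) (F (S j))) -> F O 0 = 0 ->
  cts 0 1 (F 1%nat) ->
  (forall x, 0 <= x <= 1 -> Rabs (F r x) <= M) ->
  let p := comb n (fun i => inner (F O) (e i)) e in
  let p' := comb n (fun i => inner (F O) (e i)) (de e) in
  inner (fun x => F O x - p x) (fun x => F O x - p x) <= C * h ^ (2 * (r - 1)) /\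
  inner (fun x => F 1%nat x - p' x) (fun x => F 1%nat x - p' x) <= C * h ^ (2 * (r - 1)) /\
  forall x, 0 <= x <= 1 -> Rabs (F O x - p x) <= C * h /\ Rabs (F 1%nat x - p' x) <= C.
Proof.
  intros Hr HK HM.
  set (B := K * M). assert (HB : 0 <= B) by (unfold B; apply Rmult_le_pos; lra).
  exists (2 * B ^ 2 + 8 * K * B ^ 2 + B + 2 * (1 + K) * (B + 1)).
  assert (B2 : 0 <= B ^ 2) by apply pow2_ge_0.
  assert (KB : 0 <= K * B ^ 2) by (apply Rmult_le_pos; lra).
  split; [nra |].
  intros h V n e Hh Fs Ob F HF F0 CF1 HFM p p'.
  destruct (fem_approx _ _ _ _ Fs F M HF F0 HFM) as [g [Hg [G1 G2]]].
  fold B in G1, G2.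
  assert (CF0 : cts 0 1 (F O)) by (eapply dfn_cts; [lra | apply HF; lia]).
  assert (Cg : cts 0 1 g) by (eapply fem_cts; eauto).
  assert (Cg' : cts 0 1 (Derive_on 0 1 g)) by (eapply fem_derive_cts; eauto).
  assert (Cp : cts 0 1 p) by (eapply onb_comb_cts; eauto).
  assert (Cp' : cts 0 1 p') by (eapply onb_comb_de_cts; eauto).
  set (q := fun x => p x + (-1) * g x).
  assert (Hq : V q) by (apply (fem_lin _ _ _ _ Fs); auto; exact (onb_comb_V r K h V n e _ Fs Ob)).
  assert (Cq : cts 0 1 q) by (eapply fem_cts; eauto).
  assert (Dq : forall x, 0 <= x <= 1 -> Derive_on 0 1 q x = p' x - Derive_on 0 1 g x).
  { intros x Hx; apply Derive_on_eq; [lra | auto |].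
    replace (p' x - Derive_on 0 1 g x) with (p' x + (-1) * Derive_on 0 1 g x) by ring.
    apply is_derive_on_plus; auto; [eapply onb_comb_dfn; eauto |].
    apply is_derive_on_scal; auto; eapply fem_derive; eauto. }
  assert (Pr : forall m, (2 <= m)%nat -> h ^ m <= h).
  { intros m Hm. replace m with (1 + (m - 1))%nat by lia. rewrite pow_add, pow_1.
    assert (h ^ (m - 1) <= 1) by (rewrite <- (pow1 (m - 1)); apply pow_incr; lra). nra. }
  assert (Ppos : forall m, 0 < h ^ m) by (intros; apply pow_lt; lra).
  set (E := inner (fun x => F O x - g x) (fun x => F O x - g x)).
  assert (HE : E <= B ^ 2 * (h ^ r) ^ 2).
  { rewrite <- Rpow_mult_distr. apply inner_sup_bound; auto with cts.
    apply Rmult_le_pos; auto. left; apply Ppos. }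
  assert (E1 : inner (fun x => F O x - p x) (fun x => F O x - p x) <= E).
  { apply (proj_best r K h V); auto. }
  assert (Eq : inner q q <= 4 * (B ^ 2 * (h ^ r) ^ 2)).
  { rewrite (inner_ext q q (fun x => (F O x - g x) + (-1) * (F O x - p x))
      (fun x => (F O x - g x) + (-1) * (F O x - p x))); [| intros; unfold q; ring ..].
    eapply Rle_trans; [apply inner_sum_sq; auto with cts |].
    rewrite inner_scal_l by auto with cts.
    rewrite (inner_cts_sym _ (fun x => -1 * _)), inner_scal_l by auto with cts. fold E. lra. }
  assert (hr : h ^ r = h * h ^ (r - 1)).
  { replace r with (S (r - 1)) at 1 by lia. reflexivity. }
  assert (h2r : h ^ (2 * (r - 1)) = (h ^ (r - 1)) ^ 2).
  { rewrite <- pow_mult. f_equal; lia. }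
  rewrite h2r.
  set (y := h ^ (r - 1)) in *. assert (Hy : 0 < y) by apply Ppos.
  assert (Hyh : y <= h) by (apply Pr; lia).
  assert (y2 : 0 < y ^ 2) by (apply pow_lt; auto).
  assert (Eq' : inner (Derive_on 0 1 q) (Derive_on 0 1 q) <= 4 * K * B ^ 2 * y ^ 2).
  { eapply Rle_trans; [apply (fem_inverse _ _ _ _ Fs q Hq) |].
    apply Rle_trans with (K / h ^ 2 * (4 * (B ^ 2 * (h ^ r) ^ 2))).
    - apply Rmult_le_compat_l; auto. apply Rdiv_le_0_compat; [lra | apply Ppos].
    - right; rewrite hr; field; lra. }
  assert (Cq' : cts 0 1 (Derive_on 0 1 q)) by (eapply fem_derive_cts; eauto).
  split; [| split].
  - eapply Rle_trans; [exact E1 |]. eapply Rle_trans; [exact HE |]. rewrite hr.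
    replace ((h * y) ^ 2) with (h * h * y ^ 2) by ring.
    rewrite <- Rmult_assoc. apply Rmult_le_compat_r; [lra |].
    assert (h * h <= 1) by nra. nra.
  - rewrite (inner_ext _ _ (fun x => (F 1%nat x - Derive_on 0 1 g x) + (-1) * Derive_on 0 1 q x)
      (fun x => (F 1%nat x - Derive_on 0 1 g x) + (-1) * Derive_on 0 1 q x));
      [| intros; rewrite Dq by auto; ring ..].
    eapply Rle_trans; [apply inner_sum_sq; auto with cts |].
    rewrite inner_scal_l by auto with cts.
    rewrite (inner_cts_sym _ (fun x => -1 * _)), inner_scal_l by auto with cts.
    assert (E3 : inner (fun x => F 1%nat x - Derive_on 0 1 g x)
        (fun x => F 1%nat x - Derive_on 0 1 g x) <= (B * y) ^ 2).
    { apply inner_sup_bound; auto with cts. apply Rmult_le_pos; lra. }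
    rewrite Rpow_mult_distr in E3.
    apply Rle_trans with ((2 * B ^ 2 + 8 * K * B ^ 2) * y ^ 2); [lra |].
    apply Rmult_le_compat_r; [lra |]. assert (0 <= (1 + K) * (B + 1)) by nra. lra.
  - intros x Hx.
    assert (S1 : q x ^ 2 <= (2 * (1 + K) * (B + 1) * h) ^ 2).
    { eapply Rle_trans; [apply (fem_sup _ _ _ _ Fs q x Hq Hx) |].
      apply Rle_trans with (K / h * (4 * (B ^ 2 * (h ^ r) ^ 2))).
      - apply Rmult_le_compat_l; auto. apply Rdiv_le_0_compat; lra.
      - rewrite hr. replace (K / h * (4 * (B ^ 2 * (h * y) ^ 2))) with (4 * K * B ^ 2 * (h * y ^ 2))
          by (field; lra).
        assert (h * y ^ 2 <= h ^ 2) by (assert (y ^ 2 <= h) by nra; nra).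
        replace ((2 * (1 + K) * (B + 1) * h) ^ 2) with (4 * ((1 + K) ^ 2 * (B + 1) ^ 2) * h ^ 2) by ring.
        apply Rmult_le_compat; auto; try nra. }
    assert (S2 : Derive_on 0 1 q x ^ 2 <= (2 * (1 + K) * (B + 1)) ^ 2).
    { eapply Rle_trans; [apply (fem_inverse_sup _ _ _ _ Fs q x Hq Hx) |].
      apply Rle_trans with (K / h ^ 3 * (4 * (B ^ 2 * (h ^ r) ^ 2))).
      - apply Rmult_le_compat_l; auto. apply Rdiv_le_0_compat; [lra | apply Ppos].
      - rewrite hr. replace (K / h ^ 3 * (4 * (B ^ 2 * (h * y) ^ 2))) with (4 * K * B ^ 2 * (y ^ 2 / h))
          by (field; lra).
        assert (y ^ 2 / h <= 1).
        { apply (Rmult_le_reg_r h); [lra |]. replace (y ^ 2 / h * h) with (y ^ 2) by (field; lra). nra. }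
        replace ((2 * (1 + K) * (B + 1)) ^ 2) with (4 * ((1 + K) ^ 2 * (B + 1) ^ 2) * 1) by ring.
        apply Rmult_le_compat; auto; try nra; apply Rdiv_le_0_compat; lra. }
    assert (A1 : Rabs (q x) <= 2 * (1 + K) * (B + 1) * h).
    { apply Rsqr_incr_0_var; [rewrite <- Rsqr_abs, !Rsqr_pow2; exact S1 |].
      repeat apply Rmult_le_pos; lra. }
    assert (A2 : Rabs (Derive_on 0 1 q x) <= 2 * (1 + K) * (B + 1)).
    { apply Rsqr_incr_0_var; [rewrite <- Rsqr_abs, !Rsqr_pow2; exact S2 |].
      repeat apply Rmult_le_pos; lra. }
    specialize (G1 x Hx). specialize (G2 x Hx). fold y in G2. rewrite Dq in A2 by auto.
    assert (h ^ r <= h) by (apply Pr; lia).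
    unfold q in A1. apply Rabs_le_between in A1. apply Rabs_le_between in A2.
    apply Rabs_le_between in G1. apply Rabs_le_between in G2.
    assert (B * h ^ r <= B * h) by (apply Rmult_le_compat_l; auto).
    assert (B * y <= B * 1) by (apply Rmult_le_compat_l; lra).
    split; apply Rabs_le_between; [| lra].
    assert (0 <= (2 * B ^ 2 + 8 * K * B ^ 2) * h) by (apply Rmult_le_pos; lra). nra.
Qed.

(** * Truncated quadratic systems *)

Definition unitv (j i : nat) : R := if Nat.eq_dec i j then 1 else 0.

Definition norm1 (m : nat) (y : nat -> R) : R := sumn m (fun i => Rabs (y i)).

Definition norm2 (m : nat) (y : nat -> R) : R := sqrt (sumn m (fun i => y i ^ 2)).

Record linform (m : nat) (f : (nat -> R) -> R) : Prop := {
  lf_dep : forall y z, (forall i, (i < m)%nat -> y i = z i) -> f y = f z;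
  lf_lin : forall y z k, f (fun i => y i + k * z i) = f y + k * f z
}.

Definition bilform (m : nat) (q : (nat -> R) -> (nat -> R) -> R) : Prop :=
  (forall z, linform m (fun y => q y z)) /\ (forall y, linform m (q y)).

Lemma norm1_nonneg m y : 0 <= norm1 m y.
Proof. apply sumn_nonneg; intros; apply Rabs_pos. Qed.

Lemma linform_expand m f y : linform m f -> f y = sumn m (fun j => y j * f (unitv j)).
Proof.
  intros [D L].
  assert (Z : f (fun _ => 0) = 0).
  { assert (Q := L (fun _ => 0) (fun _ => 0) 1). cbv beta in Q.
    rewrite (D (fun i => 0 + 1 * 0) (fun _ => 0)) in Q by (intros; ring). lra. }
  (* Induction over the truncations of y to its first k entries. *)
  assert (A : forall k, (k <= m)%nat -> f (fun i => if Nat.ltb i k then y i else 0)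
     = sumn k (fun j => y j * f (unitv j))).
  { induction k; intros Hk; [exact Z |]. cbn [sumn]. rewrite <- IHk, <- L by lia.
    apply D; intros i _. unfold unitv.
    destruct (Nat.ltb_spec i (S k)), (Nat.ltb_spec i k), (Nat.eq_dec i k); try lia; subst; ring. }
  rewrite <- A by lia. apply D. intros i Hi.
  rewrite (proj2 (Nat.ltb_lt i m) Hi); reflexivity.
Qed.

Lemma linform_bound m f : linform m f ->
  exists C, 0 <= C /\ forall y, Rabs (f y) <= C * norm1 m y.
Proof.
  intros H; exists (sumn m (fun j => Rabs (f (unitv j)))).
  assert (N : 0 <= sumn m (fun j => Rabs (f (unitv j))))
    by (apply sumn_nonneg; intros; apply Rabs_pos).
  split; [exact N |].
  intros y; rewrite (linform_expand m f y H). eapply Rle_trans; [apply sumn_Rabs |].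
  unfold norm1. rewrite <- sumn_scal. apply sumn_le; intros i Hi.
  rewrite Rabs_mult, Rmult_comm. apply Rmult_le_compat_r; [apply Rabs_pos |].
  apply (sumn_term_le m (fun j => Rabs (f (unitv j))) i); auto. intros; apply Rabs_pos.
Qed.

Lemma linform_sub m f y z : linform m f -> f y - f z = f (fun i => y i - z i).
Proof.
  intros [D L]. rewrite (D (fun i => y i - z i) (fun i => y i + (-1) * z i)) by (intros; ring).
  rewrite L; ring.
Qed.

Lemma linform_continuous m f (Y : nat -> R -> R) t : linform m f ->
  (forall j t, (j < m)%nat -> continuous (Y j) t) -> continuous (fun t => f (fun j => Y j t)) t.
Proof.
  intros H C. apply (continuous_ext (fun t => sumn m (fun j => Y j t * f (unitv j)))).
  { intros s; rewrite (linform_expand m f _ H); reflexivity. }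
  clear H. induction m; [apply continuous_const |].
  apply (continuous_plus (V := R_NormedModule)); [apply IHm; intros; apply C; lia |].
  apply (continuous_mult (K := R_AbsRing)); [apply C; lia | apply continuous_const].
Qed.

Lemma bilform_bound m q : bilform m q ->
  exists C, 0 <= C /\ forall y z, Rabs (q y z) <= C * norm1 m y * norm1 m z.
Proof.
  intros [H1 H2].
  set (C := sumn m (fun j => sumn m (fun i => Rabs (q (unitv j) (unitv i))))).
  exists C. assert (N : 0 <= C).
  { apply sumn_nonneg; intros; apply sumn_nonneg; intros; apply Rabs_pos. }
  split; [exact N |]. intros y z.
  rewrite (linform_expand m _ y (H1 z)). eapply Rle_trans; [apply sumn_Rabs |].
  rewrite Rmult_assoc, (Rmult_comm (norm1 m y)), <- Rmult_assoc.
  unfold norm1 at 2. rewrite <- sumn_scal. apply sumn_le; intros j Hj.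
  rewrite Rabs_mult, Rmult_comm. apply Rmult_le_compat_r; [apply Rabs_pos |].
  rewrite (linform_expand m _ z (H2 (unitv j))). eapply Rle_trans; [apply sumn_Rabs |].
  unfold norm1; rewrite <- sumn_scal. apply sumn_le; intros i Hi.
  rewrite Rabs_mult, Rmult_comm. apply Rmult_le_compat_r; [apply Rabs_pos |].
  apply Rle_trans with (sumn m (fun i => Rabs (q (unitv j) (unitv i)))).
  - apply (sumn_term_le m (fun i => Rabs (q (unitv j) (unitv i))) i); auto.
    intros; apply Rabs_pos.
  - apply (sumn_term_le m (fun j => sumn m (fun i => Rabs (q (unitv j) (unitv i)))) j); auto.
    intros; apply sumn_nonneg; intros; apply Rabs_pos.
Qed.

Lemma bilform_continuous m q (Y Z : nat -> R -> R) t : bilform m q ->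
  (forall j t, (j < m)%nat -> continuous (Y j) t) ->
  (forall j t, (j < m)%nat -> continuous (Z j) t) ->
  continuous (fun t => q (fun j => Y j t) (fun j => Z j t)) t.
Proof.
  intros [H1 H2] CY CZ.
  apply (continuous_ext (fun t => sumn m (fun j => Y j t * q (unitv j) (fun j => Z j t)))).
  { intros s; rewrite (linform_expand m _ _ (H1 _)); reflexivity. }
  assert (G : forall k, (k <= m)%nat ->
    continuous (fun t => sumn k (fun j => Y j t * q (unitv j) (fun j => Z j t))) t).
  { induction k; intros Hk; [apply continuous_const |].
    apply (continuous_plus (V := R_NormedModule)); [apply IHk; lia |].
    apply (continuous_mult (K := R_AbsRing)); [apply CY; lia |].
    apply (linform_continuous m (q (unitv k))); auto. }
  apply G; lia.
Qed.

Lemma norm2_lipschitz m y z : Rabs (norm2 m y - norm2 m z) <= norm1 m (fun i => y i - z i).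
Proof.
  assert (S1 : forall a, sqrt (sumn m (fun i => a i ^ 2)) <= norm1 m a).
  { intros a. unfold norm1. induction m; cbn [sumn]; [rewrite sqrt_0; lra |].
    assert (N1 := norm1_nonneg m a). unfold norm1 in N1.
    rewrite <- (sqrt_square (_ + Rabs (a m))).
    2:{ assert (Q := Rabs_pos (a m)). lra. }
    apply sqrt_le_1_alt.
    assert (P : 0 <= sumn m (fun i => a i ^ 2)) by (apply sumn_nonneg; intros; apply pow2_ge_0).
    assert (E := sqrt_sqrt _ P). assert (Q := Rabs_pos (a m)).
    assert (0 <= sqrt (sumn m (fun i => a i ^ 2))) by apply sqrt_pos.
    assert (a m ^ 2 = Rabs (a m) * Rabs (a m)).
    { rewrite <- Rabs_mult, Rabs_right; [ring | nra]. }
    nra. }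
  assert (T : forall a b, norm2 m a - norm2 m b <= norm1 m (fun i => a i - b i)).
  { intros a b. assert (Q2 := S1 (fun i => a i - b i)). cbv beta in Q2.
    assert (Q := sumn_triangle_sqrt m (fun i => a i - b i) b). cbv beta in Q.
    unfold norm2. rewrite (sumn_ext m (fun i => a i ^ 2) (fun i => (a i - b i + b i) ^ 2))
      by (intros; ring). lra. }
  assert (T1 := T y z). assert (T2 := T z y).
  replace (norm1 m (fun i => z i - y i)) with (norm1 m (fun i => y i - z i)) in T2
    by (apply sumn_ext; intros; apply Rabs_minus_sym).
  apply Rabs_le_between. lra.
Qed.

Lemma norm2_term m y i : (i < m)%nat -> Rabs (y i) <= norm2 m y.
Proof.
  intros Hi. apply Rsqr_incr_0_var; [| apply sqrt_pos].
  rewrite <- Rsqr_abs. unfold norm2. rewrite Rsqr_sqrt, Rsqr_pow2.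
  - apply (sumn_term_le m (fun i => y i ^ 2)); auto. intros; apply pow2_ge_0.
  - apply sumn_nonneg; intros; apply pow2_ge_0.
Qed.

(* Radial retraction factor onto the ball of radius b. *)
Definition cutoff (m : nat) (b : R) (z : nat -> R) : R := b / Rmax b (norm2 m z).

Lemma cutoff_range m b z : 0 < b -> 0 < cutoff m b z <= 1.
Proof.
  intros Hb; unfold cutoff. assert (L := Rmax_l b (norm2 m z)).
  split; [apply Rdiv_lt_0_compat; lra |].
  apply (Rmult_le_reg_r (Rmax b (norm2 m z))); [lra |].
  unfold Rdiv; rewrite Rmult_assoc, Rinv_l; lra.
Qed.

Lemma cutoff_norm m b z : 0 < b -> cutoff m b z * norm2 m z <= b.
Proof.
  intros Hb; unfold cutoff. assert (L := Rmax_l b (norm2 m z)). assert (L2 := Rmax_r b (norm2 m z)).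
  apply (Rmult_le_reg_r (Rmax b (norm2 m z))); [lra |].
  replace (b / Rmax b (norm2 m z) * norm2 m z * Rmax b (norm2 m z)) with (b * norm2 m z)
    by (field; lra). nra.
Qed.

Lemma cutoff_one m b z : 0 < b -> norm2 m z <= b -> cutoff m b z = 1.
Proof. intros Hb H; unfold cutoff; rewrite Rmax_left by exact H. field; lra. Qed.

Lemma cutoff_term m b z i : 0 < b -> (i < m)%nat -> Rabs (cutoff m b z * z i) <= b.
Proof.
  intros Hb Hi. assert (C := cutoff_range m b z Hb). rewrite Rabs_mult, Rabs_right by lra.
  eapply Rle_trans; [| apply (cutoff_norm m b z Hb)].
  apply Rmult_le_compat_l; [lra | apply norm2_term, Hi].
Qed.

Lemma cutoff_lipschitz m b y z i : 0 < b -> (i < m)%nat ->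
  Rabs (cutoff m b y * y i - cutoff m b z * z i) <= 2 * norm1 m (fun i => y i - z i).
Proof.
  intros Hb Hi. set (D := norm1 m (fun i => y i - z i)).
  assert (HD : Rabs (y i - z i) <= D).
  { apply (sumn_term_le m (fun i => Rabs (y i - z i))); auto. intros; apply Rabs_pos. }
  assert (Cy := cutoff_range m b y Hb).
  set (My := Rmax b (norm2 m y)). set (Mz := Rmax b (norm2 m z)).
  assert (Ly : b <= My) by apply Rmax_l. assert (Lz : b <= Mz) by apply Rmax_l.
  assert (Lz2 : norm2 m z <= Mz) by apply Rmax_r.
  assert (DM : Rabs (Mz - My) <= D).
  { assert (Q := norm2_lipschitz m y z). fold D in Q. revert Q. unfold My, Mz, Rmax.
    destruct (Rle_dec b (norm2 m y)), (Rle_dec b (norm2 m z));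
      unfold Rabs; repeat destruct Rcase_abs; lra. }
  assert (Hz := norm2_term m z i Hi).
  (* The factor is held fixed in the first summand and varied in the second; each of them is at most
     D, since the norm is 1-Lipschitz and |z_i| <= Mz. *)
  replace (cutoff m b y * y i - cutoff m b z * z i)
    with (cutoff m b y * (y i - z i) + (b / My) * ((Mz - My) * (z i / Mz))).
  2:{ unfold cutoff; fold My Mz. field; lra. }
  eapply Rle_trans; [apply Rabs_triang |]. rewrite !Rabs_mult.
  rewrite (Rabs_right (cutoff m b y)) by lra.
  assert (B1 : Rabs (b / My) <= 1).
  { change (b / My) with (cutoff m b y). rewrite Rabs_right; lra. }
  assert (B2 : Rabs (z i / Mz) <= 1).
  { unfold Rdiv; rewrite Rabs_mult, (Rabs_right (/ Mz)).
    - apply (Rmult_le_reg_r Mz); [lra |]. rewrite Rmult_assoc, Rinv_l; lra.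
    - apply Rle_ge, Rlt_le, Rinv_0_lt_compat; lra. }
  assert (P1 := Rabs_pos (b / My)). assert (P2 := Rabs_pos (z i / Mz)).
  assert (P3 := Rabs_pos (Mz - My)). assert (P4 := Rabs_pos (y i - z i)).
  assert (Rabs (Mz - My) * Rabs (z i / Mz) <= D) by nra.
  assert (0 <= Rabs (Mz - My) * Rabs (z i / Mz)) by nra. nra.
Qed.

Lemma continuous_norm2 m (Z : nat -> R -> R) t :
  (forall j t, (j < m)%nat -> continuous (Z j) t) -> continuous (fun t => norm2 m (fun j => Z j t)) t.
Proof.
  intros C. apply (continuous_comp (fun t => sumn m (fun i => Z i t ^ 2)) sqrt).
  - induction m; [apply continuous_const |].
    apply (continuous_plus (V := R_NormedModule)); [apply IHm; intros; apply C; lia |].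
    apply (continuous_mult (K := R_AbsRing)); [apply C; lia |].
    apply (continuous_mult (K := R_AbsRing)); [apply C; lia | apply continuous_const].
  - apply continuity_pt_filterlim, continuity_pt_sqrt.
    apply sumn_nonneg; intros; apply pow2_ge_0.
Qed.

Lemma continuous_Rmax_const b (f : R -> R) t : continuous f t -> continuous (fun t => Rmax b (f t)) t.
Proof.
  intros C. apply (continuous_ext (fun t => (b + f t + Rabs (b - f t)) * / 2)).
  { intros s; unfold Rmax, Rabs; destruct (Rle_dec b (f s)), (Rcase_abs (b - f s)); lra. }
  apply (continuous_mult (K := R_AbsRing)); [| apply continuous_const].
  apply (continuous_plus (V := R_NormedModule)).
  - apply (continuous_plus (V := R_NormedModule)); [apply continuous_const | exact C].
  - apply continuous_Rabs_comp, (continuous_minus (V := R_NormedModule));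
      [apply continuous_const | exact C].
Qed.

(* In terms of z = p - y the untruncated part of the right-hand side is affine, and the
   truncated part is quadratic in a bounded Lipschitz function of z. *)
Lemma truncated_ode m c l q (p : nat -> R -> R) b T y0 : 0 <= T -> 0 < b ->
  (forall k, (k < m)%nat -> linform m (l k)) -> (forall k, (k < m)%nat -> bilform m (q k)) ->
  (forall j, (j < m)%nat -> cts 0 T (p j)) ->
  exists Y : nat -> R -> R, forall i, (i < m)%nat ->
    Y i 0 = y0 i /\ forall t, 0 <= t <= T ->
    let y := fun j => Y j t in let z := fun j => p j t - Y j t in
    is_derive (Y i) t (c i + l i y + (q i y y - (1 - cutoff m b z ^ 2) * q i z z)).
Proof.
  intros HT Hb Hl Hq Hp.
  set (z := fun t (y : nat -> R) j => p j (clamp 0 T t) - y j).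
  set (s := fun t (y : nat -> R) j => cutoff m b (z t y) * z t y j).
  (* By bilinearity the damped quadratic term is q(s,s), where s is the retraction of z onto the
     ball. *)
  set (F := fun i t y => c i + l i y + (q i y y - q i (z t y) (z t y) + q i (s t y) (s t y))).
  assert (HP : exists P, 0 <= P /\ forall t, norm1 m (fun j => p j (clamp 0 T t)) <= P).
  { destruct (cts_bounded 0 T (fun t => norm1 m (fun j => p j t)) HT) as [P [HP BP]].
    - apply cts_sumn; intros; apply cts_Rabs; auto.
    - exists P; split; auto. intros t. specialize (BP (clamp 0 T t) (clamp_in 0 T t HT)).
      eapply Rle_trans; [apply RRle_abs | exact BP]. }
  destruct HP as [P [HP BP]].
  assert (LipF : forall i, exists L, 0 <= L /\ ((i < m)%nat -> forall t y y',
     Rabs (F i t y - F i t y') <= L * norm1 m (fun j => y j - y' j))).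
  { intros i. destruct (Nat.lt_ge_cases i m) as [Hi | Hi]; [| exists 0; split; [lra | intros; lia]].
    destruct (linform_bound m (l i) (Hl i Hi)) as [C1 [HC1 B1]].
    destruct (bilform_bound m (q i) (Hq i Hi)) as [C2 [HC2 B2]].
    destruct (Hq i Hi) as [Q1 Q2].
    set (M := INR m). assert (HM : 0 <= M) by apply pos_INR.
    exists (C1 + 2 * C2 * P + 2 * (C2 * (M * 2) * (M * b))).
    assert (0 <= C2 * P) by (apply Rmult_le_pos; auto).
    assert (HMb : 0 <= M * b) by (apply Rmult_le_pos; lra).
    assert (0 <= C2 * (M * 2) * (M * b)) by (repeat apply Rmult_le_pos; lra).
    split; [lra |]. intros _ t y y'.
    set (D := norm1 m (fun j => y j - y' j)). assert (HD : 0 <= D) by apply norm1_nonneg.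
    set (pt := fun j => p j (clamp 0 T t)). assert (Bpt : norm1 m pt <= P) by apply BP.
    (* The terms quadratic in v cancel in q(v,v) - q(pt - v, pt - v), leaving an affine function of
       v with coefficients bounded through pt. *)
    assert (Ep : forall v, q i v v - q i (z t v) (z t v) = q i pt v + q i v pt - q i pt pt).
    { intros v. unfold z. fold pt.
      assert (X1 := linform_sub m _ pt v (Q1 (fun j => pt j - v j))).
      assert (X2 := linform_sub m _ pt v (Q2 pt)). assert (X3 := linform_sub m _ pt v (Q2 v)).
      cbv beta in X1. change (fun j => p j (clamp 0 T t) - v j) with (fun j => pt j - v j). lra. }
    assert (E : F i t y - F i t y' = (l i y - l i y')
      + ((q i pt y - q i pt y') + (q i y pt - q i y' pt))
      + ((q i (s t y) (s t y) - q i (s t y') (s t y)) + (q i (s t y') (s t y) - q i (s t y') (s t y')))).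
    { unfold F. rewrite !Ep. ring. }
    rewrite E, (linform_sub m (l i)) by auto.
    rewrite (linform_sub m (q i pt)), (linform_sub m (fun v => q i v pt)) by auto.
    rewrite (linform_sub m (fun v => q i v (s t y))), (linform_sub m (q i (s t y'))) by auto.
    assert (Bs : forall v, norm1 m (s t v) <= M * b).
    { intros v. unfold M; rewrite <- sumn_const. apply sumn_le; intros j Hj.
      apply cutoff_term; auto. }
    assert (Ds : norm1 m (fun j => s t y j - s t y' j) <= M * 2 * D).
    { rewrite Rmult_assoc. unfold M; rewrite <- sumn_const. apply sumn_le; intros j Hj.
      eapply Rle_trans; [apply cutoff_lipschitz; auto |]. right; f_equal.
      apply sumn_ext; intros; unfold z.
      rewrite Rabs_minus_sym. f_equal; ring. }
    assert (D1 := B1 (fun j => y j - y' j)). fold D in D1.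
    assert (D2 := B2 pt (fun j => y j - y' j)). fold D in D2.
    assert (D3 := B2 (fun j => y j - y' j) pt). fold D in D3.
    assert (D4 := B2 (fun j => s t y j - s t y' j) (s t y)).
    assert (D5 := B2 (s t y') (fun j => s t y j - s t y' j)).
    assert (N1 := norm1_nonneg m pt). assert (N2 := norm1_nonneg m (fun j => s t y j - s t y' j)).
    assert (N3 := norm1_nonneg m (s t y)). assert (N4 := norm1_nonneg m (s t y')).
    assert (U2 : C2 * norm1 m pt * D <= C2 * P * D).
    { apply Rmult_le_compat_r; auto. apply Rmult_le_compat_l; auto. }
    assert (U3 : C2 * D * norm1 m pt <= C2 * P * D) by lra.
    assert (U4 : C2 * norm1 m (fun j => s t y j - s t y' j) * norm1 m (s t y)
        <= C2 * (M * 2 * D) * (M * b)).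
    { apply Rmult_le_compat; auto; [apply Rmult_le_pos; auto |]. apply Rmult_le_compat_l; auto. }
    assert (U5 : C2 * norm1 m (s t y') * norm1 m (fun j => s t y j - s t y' j)
        <= C2 * (M * b) * (M * 2 * D)).
    { apply Rmult_le_compat; auto; [apply Rmult_le_pos; auto |]. apply Rmult_le_compat_l; auto. }
    replace ((C1 + 2 * C2 * P + 2 * (C2 * (M * 2) * (M * b))) * D)
      with (C1 * D + (C2 * P * D + C2 * P * D)
        + (C2 * (M * 2 * D) * (M * b) + C2 * (M * b) * (M * 2 * D))) by ring.
    repeat (eapply Rle_trans; [apply Rabs_triang |]; apply Rplus_le_compat); lra. }
  assert (HL : exists L, 0 <= L /\ forall i t y y', (i < m)%nat ->
     Rabs (F i t y - F i t y') <= L * norm1 m (fun j => y j - y' j)).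
  { assert (G : forall k, exists L, 0 <= L /\ forall i t y y', (i < k)%nat -> (i < m)%nat ->
       Rabs (F i t y - F i t y') <= L * norm1 m (fun j => y j - y' j)).
    { induction k as [| k [L [HL0 IH]]]; [exists 0; split; [lra | intros; lia] |].
      destruct (LipF k) as [L' [HL' B']].
      exists (L + L'); split; [lra |]. intros i t y y' Hi Hm.
      assert (N := norm1_nonneg m (fun j => y j - y' j)).
      destruct (Nat.eq_dec i k) as [-> | Hn].
      - specialize (B' Hm t y y'). nra.
      - specialize (IH i t y y' ltac:(lia) Hm). nra. }
    destruct (G m) as [L [HL0 B]]; exists L; split; auto. }
  destruct HL as [L [HL BL]].
  destruct (ode_exists m F L T y0 HT HL) as [Y HY].
  - intros; apply BL; auto.
  - intros i Y Hi CY t. unfold F.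
    assert (Cz : forall j t, (j < m)%nat -> continuous (fun t => z t (fun j => Y j t) j) t).
    { intros j u Hj. apply (continuous_minus (V := R_NormedModule)); auto. apply Hp, Hj. }
    assert (Cs : forall j t, (j < m)%nat -> continuous (fun t => s t (fun j => Y j t) j) t).
    { intros j u Hj. apply (continuous_mult (K := R_AbsRing)); auto. unfold cutoff.
      apply (continuous_mult (K := R_AbsRing)); [apply continuous_const |].
      apply (continuous_comp (fun t => Rmax b (norm2 m (z t (fun j => Y j t)))) Rinv).
      - apply continuous_Rmax_const.
        apply (continuous_norm2 m (fun j t => z t (fun j => Y j t) j)); auto.
      - apply (ex_derive_continuous (V := R_NormedModule)). auto_derive.
        assert (Q := Rmax_l b (norm2 m (z u (fun j => Y j u)))). lra. }
    apply (continuous_plus (V := R_NormedModule)).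
    + apply (continuous_plus (V := R_NormedModule)); [apply continuous_const |].
      apply (linform_continuous m (l i)); auto.
    + apply (continuous_plus (V := R_NormedModule)).
      * apply (continuous_minus (V := R_NormedModule)).
        -- apply (bilform_continuous m (q i) Y Y); auto.
        -- apply (bilform_continuous m (q i) (fun j t => z t (fun j => Y j t) j)
             (fun j t => z t (fun j => Y j t) j)); auto.
      * apply (bilform_continuous m (q i) (fun j t => s t (fun j => Y j t) j)
             (fun j t => s t (fun j => Y j t) j)); auto.
  - exists Y; intros i Hi. destruct (HY i Hi) as [_ [E D]]; split; auto.
    intros t Ht y zt. specialize (D t Ht).
    replace (c i + l i y + (q i y y - (1 - cutoff m b zt ^ 2) * q i zt zt))
      with (F i t (fun j => Y j t)); [exact D |].
    unfold F, s. fold y.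
    destruct (Hq i Hi) as [Q1 Q2].
    assert (Ez : z t y = zt) by (unfold z, zt; rewrite clamp_id by auto; reflexivity).
    rewrite Ez. set (k := cutoff m b zt).
    rewrite (linform_expand m _ (fun j => k * zt j) (Q1 _)).
    rewrite (sumn_ext m _ (fun j => k * (k * (zt j * q i (unitv j) zt)))).
    2:{ intros j _. rewrite (linform_expand m _ (fun j => k * zt j) (Q2 _)).
        rewrite (linform_expand m _ zt (Q2 _)).
        rewrite (sumn_ext m _ (fun j0 => k * (zt j0 * q i (unitv j) (unitv j0)))) by (intros; ring).
        rewrite sumn_scal. ring. }
    rewrite !sumn_scal, <- (linform_expand m (fun v => q i v zt) zt (Q1 zt)). ring.
Qed.

(** * The energy inequality *)

Lemma product_bound a x y A Q : Rabs a <= A -> x ^ 2 <= Q -> y ^ 2 <= Q ->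
  - (A * Q) <= a * x * y <= A * Q.
Proof.
  intros Ha Hx Hy. apply Rabs_le_between.
  assert (B : Rabs (x * y) <= Q).
  { apply Rabs_le_between.
    assert (0 <= (x + y) ^ 2) by apply pow2_ge_0.
    assert (0 <= (x - y) ^ 2) by apply pow2_ge_0. nra. }
  rewrite Rmult_assoc, Rabs_mult. apply Rmult_le_compat; auto using Rabs_pos.
Qed.

Lemma Rabs_mult_le a b A B : Rabs a <= A -> Rabs b <= B -> Rabs (a * b) <= A * B.
Proof. intros; rewrite Rabs_mult; apply Rmult_le_compat; auto using Rabs_pos. Qed.

Section EnergyPointwise.

(* Values at a point of U = u + u0, w = beta + eta + eta0, of the projection errors rho, sigma,
   of the discrete errors th, xi, and of their x-derivatives; ze = P(w xi) - w xi. *)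
Variables U w U' w' rho rho' sg sg' th th' xi xi' ze ka : R.

(** The flux of the first equation at (eta, u) minus that at (eta - rho - th, u - sg - xi): its
    linearisation minus the derivative of (rho + th)(sg + xi), where the part quadratic in the
    discrete errors is damped by ka^2. *)
Definition residual1 : R :=
  U * (rho' + th') + w * (sg' + xi') + U' * (rho + th) + w' * (sg + xi)
  - ((rho' * sg + rho * sg') + (rho' * xi + rho * xi') + (th' * sg + th * sg')
     + ka ^ 2 * (th' * xi + th * xi')).

(** The same difference for the second equation, whose quadratic part is the derivative of (sg +
    xi)^2 / 2. *)
Definition residual2 : R :=
  (rho' + th') + U * (sg' + xi') + U' * (sg + xi)
  - (sg * sg' + (sg * xi' + xi * sg') + ka ^ 2 * (xi * xi')).

(* x-derivative of U th^2 + 2 w th xi + U w xi^2. *)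
Definition flux' : R :=
  U' * th ^ 2 + U * (2 * (th * th')) + 2 * (w' * (th * xi) + w * (th' * xi + th * xi'))
  + ((U' * w + U * w') * xi ^ 2 + U * w * (2 * (xi * xi'))).

(** The weights h^2 and h^(-2) are those for which the inverse inequality and superapproximation
    bound the integrals by |th|^2 + |xi|^2. *)
Definition error_sq (h : R) : R :=
  rho ^ 2 + sg ^ 2 + rho' ^ 2 + sg' ^ 2 + th ^ 2 + xi ^ 2
  + h ^ 2 * th' ^ 2 + h ^ 2 * xi' ^ 2 + ze ^ 2 + / h ^ 2 * ze ^ 2.

(** After removal of half the derivative [flux'], no product of a discrete error with an undamped
    derivative of a discrete error is left without a compensating factor: such derivatives come with
    rho, sg or ze and are paired as (rho/h)(h xi') or (h th')(ze/h), while damped ones are bounded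
    by 1. What remains is 32 products of size at most A Q, and 40 leaves room. *)
Lemma energy_pointwise M h : 0 <= M -> 0 < h ->
  Rabs U <= M -> Rabs w <= M -> Rabs U' <= M -> Rabs w' <= M ->
  Rabs rho <= M * h -> Rabs sg <= M * h -> Rabs rho' <= M -> Rabs sg' <= M ->
  0 <= ka <= 1 -> ka * Rabs th' <= 1 -> ka * Rabs xi' <= 1 ->
  / 2 * flux' - 40 * (1 + M) ^ 2 * error_sq h
  <= residual1 * th + residual2 * (w * xi + ze).
Proof.
  intros HM Hh BU Bw BU' Bw' Br Bs Br' Bs' Hk Kt Kx.
  set (Q := error_sq h). set (A := (1 + M) ^ 2).
  assert (A1 : 1 <= A) by (unfold A; nra).
  assert (AM : M <= A) by (unfold A; nra).
  assert (AM2 : M * M <= A) by (unfold A; nra).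
  assert (S : forall x, 0 <= x ^ 2) by (intros; apply pow2_ge_0).
  assert (Hq : rho ^ 2 <= Q /\ sg ^ 2 <= Q /\ rho' ^ 2 <= Q /\ sg' ^ 2 <= Q /\ th ^ 2 <= Q /\
    xi ^ 2 <= Q /\ (h * th') ^ 2 <= Q /\ (h * xi') ^ 2 <= Q /\ ze ^ 2 <= Q /\ (ze / h) ^ 2 <= Q).
  { assert (E : (ze / h) ^ 2 = / h ^ 2 * ze ^ 2) by (field; lra).
    assert (P := S (ze / h)). rewrite E in *.
    rewrite !Rpow_mult_distr. unfold Q, error_sq.
    assert (P1 := S (h * th')). assert (P2 := S (h * xi')).
    rewrite Rpow_mult_distr in P1, P2.
    assert (P3 := S rho). assert (P4 := S sg). assert (P5 := S rho'). assert (P6 := S sg').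
    assert (P7 := S th). assert (P8 := S xi). assert (P9 := S ze). repeat split; lra. }
  destruct Hq as [q1 [q2 [q3 [q4 [q5 [q6 [q7 [q8 [q9 q10]]]]]]]]].
  assert (Dv : forall z, Rabs z <= M * h -> Rabs (z / h) <= M).
  { intros z Hz. unfold Rdiv. rewrite Rabs_mult, (Rabs_right (/ h)).
    - apply (Rmult_le_reg_r h); auto. rewrite Rmult_assoc, Rinv_l; lra.
    - apply Rle_ge, Rlt_le, Rinv_0_lt_compat, Hh. }
  assert (Cr := Dv _ Br). assert (Cs := Dv _ Bs).
  assert (Kc : forall z, ka * Rabs z <= 1 -> Rabs (ka * (ka * z)) <= 1).
  { intros z Hz. rewrite !Rabs_mult, (Rabs_right ka) by lra. assert (P := Rabs_pos z). nra. }
  assert (Kt' := Kc _ Kt). assert (Kx' := Kc _ Kx).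
  assert (W : forall z, Rabs z <= M -> Rabs (w * z) <= A).
  { intros z Hz; eapply Rle_trans; [apply Rabs_mult_le; eauto | exact AM2]. }
  assert (Wk : Rabs (w * (ka * (ka * xi'))) <= A).
  { eapply Rle_trans; [apply Rabs_mult_le; eauto | lra]. }
  assert (L : forall z, Rabs z <= M -> Rabs z <= A) by (intros; lra).
  assert (L1 : forall z, Rabs z <= 1 -> Rabs z <= A) by (intros; lra).
  pose proof (product_bound _ rho' th A Q (L _ BU) q3 q5) as t1.
  pose proof (product_bound _ sg' th A Q (L _ Bw) q4 q5) as t2.
  pose proof (product_bound _ rho th A Q (L _ BU') q1 q5) as t3.
  pose proof (product_bound _ th th A Q (L _ BU') q5 q5) as t4.
  pose proof (product_bound _ sg th A Q (L _ Bw') q2 q5) as t5.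
  pose proof (product_bound _ sg th A Q (L _ Br') q2 q5) as t7.
  pose proof (product_bound _ rho th A Q (L _ Bs') q1 q5) as t8.
  pose proof (product_bound _ xi th A Q (L _ Br') q6 q5) as t9.
  pose proof (product_bound _ (h * xi') th A Q (L _ Cr) q8 q5) as t10.
  pose proof (product_bound _ (h * th') th A Q (L _ Cs) q7 q5) as t11.
  pose proof (product_bound _ th th A Q (L _ Bs') q5 q5) as t12.
  pose proof (product_bound _ xi th A Q (L1 _ Kt') q6 q5) as t13.
  pose proof (product_bound _ th th A Q (L1 _ Kx') q5 q5) as t14.
  pose proof (product_bound _ rho' xi A Q (L _ Bw) q3 q6) as t15.
  pose proof (product_bound _ sg' xi A Q (W _ BU) q4 q6) as t16.
  pose proof (product_bound _ sg xi A Q (W _ BU') q2 q6) as t17.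
  pose proof (product_bound _ xi xi A Q (W _ BU') q6 q6) as t18.
  pose proof (product_bound _ sg xi A Q (W _ Bs') q2 q6) as t19.
  pose proof (product_bound _ (h * xi') xi A Q (W _ Cs) q8 q6) as t20.
  pose proof (product_bound _ xi xi A Q (W _ Bs') q6 q6) as t21.
  pose proof (product_bound _ xi xi A Q Wk q6 q6) as t22.
  assert (One : Rabs 1 <= A) by (rewrite Rabs_R1; lra).
  pose proof (product_bound _ rho' ze A Q One q3 q9) as t23.
  pose proof (product_bound _ (h * th') (ze / h) A Q One q7 q10) as t24.
  pose proof (product_bound _ sg' ze A Q (L _ BU) q4 q9) as t25.
  pose proof (product_bound _ (h * xi') (ze / h) A Q (L _ BU) q8 q10) as t26.
  pose proof (product_bound _ sg ze A Q (L _ BU') q2 q9) as t27.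
  pose proof (product_bound _ xi ze A Q (L _ BU') q6 q9) as t28.
  pose proof (product_bound _ sg ze A Q (L _ Bs') q2 q9) as t29.
  pose proof (product_bound _ (h * xi') ze A Q (L _ Cs) q8 q9) as t30.
  pose proof (product_bound _ xi ze A Q (L _ Bs') q6 q9) as t31.
  pose proof (product_bound _ xi ze A Q (L1 _ Kx') q6 q9) as t32.
  assert (WU : Rabs (U * w') <= A).
  { eapply Rle_trans; [apply Rabs_mult_le; eauto | exact AM2]. }
  pose proof (product_bound _ xi xi A Q WU q6 q6) as t33.
  assert (N : 0 <= A * Q) by (assert (P := S rho); apply Rmult_le_pos; lra).
  match goal with |- ?l <= ?r => enough (r - / 2 * flux' =
    U * rho' * th + w * sg' * th + U' * rho * th + / 2 * (U' * th * th) + w' * sg * th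
    - rho' * sg * th - sg' * rho * th - rho' * xi * th - rho / h * (h * xi') * th
    - sg / h * (h * th') * th - sg' * th * th - ka * (ka * th') * xi * th
    - ka * (ka * xi') * th * th
    + w * rho' * xi + w * U * sg' * xi + w * U' * sg * xi + / 2 * (w * U' * xi * xi)
    - w * sg' * sg * xi - w * (sg / h) * (h * xi') * xi - w * sg' * xi * xi
    - w * (ka * (ka * xi')) * xi * xi
    + 1 * rho' * ze + 1 * (h * th') * (ze / h) + U * sg' * ze + U * (h * xi') * (ze / h)
    + U' * sg * ze + U' * xi * ze - sg' * sg * ze - sg / h * (h * xi') * ze - sg' * xi * ze
    - ka * (ka * xi') * xi * ze - / 2 * (U * w' * xi * xi)) as E end.
  - rewrite Rmult_assoc. fold A Q. fold Q in E. lra.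
  - unfold residual1, residual2, flux'. field. lra.
Qed.

End EnergyPointwise.

Ltac solve_cts :=
  match goal with
  | |- cts ?a ?b (fun x => @?f x + @?g x) => apply (cts_plus a b f g); solve_cts
  | |- cts ?a ?b (fun x => @?f x - @?g x) => apply (cts_minus a b f g); solve_cts
  | |- cts ?a ?b (fun x => @?f x * @?g x) => apply (cts_mult a b f g); solve_cts
  | |- cts ?a ?b (fun x => @?f x ^ ?n) => apply (cts_pow a b f n); solve_cts
  | |- cts ?a ?b (fun _ => ?c) => apply (cts_const a b c)
  | _ => assumption
  end.

(** The derivative is built as an existential variable by the sum and product rules and is
    identified afterwards by [ring]. *)
Ltac solve_deriv :=
  match goal with
  | |- is_derive_on ?a ?b (fun x => @?f x + @?g x) ?x _ =>
      eapply (is_derive_on_plus a b f g x); [assumption | solve_deriv | solve_deriv]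
  | |- is_derive_on ?a ?b (fun x => @?f x * @?g x) ?x _ =>
      eapply (is_derive_on_mult a b f g x); [assumption | solve_deriv | solve_deriv]
  | |- is_derive_on ?a ?b (fun _ => ?c) ?x _ => apply (is_derive_on_const a b c x); assumption
  | D : dfn ?a ?b ?f ?f' |- is_derive_on ?a ?b _ ?x _ => apply (D x); assumption
  end.

(** The integral of [flux'] is the difference of its primitive at the endpoints; dropping this
    nonnegative quantity leaves only the error terms of [energy_pointwise]. *)
Lemma energy_rate M K : 0 <= M -> 0 < K -> exists C, 0 < C /\
  forall h (U w U' w' rho rho' sg sg' th th' xi xi' ze : R -> R) ka, 0 < h <= 1 ->
  dfn 0 1 U U' -> dfn 0 1 w w' -> dfn 0 1 th th' -> dfn 0 1 xi xi' ->
  cts 0 1 U' -> cts 0 1 w' -> cts 0 1 th' -> cts 0 1 xi' ->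
  cts 0 1 rho -> cts 0 1 rho' -> cts 0 1 sg -> cts 0 1 sg' -> cts 0 1 ze ->
  (forall x, 0 <= x <= 1 -> Rabs (U x) <= M /\ Rabs (w x) <= M /\ Rabs (U' x) <= M /\
     Rabs (w' x) <= M /\ Rabs (rho x) <= M * h /\ Rabs (sg x) <= M * h /\
     Rabs (rho' x) <= M /\ Rabs (sg' x) <= M /\
     ka * Rabs (th' x) <= 1 /\ ka * Rabs (xi' x) <= 1) ->
  0 <= ka <= 1 -> th 0 = 0 -> xi 0 = 0 -> 0 < U 1 -> 0 <= w 1 -> w 1 <= U 1 ^ 2 ->
  inner th' th' <= K / h ^ 2 * inner th th -> inner xi' xi' <= K / h ^ 2 * inner xi xi ->
  inner ze ze <= K * (M * h) ^ 2 * inner xi xi ->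
  - inner (fun x => residual1 (U x) (w x) (U' x) (w' x) (rho x) (rho' x) (sg x) (sg' x)
             (th x) (th' x) (xi x) (xi' x) ka) th
  - inner (fun x => residual2 (U x) (U' x) (rho' x) (sg x) (sg' x) (th' x) (xi x) (xi' x) ka)
      (fun x => w x * xi x + ze x)
  <= C * (inner th th + inner xi xi)
     + C * (inner rho rho + inner sg sg + inner rho' rho' + inner sg' sg').
Proof.
  intros HM HK. set (A := 40 * (1 + M) ^ 2).
  assert (HA : 0 < A) by (unfold A; nra).
  assert (HKM : 0 <= K * M ^ 2) by (apply Rmult_le_pos; [lra | apply pow2_ge_0]).
  exists (A * (1 + K + 2 * (K * M ^ 2))). split; [apply Rmult_lt_0_compat; lra |].
  intros h U w U' w' rho rho' sg sg' th th' xi xi' ze ka Hh DU Dw Dth Dxi CU' Cw' Cth' Cxi'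
    Crho Crho' Csg Csg' Cze B Hk T0 X0 U1 w1 wU Ith Ixi Ize.
  assert (CU : cts 0 1 U) by (eapply dfn_cts; [lra | eauto]).
  assert (Cw : cts 0 1 w) by (eapply dfn_cts; [lra | eauto]).
  assert (Cth : cts 0 1 th) by (eapply dfn_cts; [lra | eauto]).
  assert (Cxi : cts 0 1 xi) by (eapply dfn_cts; [lra | eauto]).
  set (Phi := fun x => U x * (th x * th x) + 2 * (w x * (th x * xi x)) + (U x * w x) * (xi x * xi x)).
  set (P' := fun x => flux' (U x) (w x) (U' x) (w' x) (th x) (th' x) (xi x) (xi' x)).
  set (R1 := fun x => residual1 (U x) (w x) (U' x) (w' x) (rho x) (rho' x) (sg x) (sg' x)
             (th x) (th' x) (xi x) (xi' x) ka).
  set (R2 := fun x => residual2 (U x) (U' x) (rho' x) (sg x) (sg' x) (th' x) (xi x) (xi' x) ka).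
  set (Q := fun x => error_sq (rho x) (rho' x) (sg x) (sg' x) (th x) (th' x) (xi x) (xi' x) (ze x) h).
  assert (CP : cts 0 1 P') by (unfold P', flux'; solve_cts).
  assert (CR1 : cts 0 1 R1) by (unfold R1, residual1; solve_cts).
  assert (CR2 : cts 0 1 R2) by (unfold R2, residual2; solve_cts).
  assert (CQ : cts 0 1 Q) by (unfold Q, error_sq; solve_cts).
  assert (DP : dfn 0 1 Phi P').
  { intros x Hx. unfold Phi. evar_last.
    - solve_deriv.
    - unfold P', flux'. ring. }
  assert (IP : 0 <= RInt P' 0 1).
  { rewrite (is_RInt_unique _ _ _ _ (dfn_FTC 0 1 Phi P' 0 1 DP CP ltac:(lra) ltac:(lra) ltac:(lra))).
    unfold Phi; rewrite T0, X0.
    (* Completing the square: U times the quadratic form is (U th + w xi)^2 + w (U^2 - w) xi^2. *)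
    assert (0 <= U 1 * (U 1 * (th 1 * th 1) + 2 * (w 1 * (th 1 * xi 1)) + U 1 * w 1 * (xi 1 * xi 1))).
    { replace (U 1 * (U 1 * (th 1 * th 1) + 2 * (w 1 * (th 1 * xi 1)) + U 1 * w 1 * (xi 1 * xi 1)))
        with ((U 1 * th 1 + w 1 * xi 1) ^ 2 + (w 1 * (U 1 ^ 2 - w 1)) * xi 1 ^ 2) by ring.
      apply Rplus_le_le_0_compat; [apply pow2_ge_0 |].
      apply Rmult_le_pos; [apply Rmult_le_pos; lra | apply pow2_ge_0]. }
    assert (0 <= U 1 * (th 1 * th 1) + 2 * (w 1 * (th 1 * xi 1)) + U 1 * w 1 * (xi 1 * xi 1)).
    { apply (Rmult_le_reg_l (U 1)); lra. }
    lra. }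
  assert (Main : RInt (fun x => / 2 * P' x - A * Q x) 0 1
     <= RInt (fun x => R1 x * th x + R2 x * (w x * xi x + ze x)) 0 1).
  { apply RInt_cts_le; [lra | solve_cts | solve_cts |].
    intros x Hx. destruct (B x Hx) as [b1 [b2 [b3 [b4 [b5 [b6 [b7 [b8 [b9 b10]]]]]]]]].
    apply energy_pointwise; auto; lra. }
  rewrite RInt_cts_minus, RInt_cts_scal, RInt_cts_scal in Main; try lra; try solve_cts.
  rewrite RInt_cts_plus in Main; try lra; try solve_cts.
  change (RInt (fun x => R1 x * th x) 0 1) with (inner R1 th) in Main.
  change (RInt (fun x => R2 x * (w x * xi x + ze x)) 0 1)
    with (inner R2 (fun x => w x * xi x + ze x)) in Main.
  assert (IQ : RInt Q 0 1 = inner rho rho + inner sg sg + inner rho' rho' + inner sg' sg'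
    + inner th th + inner xi xi + h ^ 2 * inner th' th' + h ^ 2 * inner xi' xi' + inner ze ze
    + / h ^ 2 * inner ze ze).
  { unfold Q, error_sq. rewrite !inner_sq.
    repeat (rewrite RInt_cts_plus; [| lra | solve_cts | solve_cts]).
    repeat (rewrite RInt_cts_scal; [| lra | solve_cts]). reflexivity. }
  assert (h2 : 0 < h ^ 2) by (apply pow_lt; lra).
  set (a := inner th th) in *. set (b := inner xi xi) in *.
  assert (Ha : 0 <= a) by (apply inner_nonneg; auto).
  assert (Hb : 0 <= b) by (apply inner_nonneg; auto).
  assert (E1 : h ^ 2 * inner th' th' <= K * a).
  { apply (Rmult_le_compat_l (h ^ 2)) in Ith; [| lra].
    replace (h ^ 2 * (K / h ^ 2 * a)) with (K * a) in Ith by (field; lra). exact Ith. }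
  assert (E2 : h ^ 2 * inner xi' xi' <= K * b).
  { apply (Rmult_le_compat_l (h ^ 2)) in Ixi; [| lra].
    replace (h ^ 2 * (K / h ^ 2 * b)) with (K * b) in Ixi by (field; lra). exact Ixi. }
  assert (E3 : / h ^ 2 * inner ze ze <= K * M ^ 2 * b).
  { apply (Rmult_le_compat_l (/ h ^ 2)) in Ize; [| apply Rlt_le, Rinv_0_lt_compat, h2].
    replace (/ h ^ 2 * (K * (M * h) ^ 2 * b)) with (K * M ^ 2 * b) in Ize by (field; lra). exact Ize. }
  assert (E4 : inner ze ze <= K * M ^ 2 * b).
  { eapply Rle_trans; [exact Ize |].
    replace (K * (M * h) ^ 2 * b) with (K * M ^ 2 * b * h ^ 2) by ring.
    assert (0 <= K * M ^ 2 * b) by (apply Rmult_le_pos; auto).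
    assert (h ^ 2 <= 1) by nra. nra. }
  set (p := inner rho rho + inner sg sg + inner rho' rho' + inner sg' sg') in *.
  assert (Hp : 0 <= p).
  { unfold p. assert (N1 := inner_nonneg _ Crho). assert (N2 := inner_nonneg _ Crho').
    assert (N3 := inner_nonneg _ Csg). assert (N4 := inner_nonneg _ Csg'). lra. }
  (* The 1 stems from th and xi themselves, K from their weighted derivatives, and 2 K M^2 from the
     two terms in ze. *)
  assert (QB : RInt Q 0 1 <= (1 + K + 2 * (K * M ^ 2)) * (a + b) + p).
  { rewrite IQ. fold p. assert (0 <= K * M ^ 2 * a) by (apply Rmult_le_pos; auto). nra. }
  assert (QB' : A * RInt Q 0 1 <= A * ((1 + K + 2 * (K * M ^ 2)) * (a + b) + p))
    by (apply Rmult_le_compat_l; lra).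
  assert (0 <= A * (K + 2 * (K * M ^ 2)) * p).
  { apply Rmult_le_pos; auto. apply Rmult_le_pos; lra. }
  clear - Main QB' IP H. revert Main QB' IP.
  generalize (RInt Q 0 1) (RInt P' 0 1); simpl. intros q0 p0. lra.
Qed.

(** * The semidiscrete problem in coordinates *)

(* Expressing coordinates through point values shows that the coordinates of eta_h(t) are
   differentiable as soon as eta_h(x,t) is, for each x. *)
Lemma comb_from_values n : forall e : nat -> R -> R, (forall i, (i < n)%nat -> cts 0 1 (e i)) ->
  exists m (xs : nat -> R) (g : nat -> R -> R),
    (forall j, (j < m)%nat -> 0 <= xs j <= 1 /\ cts 0 1 (g j)) /\
    forall c x, 0 <= x <= 1 -> comb n c e x = sumn m (fun j => comb n c e (xs j) * g j x).
Proof.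
  induction n; intros e Ce.
  - exists O, (fun _ => 0), (fun _ _ => 0); split; [intros; lia | intros; reflexivity].
  - destruct (classic (exists x0, 0 <= x0 <= 1 /\ e n x0 <> 0)) as [[x0 [Hx0 Ne]] | Z].
    (* Elimination with the pivot e_n(x0): every e'_i vanishes at x0, so the value at x0 alone
       determines the multiple of e_n. *)
    + set (e' := fun i x => e i x - e i x0 / e n x0 * e n x).
      destruct (IHn e') as [m [xs [g [Hg E]]]].
      { intros i Hi; unfold e'. apply cts_minus; [| apply cts_mult; [apply cts_const |]]; apply Ce; lia. }
      exists (S m), (fun j => if Nat.eq_dec j m then x0 else xs j),
        (fun j => if Nat.eq_dec j m
          then fun x => / e n x0 * (e n x - sumn m (fun i => e n (xs i) * g i x)) else g j).
      split.
      * intros j Hj. destruct (Nat.eq_dec j m); [split; auto | apply Hg; lia].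
        apply cts_mult; [apply cts_const | apply cts_minus; [apply Ce; lia |]].
        apply cts_sumn; intros i Hi. apply cts_mult; [apply cts_const | apply Hg, Hi].
      * intros c x Hx.
        assert (P : forall y, comb (S n) c e y
          = comb n c e' y + comb (S n) c e x0 / e n x0 * e n y).
        { intros y. unfold comb; cbn [sumn]. unfold e'.
          rewrite (sumn_ext n (fun i => c i * (e i y - e i x0 / e n x0 * e n y))
            (fun i => c i * e i y - (c i * e i x0) * (e n y / e n x0)))
            by (intros; unfold Rdiv; ring).
          rewrite sumn_minus, sumn_scal_r. field; auto. }
        cbn [sumn]. destruct (Nat.eq_dec m m) as [_ | ?]; [| lia].
        rewrite (sumn_ext m _ (fun j => comb n c e' (xs j) * g j x
          + comb (S n) c e x0 / e n x0 * (e n (xs j) * g j x))).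
        2:{ intros j Hj. destruct (Nat.eq_dec j m); [lia |]. rewrite (P (xs j)). ring. }
        rewrite sumn_plus, sumn_scal, <- E by auto.
        rewrite (P x) at 1. field; auto.
    + destruct (IHn e) as [m [xs [g [Hg E]]]]; [auto |].
      exists m, xs, g; split; auto. intros c x Hx.
      assert (P : forall y, 0 <= y <= 1 -> comb (S n) c e y = comb n c e y).
      { intros y Hy. unfold comb; cbn [sumn].
        destruct (Req_dec (e n y) 0) as [-> | N]; [ring |]. exfalso; apply Z; eauto. }
      rewrite P, E by auto. apply sumn_ext; intros j Hj. rewrite P; auto. apply Hg, Hj.
Qed.

Lemma norm1_sq_le m d : norm1 m d ^ 2 <= INR m * sumn m (fun i => d i ^ 2).
Proof.
  assert (Q := sumn_CS m (fun i => Rabs (d i)) (fun _ => 1)). cbv beta in Q.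
  rewrite (sumn_ext m (fun i => Rabs (d i) * 1) (fun i => Rabs (d i))) in Q by (intros; ring).
  rewrite (sumn_ext m (fun i => Rabs (d i) ^ 2) (fun i => d i ^ 2)) in Q by (intros; apply pow2_abs).
  rewrite (sumn_const m (1 ^ 2)) in Q. unfold norm1. lra.
Qed.

(** Two given solutions are continuous, hence bounded on [0,T], and the quadratic right-hand side is
    Lipschitz along them. Gronwall applies to the sum of the squared differences. *)
Lemma quadratic_ode_unique m c l q T (Y Y' : nat -> R -> R) : 0 < T ->
  (forall k, (k < m)%nat -> linform m (l k)) -> (forall k, (k < m)%nat -> bilform m (q k)) ->
  (forall i, (i < m)%nat -> Y i 0 = Y' i 0) ->
  (forall i t, (i < m)%nat -> 0 <= t <= T -> is_derive_on 0 T (Y i) t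
     (c i + l i (fun j => Y j t) + q i (fun j => Y j t) (fun j => Y j t))) ->
  (forall i t, (i < m)%nat -> 0 <= t <= T -> is_derive_on 0 T (Y' i) t
     (c i + l i (fun j => Y' j t) + q i (fun j => Y' j t) (fun j => Y' j t))) ->
  forall i t, (i < m)%nat -> 0 <= t <= T -> Y i t = Y' i t.
Proof.
  intros HT Hl Hq E0 D D'.
  assert (HP : forall Z dZ : nat -> R -> R, (forall i, (i < m)%nat -> dfn 0 T (Z i) (dZ i)) ->
    exists P, 0 <= P /\ forall t, 0 <= t <= T -> norm1 m (fun j => Z j t) <= P).
  { intros Z dZ HZ. destruct (cts_bounded 0 T (fun t => norm1 m (fun j => Z j t))) as [P [HP B]];
      [lra | |].
    - apply cts_sumn; intros i Hi; apply cts_Rabs. eapply dfn_cts; [lra | eauto].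
    - exists P; split; auto. intros t Ht. eapply Rle_trans; [apply RRle_abs | apply B, Ht]. }
  set (f := fun Z : nat -> R -> R => fun i t =>
     c i + l i (fun j => Z j t) + q i (fun j => Z j t) (fun j => Z j t)).
  destruct (HP Y (f Y)) as [P [HP0 BP]]; [intros i Hi t Ht; apply D; auto |].
  destruct (HP Y' (f Y')) as [P' [HP0' BP']]; [intros i Hi t Ht; apply D'; auto |].
  assert (Lip : forall k, (k <= m)%nat -> exists L, 0 <= L /\ forall i t, (i < k)%nat -> 0 <= t <= T ->
    Rabs (f Y i t - f Y' i t) <= L * norm1 m (fun j => Y j t - Y' j t)).
  { induction k; intros Hk; [exists 0; split; [lra | intros; lia] |].
    destruct (IHk ltac:(lia)) as [L [HL BL]].
    destruct (linform_bound m (l k) (Hl k ltac:(lia))) as [C1 [HC1 B1]].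
    destruct (bilform_bound m (q k) (Hq k ltac:(lia))) as [C2 [HC2 B2]].
    destruct (Hq k ltac:(lia)) as [Q1 Q2].
    exists (L + (C1 + C2 * P + C2 * P')).
    assert (0 <= C2 * P) by (apply Rmult_le_pos; auto).
    assert (0 <= C2 * P') by (apply Rmult_le_pos; auto).
    split; [lra |]. intros i t Hi Ht.
    set (N := norm1 m (fun j => Y j t - Y' j t)).
    assert (HN : 0 <= N) by apply norm1_nonneg.
    destruct (Nat.eq_dec i k) as [-> | Hn].
    2:{ specialize (BL i t ltac:(lia) Ht). fold N in BL. nra. }
    set (y := fun j => Y j t) in *. set (y' := fun j => Y' j t) in *.
    assert (E : f Y k t - f Y' k t = (l k y - l k y')
       + ((q k y y - q k y' y) + (q k y' y - q k y' y'))) by (unfold f; fold y y'; ring).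
    rewrite E, (linform_sub m (l k)), (linform_sub m (fun v => q k v y)),
      (linform_sub m (q k y')) by (auto; apply Hl; lia).
    assert (D1 := B1 (fun j => y j - y' j)). assert (D2 := B2 (fun j => y j - y' j) y).
    assert (D3 := B2 y' (fun j => y j - y' j)).
    change (norm1 m (fun j => y j - y' j)) with N in *.
    assert (N1 := BP t Ht). assert (N2 := BP' t Ht). fold y in N1. fold y' in N2.
    assert (U2 : C2 * N * norm1 m y <= C2 * P * N).
    { replace (C2 * P * N) with (C2 * N * P) by ring. apply Rmult_le_compat_l; nra. }
    assert (U3 : C2 * norm1 m y' * N <= C2 * P' * N).
    { apply Rmult_le_compat_r; auto. apply Rmult_le_compat_l; auto. }
    assert (0 <= L * N) by nra.
    eapply Rle_trans; [apply Rabs_triang |].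
    eapply Rle_trans; [apply Rplus_le_compat_l, Rabs_triang |]. lra. }
  destruct (Lip m ltac:(lia)) as [L [HL BL]].
  set (E := fun t => sumn m (fun i => (Y i t - Y' i t) ^ 2)).
  assert (DE : dfn 0 T E (fun t => sumn m (fun i => 2 * (Y i t - Y' i t) * (f Y i t - f Y' i t)))).
  { intros t Ht. apply is_derive_on_sumn; auto. intros i Hi.
    replace (2 * (Y i t - Y' i t) * (f Y i t - f Y' i t))
      with ((f Y i t - f Y' i t) * (Y i t - Y' i t) + (Y i t - Y' i t) * (f Y i t - f Y' i t)) by ring.
    apply (is_derive_on_ext 0 T (fun t => (Y i t - Y' i t) * (Y i t - Y' i t))); auto.
    { intros; ring. }
    assert (Dd : is_derive_on 0 T (fun t => Y i t - Y' i t) t (f Y i t - f Y' i t)).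
    { apply is_derive_on_minus; [exact Ht | apply D | apply D']; auto. }
    apply (is_derive_on_mult 0 T (fun t => Y i t - Y' i t) (fun t => Y i t - Y' i t)); auto. }
  assert (HE : forall t, 0 <= t <= T -> E t <= 0).
  { intros t Ht. set (M := INR m). assert (HM : 0 <= M) by apply pos_INR.
    assert (ML : 0 <= 2 * L * M) by (apply Rmult_le_pos; lra).
    assert (G := gronwall T E _ (2 * L * M + 1) 0 ltac:(lra) DE).
    assert (E00 : E 0 = 0).
    { apply sumn_zero; intros i Hi. rewrite E0, Rminus_diag by auto. ring. }
    apply Rle_trans with ((E 0 + 0 / (2 * L * M + 1)) * exp ((2 * L * M + 1) * t) - 0 / (2 * L * M + 1)).
    2:{ rewrite E00. unfold Rdiv. rewrite Rmult_0_l. lra. }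
    apply G; auto. intros s Hs.
    assert (EN : 0 <= E s) by (apply sumn_nonneg; intros; apply pow2_ge_0).
    set (N := norm1 m (fun j => Y j s - Y' j s)).
    assert (HN : 0 <= N) by apply norm1_nonneg.
    apply Rle_trans with (sumn m (fun i => 2 * (L * N) * Rabs (Y i s - Y' i s))).
    - apply sumn_le; intros i Hi. eapply Rle_trans; [apply RRle_abs |].
      rewrite !Rabs_mult, (Rabs_right 2) by lra.
      specialize (BL i s Hi Hs). fold N in BL. assert (Q := Rabs_pos (Y i s - Y' i s)). nra.
    - rewrite sumn_scal. change (sumn m (fun i => Rabs (Y i s - Y' i s))) with N.
      assert (S : N ^ 2 <= M * E s) by apply (norm1_sq_le m (fun j => Y j s - Y' j s)).
      apply (Rmult_le_compat_l L) in S; [| exact HL]. lra. }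
  intros i t Hi Ht. specialize (HE t Ht).
  assert (B : (Y i t - Y' i t) ^ 2 <= E t).
  { apply (sumn_term_le m (fun i => (Y i t - Y' i t) ^ 2)); auto. intros; apply pow2_ge_0. }
  assert (Y i t - Y' i t = 0) by nra. lra.
Qed.

Definition shift (n : nat) (y : nat -> R) (i : nat) : R := y (n + i)%nat.

Lemma comb_ext n a b (f : nat -> R -> R) x : (forall i, (i < n)%nat -> a i = b i) ->
  comb n a f x = comb n b f x.
Proof. intros E; apply sumn_ext; intros; rewrite E; auto. Qed.

Lemma comb_lin n a b k (f : nat -> R -> R) x :
  comb n (fun i => a i + k * b i) f x = comb n a f x + k * comb n b f x.
Proof.
  unfold comb; rewrite <- sumn_scal, <- sumn_plus; apply sumn_ext; intros; ring.
Qed.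

Lemma linform_inner m (F : (nat -> R) -> R -> R) g : cts 0 1 g -> (forall y, cts 0 1 (F y)) ->
  (forall y z x, (forall i, (i < m)%nat -> y i = z i) -> F y x = F z x) ->
  (forall y z k x, F (fun i => y i + k * z i) x = F y x + k * F z x) ->
  linform m (fun y => - inner (F y) g).
Proof.
  intros Cg CF Dep Lin; constructor.
  - intros y z E. f_equal. apply inner_ext; auto.
  - intros y z k. rewrite (inner_ext (F _) g (fun x => F y x + k * F z x) g) by auto.
    rewrite inner_plus_l, inner_scal_l; auto with cts. ring.
Qed.

Section SemiDiscrete.

Variables (r : nat) (K h : R) (V : (R -> R) -> Prop) (n : nat) (e : nat -> R -> R).
Hypothesis Fs : fem_space r K h V.
Hypothesis Ob : fem_onb V n e.
Variables (beta : R -> R) (eta0 u0 : R).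
Local Notation bx := (Derive_on 0 1 beta).
Hypothesis Cb : cts 0 1 beta.
Hypothesis Cbx : cts 0 1 bx.

(* A pair of functions of V is coded by y_0, ..., y_(2n-1). *)
Local Notation fe y := (comb n y e).
Local Notation ge y := (comb n (shift n y) e).
Local Notation fe' y := (comb n y (de e)).
Local Notation ge' y := (comb n (shift n y) (de e)).

Definition flux1 (y : nat -> R) (x : R) : R :=
  u0 * fe' y x + (beta x + eta0) * ge' y x + (fe' y x * ge y x + fe y x * ge' y x)
  + (ge y x + u0) * bx x.

Definition flux2 (y : nat -> R) (x : R) : R := fe' y x + u0 * ge' y x + ge y x * ge' y x.

Definition quad1 (y z : nat -> R) (x : R) : R := fe' y x * ge z x + fe y x * ge' z x.

Definition quad2 (y z : nat -> R) (x : R) : R := ge y x * ge' z x.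

(** Constant, linear and quadratic parts of the right-hand side in coordinates. An index k < n is
    the first equation tested with e_k, an index n + k the second one; orthonormality leaves the
    time derivative of a single coordinate on the left. *)
Definition sd_c (k : nat) : R :=
  if Nat.ltb k n then - inner (fun x => u0 * bx x) (e k) else 0.

Definition sd_l (k : nat) (y : nat -> R) : R :=
  if Nat.ltb k n
  then - inner (fun x => u0 * fe' y x + (beta x + eta0) * ge' y x + ge y x * bx x) (e k)
  else - inner (fun x => fe' y x + u0 * ge' y x) (e (k - n)%nat).

Definition sd_q (k : nat) (y z : nat -> R) : R :=
  if Nat.ltb k n then - inner (quad1 y z) (e k) else - inner (quad2 y z) (e (k - n)%nat).

Lemma fe_cts y : cts 0 1 (fe y). Proof. eapply onb_comb_cts; eauto. Qed.
Lemma fe'_cts y : cts 0 1 (fe' y). Proof. eapply onb_comb_de_cts; eauto. Qed.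
Lemma e_cts k : (k < n)%nat -> cts 0 1 (e k). Proof. eapply onb_cts; eauto. Qed.

Ltac cts_fe :=
  repeat match goal with
  | |- cts ?a ?b (fun x => @?f x + @?g x) => apply (cts_plus a b f g)
  | |- cts ?a ?b (fun x => @?f x * @?g x) => apply (cts_mult a b f g)
  | |- cts _ _ (fun x => comb n ?y e x) => apply (fe_cts y)
  | |- cts _ _ (fun x => comb n ?y (de e) x) => apply (fe'_cts y)
  | |- cts ?a ?b (fun _ => ?c) => apply (cts_const a b c)
  | |- cts _ _ _ => assumption
  end.

Lemma quad1_cts y z : cts 0 1 (quad1 y z). Proof. unfold quad1; cts_fe. Qed.
Lemma quad2_cts y z : cts 0 1 (quad2 y z). Proof. unfold quad2; cts_fe. Qed.
Lemma flux1_cts y : cts 0 1 (flux1 y). Proof. unfold flux1; cts_fe. Qed.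
Lemma flux2_cts y : cts 0 1 (flux2 y). Proof. unfold flux2; cts_fe. Qed.

Lemma fe_dep (f : nat -> R -> R) y z x : (forall i, (i < n + n)%nat -> y i = z i) ->
  comb n y f x = comb n z f x /\ comb n (shift n y) f x = comb n (shift n z) f x.
Proof. intros E; split; apply comb_ext; intros; apply E; lia. Qed.

Lemma fe_lin (f : nat -> R -> R) y z k x :
  comb n (fun i => y i + k * z i) f x = comb n y f x + k * comb n z f x /\
  comb n (shift n (fun i => y i + k * z i)) f x = comb n (shift n y) f x + k * comb n (shift n z) f x.
Proof. split; [apply comb_lin | apply (comb_lin n (shift n y) (shift n z))]. Qed.

Lemma sd_l_linform k : (k < n + n)%nat -> linform (n + n) (sd_l k).
Proof.
  intros Hk; unfold sd_l; destruct (Nat.ltb_spec k n) as [H | H].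
  - apply linform_inner; [apply e_cts, H | intros; cts_fe | |].
    + intros y z x E.  destruct (fe_dep e y z x E) as [_ ->].
      destruct (fe_dep (de e) y z x E) as [-> ->]; reflexivity.
    + intros y z a x.  destruct (fe_lin e y z a x) as [_ ->].
      destruct (fe_lin (de e) y z a x) as [-> ->]; ring.
  - apply linform_inner; [apply e_cts; lia | intros; cts_fe | |].
    + intros y z x E. 
      destruct (fe_dep (de e) y z x E) as [-> ->]; reflexivity.
    + intros y z a x.  destruct (fe_lin (de e) y z a x) as [-> ->]; ring.
Qed.

Lemma sd_q_bilform k : (k < n + n)%nat -> bilform (n + n) (sd_q k).
Proof.
  intros Hk; unfold sd_q; destruct (Nat.ltb_spec k n) as [H | H]; split; intros w.
  - apply (linform_inner (n + n) (fun y => quad1 y w)); [apply e_cts, H | intros; apply quad1_cts | |].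
    + intros y z x E. unfold quad1. destruct (fe_dep e y z x E) as [-> _].
      destruct (fe_dep (de e) y z x E) as [-> _]; reflexivity.
    + intros y z a x. unfold quad1. destruct (fe_lin e y z a x) as [-> _].
      destruct (fe_lin (de e) y z a x) as [-> _]; ring.
  - apply (linform_inner (n + n) (quad1 w)); [apply e_cts, H | intros; apply quad1_cts | |].
    + intros y z x E. unfold quad1. destruct (fe_dep e y z x E) as [_ ->].
      destruct (fe_dep (de e) y z x E) as [_ ->]; reflexivity.
    + intros y z a x. unfold quad1. destruct (fe_lin e y z a x) as [_ ->].
      destruct (fe_lin (de e) y z a x) as [_ ->]; ring.
  - apply (linform_inner (n + n) (fun y => quad2 y w)); [apply e_cts; lia | intros; apply quad2_cts | |].
    + intros y z x E. unfold quad2. destruct (fe_dep e y z x E) as [_ ->]; reflexivity.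
    + intros y z a x. unfold quad2. destruct (fe_lin e y z a x) as [_ ->]; ring.
  - apply (linform_inner (n + n) (quad2 w)); [apply e_cts; lia | intros; apply quad2_cts | |].
    + intros y z x E. unfold quad2. destruct (fe_dep (de e) y z x E) as [_ ->]; reflexivity.
    + intros y z a x. unfold quad2. destruct (fe_lin (de e) y z a x) as [_ ->]; ring.
Qed.

Lemma sd_rhs1 k y : (k < n)%nat -> sd_c k + sd_l k y + sd_q k y y = - inner (flux1 y) (e k).
Proof.
  intros Hk; unfold sd_c, sd_l, sd_q. rewrite (proj2 (Nat.ltb_lt k n) Hk).
  assert (Ce := e_cts k Hk). assert (Cq := quad1_cts y y).
  set (a := fun x => u0 * bx x).
  set (b := fun x => u0 * fe' y x + (beta x + eta0) * ge' y x + ge y x * bx x).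
  assert (Ca : cts 0 1 a) by (unfold a; cts_fe). assert (Cb' : cts 0 1 b) by (unfold b; cts_fe).
  rewrite (inner_ext (flux1 y) (e k) (fun x => a x + b x + quad1 y y x) (e k));
    [| intros; unfold flux1, quad1, a, b; ring | auto].
  rewrite (inner_plus_l (fun x => a x + b x)), (inner_plus_l a b) by auto with cts. ring.
Qed.

Lemma sd_rhs2 k y : (k < n)%nat ->
  sd_c (n + k) + sd_l (n + k) y + sd_q (n + k) y y = - inner (flux2 y) (e k).
Proof.
  intros Hk; unfold sd_c, sd_l, sd_q. rewrite (proj2 (Nat.ltb_ge (n + k) n)) by lia.
  replace (n + k - n)%nat with k by lia.
  assert (Ce := e_cts k Hk). assert (Cq := quad2_cts y y).
  set (b := fun x => fe' y x + u0 * ge' y x).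
  assert (Cb' : cts 0 1 b) by (unfold b; cts_fe).
  rewrite (inner_ext (flux2 y) (e k) (fun x => b x + quad2 y y x) (e k));
    [| intros; unfold flux2, quad2, b; ring | auto].
  rewrite (inner_plus_l b) by auto. ring.
Qed.

Lemma Derive_on_fe p y x : (forall x, 0 <= x <= 1 -> p x = fe y x) -> 0 <= x <= 1 ->
  is_derive_on 0 1 p x (fe' y x).
Proof.
  intros E Hx. apply (is_derive_on_ext 0 1 (fe y)); auto; [intros; symmetry; auto |].
  eapply onb_comb_dfn; eauto.
Qed.

(** Stated for functions that coincide with the combinations on [0,1] only, because an arbitrary
    solution in [solves_semidiscrete] is not constrained elsewhere. *)
Lemma weak_flux1 p q phi y : (forall x, 0 <= x <= 1 -> p x = fe y x) ->
  (forall x, 0 <= x <= 1 -> q x = ge y x) -> cts 0 1 phi ->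
  inner (fun x => u0 * Derive_on 0 1 p x) phi + inner (fun x => (beta x + eta0) * Derive_on 0 1 q x) phi
  + inner (fun x => Derive_on 0 1 (fun z => p z * q z) x) phi + inner (fun x => (q x + u0) * bx x) phi
  = inner (flux1 y) phi.
Proof.
  intros Ep Eq Cphi.
  set (a := fun x => u0 * fe' y x). set (b := fun x => (beta x + eta0) * ge' y x).
  set (c := quad1 y y). set (d := fun x => (ge y x + u0) * bx x).
  assert (Ca : cts 0 1 a) by (unfold a; cts_fe). assert (Cb' : cts 0 1 b) by (unfold b; cts_fe).
  assert (Cc : cts 0 1 c) by apply quad1_cts. assert (Cd : cts 0 1 d) by (unfold d; cts_fe).
  rewrite (inner_ext (fun x => u0 * Derive_on 0 1 p x) phi a phi); auto.
  2:{ intros x Hx; unfold a. rewrite (Derive_on_eq 0 1 p x (fe' y x)); auto; [lra |].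
      apply Derive_on_fe; auto. }
  rewrite (inner_ext (fun x => (beta x + eta0) * Derive_on 0 1 q x) phi b phi); auto.
  2:{ intros x Hx; unfold b. rewrite (Derive_on_eq 0 1 q x (ge' y x)); auto; [lra |].
      apply (Derive_on_fe q (shift n y)); auto. }
  rewrite (inner_ext (fun x => Derive_on 0 1 (fun z => p z * q z) x) phi c phi); auto.
  2:{ intros x Hx. rewrite (Derive_on_eq 0 1 (fun z => p z * q z) x (fe' y x * q x + p x * ge' y x)).
      - unfold c, quad1. rewrite Ep, Eq by auto. reflexivity.
      - lra.
      - auto.
      - apply is_derive_on_mult; auto; [apply Derive_on_fe | apply (Derive_on_fe q (shift n y))]; auto. }
  rewrite (inner_ext (fun x => (q x + u0) * bx x) phi d phi); auto.
  2:{ intros x Hx; unfold d; rewrite Eq; auto. }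
  rewrite (inner_ext (flux1 y) phi (fun x => a x + b x + c x + d x) phi); auto.
  rewrite (inner_plus_l (fun x => a x + b x + c x)), (inner_plus_l (fun x => a x + b x)),
    (inner_plus_l a b) by auto with cts. reflexivity.
Qed.

Lemma weak_flux2 p q phi y : (forall x, 0 <= x <= 1 -> p x = fe y x) ->
  (forall x, 0 <= x <= 1 -> q x = ge y x) -> cts 0 1 phi ->
  inner (fun x => Derive_on 0 1 p x) phi + inner (fun x => u0 * Derive_on 0 1 q x) phi
  + inner (fun x => q x * Derive_on 0 1 q x) phi = inner (flux2 y) phi.
Proof.
  intros Ep Eq Cphi.
  set (a := fun x => fe' y x). set (b := fun x => u0 * ge' y x). set (c := quad2 y y).
  assert (Ca : cts 0 1 a) by (unfold a; cts_fe). assert (Cb' : cts 0 1 b) by (unfold b; cts_fe).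
  assert (Cc : cts 0 1 c) by apply quad2_cts.
  assert (Dq : forall x, 0 <= x <= 1 -> Derive_on 0 1 q x = ge' y x).
  { intros x Hx. apply Derive_on_eq; auto; [lra |]. apply (Derive_on_fe q (shift n y)); auto. }
  rewrite (inner_ext (fun x => Derive_on 0 1 p x) phi a phi); auto.
  2:{ intros x Hx; unfold a. apply Derive_on_eq; auto; [lra |]. apply Derive_on_fe; auto. }
  rewrite (inner_ext (fun x => u0 * Derive_on 0 1 q x) phi b phi); auto.
  2:{ intros x Hx; unfold b; rewrite Dq; auto. }
  rewrite (inner_ext (fun x => q x * Derive_on 0 1 q x) phi c phi); auto.
  2:{ intros x Hx; unfold c, quad2; rewrite Dq, Eq; auto. }
  rewrite (inner_ext (flux2 y) phi (fun x => a x + b x + c x) phi); auto.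
  rewrite (inner_plus_l (fun x => a x + b x)), (inner_plus_l a b) by auto with cts. reflexivity.
Qed.

Lemma weak_test (F phi : R -> R) : cts 0 1 F -> V phi ->
  (forall k, (k < n)%nat -> inner F (e k) = 0) -> inner F phi = 0.
Proof.
  intros CF Hphi H. destruct Ob as [_ Cpl].
  rewrite (inner_ext F phi F (comb n (fun i => inner phi (e i)) e)); auto.
  rewrite inner_comb_r by (auto using e_cts).
  apply sumn_zero; intros k Hk. rewrite H; auto. ring.
Qed.

Lemma inner_fe_e y k : (k < n)%nat -> inner (fe y) (e k) = y k.
Proof. destruct Ob as [O1 _]. intros; eapply inner_comb_orthonormal; eauto. Qed.

Definition sd_solution (T : R) (Y : nat -> R -> R) : Prop :=
  forall k t, (k < n + n)%nat -> 0 <= t <= T -> let y := fun j => Y j t in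
    is_derive_on 0 T (Y k) t (sd_c k + sd_l k y + sd_q k y y).

Lemma semidiscrete_of_coords T eta_init u_init N xs Y : 0 < T ->
  (forall f, V f <-> Sh r N xs f) ->
  cts 0 1 (fun x => eta_init x - eta0) -> cts 0 1 (fun x => u_init x - u0) ->
  (forall k, (k < n)%nat -> Y k 0 = inner (fun x => eta_init x - eta0) (e k) /\
     Y (n + k)%nat 0 = inner (fun x => u_init x - u0) (e k)) ->
  sd_solution T Y ->
  solves_semidiscrete T beta eta0 u0 eta_init u_init r N xs
    (fun x t => fe (fun j => Y j t) x) (fun x t => ge (fun j => Y j t) x).
Proof.
  intros HT HV Ce Cu Y0 HY.
  set (dY := fun t k => let y := fun j => Y j t in sd_c k + sd_l k y + sd_q k y y).
  assert (VE : forall a, V (comb n a e)) by (intros; eapply onb_comb_V; eauto).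
  assert (D1 : forall x t, 0 <= t <= T ->
    is_derive_on 0 T (fun s => fe (fun j => Y j s) x) t (fe (dY t) x)).
  { intros x t Ht. apply is_derive_on_sumn; auto. intros i Hi.
    apply (is_derive_on_ext 0 T (fun s => e i x * Y i s)); auto; [intros; ring |].
    rewrite Rmult_comm. apply is_derive_on_scal; auto. apply HY; auto; lia. }
  assert (D2 : forall x t, 0 <= t <= T ->
    is_derive_on 0 T (fun s => ge (fun j => Y j s) x) t (ge (dY t) x)).
  { intros x t Ht. apply is_derive_on_sumn; auto. intros i Hi. unfold shift.
    apply (is_derive_on_ext 0 T (fun s => e i x * Y (n + i)%nat s)); auto; [intros; ring |].
    rewrite Rmult_comm. apply is_derive_on_scal; auto. apply HY; auto; lia. }
  split; [| split; [| split; [| split]]].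
  - intros t Ht; split; apply HV, VE.
  - intros x t Hx Ht; split; eexists; [apply D1 | apply D2]; auto.
  - intros t Ht phi Hphi. apply HV in Hphi.
    assert (Cp : cts 0 1 phi) by (eapply fem_cts; eauto).
    set (y := fun j => Y j t).
    split.
    + assert (W := weak_flux1 (fe y) (ge y) phi y (fun x _ => eq_refl) (fun x _ => eq_refl) Cp).
      rewrite (inner_ext (fun x => Dt T (fun x t => fe (fun j => Y j t) x) x t) phi (fe (dY t)) phi);
        [| intros x Hx; apply Derive_on_eq; auto | auto].
      unfold Defs.Dx. fold y. rewrite !Rplus_assoc in *.
      eapply eq_trans; [apply Rplus_eq_compat_l; exact W |].
      rewrite <- inner_plus_l; [| apply fe_cts | apply flux1_cts | exact Cp].
      apply weak_test; auto; [apply cts_plus; [apply fe_cts | apply flux1_cts] |].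
      intros k Hk. rewrite inner_plus_l; [| apply fe_cts | apply flux1_cts | apply e_cts, Hk].
      rewrite inner_fe_e by auto. unfold dY. rewrite sd_rhs1 by auto. fold y. ring.
    + assert (W := weak_flux2 (fe y) (ge y) phi y (fun x _ => eq_refl) (fun x _ => eq_refl) Cp).
      rewrite (inner_ext (fun x => Dt T (fun x t => ge (fun j => Y j t) x) x t) phi (ge (dY t)) phi);
        [| intros x Hx; apply Derive_on_eq; auto | auto].
      unfold Defs.Dx. fold y. rewrite !Rplus_assoc in *.
      eapply eq_trans; [apply Rplus_eq_compat_l; exact W |].
      rewrite <- inner_plus_l; [| apply fe_cts | apply flux2_cts | exact Cp].
      apply weak_test; auto; [apply cts_plus; [apply fe_cts | apply flux2_cts] |].
      intros k Hk. rewrite inner_plus_l; [| apply fe_cts | apply flux2_cts | apply e_cts, Hk].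
      rewrite (inner_fe_e (shift n (dY t))) by auto. unfold shift at 1, dY.
      rewrite sd_rhs2 by auto. fold y. ring.
  - split; [apply HV, VE |]. intros phi Hphi. apply HV in Hphi.
    assert (Cp : cts 0 1 phi) by (eapply fem_cts; eauto).
    rewrite <- (proj_orth r K h V n e _ phi Fs Ob Ce Hphi).
    apply inner_ext; auto. intros x Hx. apply comb_ext; intros i Hi. apply Y0, Hi.
  - split; [apply HV, VE |]. intros phi Hphi. apply HV in Hphi.
    assert (Cp : cts 0 1 phi) by (eapply fem_cts; eauto).
    rewrite <- (proj_orth r K h V n e _ phi Fs Ob Cu Hphi).
    apply inner_ext; auto. intros x Hx. apply comb_ext; intros i Hi. apply Y0, Hi.
Qed.

Lemma coords_derivative T f t : 0 < T -> 0 <= t <= T ->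
  (forall s, 0 <= s <= T -> V (fun x => f x s)) ->
  (forall x s, 0 <= x <= 1 -> 0 <= s <= T -> ex_derive_on 0 T (fun s => f x s) s) ->
  exists d : nat -> R,
    (forall k, (k < n)%nat -> is_derive_on 0 T (fun s => inner (fun x => f x s) (e k)) t (d k)) /\
    forall x, 0 <= x <= 1 -> Dt T f x t = fe d x.
Proof.
  intros HT Ht HV HD. destruct Ob as [_ Cpl].
  destruct (comb_from_values n e e_cts) as [m [xs [g [Hg E]]]].
  set (d := fun k => sumn m (fun j => Dt T f (xs j) t * inner (g j) (e k))).
  assert (D : forall x, 0 <= x <= 1 -> is_derive_on 0 T (fun s => f x s) t (Dt T f x t)).
  { intros x Hx; apply Derive_on_correct; auto. }
  assert (Dk : forall k, (k < n)%nat ->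
    is_derive_on 0 T (fun s => inner (fun x => f x s) (e k)) t (d k)).
  { intros k Hk.
    apply (is_derive_on_ext 0 T (fun s => sumn m (fun j => f (xs j) s * inner (g j) (e k)))); auto.
    - intros s Hs.
      rewrite (inner_ext (fun x => f x s) (e k) (comb m (fun j => f (xs j) s) g) (e k)); auto.
      + rewrite inner_comb_l; auto using e_cts. intros; apply Hg; auto.
      + intros x Hx. rewrite (Cpl _ (HV s Hs) x Hx), E by auto.
        apply sumn_ext; intros j Hj. rewrite <- Cpl; auto. apply Hg, Hj.
    - apply is_derive_on_sumn; auto. intros j Hj.
      apply (is_derive_on_ext 0 T (fun s => inner (g j) (e k) * f (xs j) s)); auto; [intros; ring |].
      rewrite Rmult_comm. apply is_derive_on_scal; auto. apply D, Hg, Hj. }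
  exists d; split; auto.
  intros x Hx. apply Derive_on_eq; auto.
  apply (is_derive_on_ext 0 T (fun s => fe (fun k => inner (fun x => f x s) (e k)) x)); auto.
  - intros s Hs. symmetry. apply (Cpl _ (HV s Hs)); auto.
  - apply is_derive_on_sumn; auto. intros i Hi.
    apply (is_derive_on_ext 0 T (fun s => e i x * inner (fun x => f x s) (e i))); auto; [intros; ring |].
    rewrite Rmult_comm. apply is_derive_on_scal; auto.
Qed.

(** The direction needed for uniqueness: an arbitrary semidiscrete solution, differentiable in t
    only point by point, solves the coordinate system. *)
Lemma coords_of_semidiscrete T eta_init u_init N xs etah uh : 0 < T ->
  (forall f, V f <-> Sh r N xs f) ->
  solves_semidiscrete T beta eta0 u0 eta_init u_init r N xs etah uh ->
  exists Y, sd_solution T Y /\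
    (forall k, (k < n)%nat -> Y k 0 = inner (fun x => eta_init x - eta0) (e k) /\
       Y (n + k)%nat 0 = inner (fun x => u_init x - u0) (e k)) /\
    forall x t, 0 <= x <= 1 -> 0 <= t <= T ->
      etah x t = fe (fun j => Y j t) x /\ uh x t = ge (fun j => Y j t) x.
Proof.
  intros HT HV [S1 [S2 [S3 [S4 S5]]]].
  set (a := fun t k => inner (fun x => etah x t) (e k)).
  set (b := fun t k => inner (fun x => uh x t) (e k)).
  set (Y := fun k t => if Nat.ltb k n then a t k else b t (k - n)%nat).
  assert (O' := Ob). destruct O' as [[He _] Cpl].
  assert (Va : forall t, 0 <= t <= T -> V (fun x => etah x t)) by (intros; apply HV, S1; auto).
  assert (Vb : forall t, 0 <= t <= T -> V (fun x => uh x t)) by (intros; apply HV, S1; auto).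
  assert (Y1 : forall k t, (k < n)%nat -> Y k t = a t k).
  { intros k t Hk; unfold Y. rewrite (proj2 (Nat.ltb_lt k n) Hk); auto. }
  assert (Y2 : forall k t, Y (n + k)%nat t = b t k).
  { intros k t; unfold Y. rewrite (proj2 (Nat.ltb_ge (n + k) n)) by lia.
    replace (n + k - n)%nat with k by lia; auto. }
  assert (E1 : forall x t, 0 <= x <= 1 -> 0 <= t <= T -> etah x t = fe (fun j => Y j t) x).
  { intros x t Hx Ht. rewrite (Cpl _ (Va t Ht) x Hx). apply comb_ext; intros; rewrite Y1; auto. }
  assert (E2 : forall x t, 0 <= x <= 1 -> 0 <= t <= T -> uh x t = ge (fun j => Y j t) x).
  { intros x t Hx Ht. rewrite (Cpl _ (Vb t Ht) x Hx). apply comb_ext; intros.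
    unfold shift; rewrite Y2; auto. }
  exists Y; split; [| split; [| intros; split; auto]].
  - intros k t Hk Ht y.
    destruct (coords_derivative T etah t HT Ht Va) as [d1 [D1 F1]]; [intros; apply S2; auto |].
    destruct (coords_derivative T uh t HT Ht Vb) as [d2 [D2 F2]]; [intros; apply S2; auto |].
    destruct (Nat.lt_ge_cases k n) as [H | H].
    + assert (Ck := e_cts k H).
      apply (is_derive_on_ext 0 T (fun s => inner (fun x => etah x s) (e k))); auto.
      { intros s _; rewrite Y1; auto. }
      rewrite sd_rhs1 by auto. destruct (S3 t Ht (e k)) as [Q _]; [apply HV, He, H |].
      rewrite (inner_ext (fun x => Dt T etah x t) (e k) (fe d1) (e k)) in Q by auto.
      rewrite inner_fe_e in Q by auto.
      assert (W := weak_flux1 (fun x => etah x t) (fun x => uh x t) (e k) y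
        (fun x Hx => E1 x t Hx Ht) (fun x Hx => E2 x t Hx Ht) Ck).
      unfold Defs.Dx in Q. replace (- inner (flux1 y) (e k)) with (d1 k) by lra. apply D1, H.
    + set (k' := (k - n)%nat). assert (Hk' : (k' < n)%nat) by (unfold k'; lia).
      replace k with (n + k')%nat by (unfold k'; lia).
      assert (Ck := e_cts k' Hk').
      apply (is_derive_on_ext 0 T (fun s => inner (fun x => uh x s) (e k'))); auto.
      rewrite sd_rhs2 by auto. destruct (S3 t Ht (e k')) as [_ Q]; [apply HV, He, Hk' |].
      rewrite (inner_ext (fun x => Dt T uh x t) (e k') (fe d2) (e k')) in Q by auto.
      rewrite inner_fe_e in Q by auto.
      assert (W := weak_flux2 (fun x => etah x t) (fun x => uh x t) (e k') y
        (fun x Hx => E1 x t Hx Ht) (fun x Hx => E2 x t Hx Ht) Ck).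
      unfold Defs.Dx in Q. replace (- inner (flux2 y) (e k')) with (d2 k') by lra. apply D2, Hk'.
  - intros k Hk. rewrite Y1, Y2 by auto. split; [apply S4 | apply S5]; apply HV, He, Hk.
Qed.

End SemiDiscrete.

(** * The error estimate *)

Lemma norm2_sq m z : norm2 m z ^ 2 = sumn m (fun i => z i ^ 2).
Proof. apply pow2_sqrt, sumn_nonneg; intros; apply pow2_ge_0. Qed.

Lemma norm2_sq_inner r K h V n e z : fem_space r K h V -> fem_onb V n e ->
  norm2 (n + n) z ^ 2 = inner (comb n z e) (comb n z e)
    + inner (comb n (shift n z) e) (comb n (shift n z) e).
Proof.
  intros F [O _]. rewrite norm2_sq, sumn_split, !(inner_comb_comb r K h V) by auto.
  f_equal; apply sumn_ext; intros; unfold shift; ring.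
Qed.

Section StaticError.

(* F j and G j are the j-th x-derivatives of eta and u at a fixed time. *)
Variables (F G : nat -> R -> R) (beta bx : R -> R) (eta0 u0 : R).
Variables (n : nat) (e : nat -> R -> R).

Definition Uf (x : R) : R := G O x + u0.
Definition wf (x : R) : R := beta x + F O x + eta0.
Definition wf' (x : R) : R := bx x + F 1%nat x.
Definition rho0 (x : R) : R := F O x - comb n (fun i => inner (F O) (e i)) e x.
Definition rho1 (x : R) : R := F 1%nat x - comb n (fun i => inner (F O) (e i)) (de e) x.
Definition sig0 (x : R) : R := G O x - comb n (fun i => inner (G O) (e i)) e x.
Definition sig1 (x : R) : R := G 1%nat x - comb n (fun i => inner (G O) (e i)) (de e) x.

Definition res1 (ka : R) (z : nat -> R) (x : R) : R :=
  residual1 (Uf x) (wf x) (G 1%nat x) (wf' x) (rho0 x) (rho1 x) (sig0 x) (sig1 x)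
    (comb n z e x) (comb n z (de e) x) (comb n (shift n z) e x) (comb n (shift n z) (de e) x) ka.

Definition res2 (ka : R) (z : nat -> R) (x : R) : R :=
  residual2 (Uf x) (G 1%nat x) (rho1 x) (sig0 x) (sig1 x)
    (comb n z (de e) x) (comb n (shift n z) e x) (comb n (shift n z) (de e) x) ka.

End StaticError.

(** All spatial estimates at one fixed time, for an arbitrary vector z of discrete errors. The left
    side is the spatial contribution to half the time derivative of the energy. *)
Lemma error_rate r K M : (3 <= r)%nat -> 0 < K -> 0 <= M -> exists C, 0 < C /\
  forall h V n e, 0 < h <= 1 -> fem_space r K h V -> fem_onb V n e ->
  forall (F G : nat -> R -> R) (beta bx : R -> R) (eta0 u0 : R),
  (forall j, (j < r)%nat -> dfn 0 1 (F j) (F (S j))) ->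
  (forall j, (j < r)%nat -> dfn 0 1 (G j) (G (S j))) ->
  dfn 0 1 beta bx -> cts 0 1 bx -> F O 0 = 0 -> G O 0 = 0 ->
  (forall x, 0 <= x <= 1 -> Rabs (F r x) <= M /\ Rabs (G r x) <= M /\ Rabs (Uf G u0 x) <= M /\
     Rabs (wf F beta eta0 x) <= M /\ Rabs (G 1%nat x) <= M /\ Rabs (wf' F bx x) <= M) ->
  0 < Uf G u0 1 -> 0 <= wf F beta eta0 1 -> wf F beta eta0 1 <= Uf G u0 1 ^ 2 ->
  forall z, let ka := cutoff (n + n) (sqrt (h ^ 3 / K)) z in
  - inner (res1 F G beta bx eta0 u0 n e ka z) (comb n z e)
  - inner (res2 F G u0 n e ka z)
      (proj n e (fun x => wf F beta eta0 x * comb n (shift n z) e x))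
  <= C * norm2 (n + n) z ^ 2 + C * h ^ (2 * (r - 1)).
Proof.
  intros Hr HK HM.
  destruct (proj_error r K M Hr HK HM) as [C1 [HC1 PE]].
  (* The sum bounds the exact solution and the projection errors at once. *)
  destruct (energy_rate (M + C1) K ltac:(lra) HK) as [C2 [HC2 ER]].
  exists (C2 + C2 * (4 * C1)). split; [nra |].
  intros h V n e Hh Fs Ob F G beta bx eta0 u0 DF DG Db Cbx F0 G0 B U1 w1 wU z ka.
  assert (CF1 : cts 0 1 (F 1%nat)) by (eapply dfn_cts; [lra | apply DF; lia]).
  assert (CG1 : cts 0 1 (G 1%nat)) by (eapply dfn_cts; [lra | apply DG; lia]).
  assert (CF0 : cts 0 1 (F O)) by (eapply dfn_cts; [lra | apply DF; lia]).
  assert (CG0 : cts 0 1 (G O)) by (eapply dfn_cts; [lra | apply DG; lia]).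
  assert (Cb : cts 0 1 beta) by (eapply dfn_cts; [lra | eauto]).
  destruct (PE h V n e Hh Fs Ob F DF F0 CF1 (fun x Hx => proj1 (B x Hx))) as [P1 [P2 P3]].
  destruct (PE h V n e Hh Fs Ob G DG G0 CG1 (fun x Hx => proj1 (proj2 (B x Hx)))) as [S1 [S2 S3]].
  set (th := comb n z e). set (th' := comb n z (de e)).
  set (xi := comb n (shift n z) e). set (xi' := comb n (shift n z) (de e)).
  assert (Cth' : cts 0 1 th') by (eapply onb_comb_de_cts; eauto).
  assert (Cxi' : cts 0 1 xi') by (eapply onb_comb_de_cts; eauto).
  assert (Cth : cts 0 1 th) by (eapply onb_comb_cts; eauto).
  assert (Cxi : cts 0 1 xi) by (eapply onb_comb_cts; eauto).
  assert (Vth : V th) by exact (onb_comb_V r K h V n e z Fs Ob).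
  assert (Vxi : V xi) by exact (onb_comb_V r K h V n e (shift n z) Fs Ob).
  assert (Dth : dfn 0 1 th th') by exact (onb_comb_dfn r K h V n e z Fs Ob).
  assert (Dxi : dfn 0 1 xi xi') by exact (onb_comb_dfn r K h V n e (shift n z) Fs Ob).
  assert (Eth : forall x, 0 <= x <= 1 -> Derive_on 0 1 th x = th' x).
  { intros x Hx; apply Derive_on_eq; auto; lra. }
  assert (Exi : forall x, 0 <= x <= 1 -> Derive_on 0 1 xi x = xi' x).
  { intros x Hx; apply Derive_on_eq; auto; lra. }
  set (w := wf F beta eta0) in *. set (U := Uf G u0) in *.
  assert (Dw : dfn 0 1 w (wf' F bx)).
  { intros x Hx. unfold w, wf, wf'. replace (bx x + F 1%nat x) with (bx x + F 1%nat x + 0) by ring.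
    apply (is_derive_on_plus 0 1 (fun x => beta x + F O x)); auto; [| apply is_derive_on_const, Hx].
    apply is_derive_on_plus; auto. apply DF; auto; lia. }
  assert (DU : dfn 0 1 U (G 1%nat)).
  { intros x Hx. unfold U, Uf. replace (G 1%nat x) with (G 1%nat x + 0) by ring.
    apply is_derive_on_plus; auto; [apply DG; auto; lia | apply is_derive_on_const, Hx]. }
  assert (Cw : cts 0 1 w) by (eapply dfn_cts; [lra | eauto]).
  assert (Crho : cts 0 1 (rho0 F n e)) by (apply cts_minus; [exact CF0 | eapply onb_comb_cts; eauto]).
  assert (Crho1 : cts 0 1 (rho1 F n e)) by (apply cts_minus; [exact CF1 | eapply onb_comb_de_cts; eauto]).
  assert (Csig : cts 0 1 (sig0 G n e)) by (apply cts_minus; [exact CG0 | eapply onb_comb_cts; eauto]).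
  assert (Csig1 : cts 0 1 (sig1 G n e)) by (apply cts_minus; [exact CG1 | eapply onb_comb_de_cts; eauto]).
  set (wxi := fun x => w x * xi x).
  assert (Cwxi : cts 0 1 wxi) by (apply cts_mult; auto).
  set (ze := fun x => proj n e wxi x - wxi x).
  assert (Cpw : cts 0 1 (proj n e wxi)) by (eapply proj_cts; eauto).
  assert (Cze : cts 0 1 ze) by (apply cts_minus; auto).
  set (b := sqrt (h ^ 3 / K)) in *.
  assert (h3 : 0 < h ^ 3) by (apply pow_lt; lra).
  assert (hK : 0 < h ^ 3 / K) by (apply Rdiv_lt_0_compat; auto).
  assert (Hb : 0 < b) by (apply sqrt_lt_R0, hK).
  assert (b2 : b ^ 2 = h ^ 3 / K) by (apply pow2_sqrt; lra).
  assert (Hka := cutoff_range (n + n) b z Hb). fold ka in Hka.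
  assert (Nz := norm2_sq_inner r K h V n e z Fs Ob). fold th xi in Nz.
  assert (Nth := inner_nonneg th Cth). assert (Nxi := inner_nonneg xi Cxi).
  assert (Kb : ka ^ 2 * norm2 (n + n) z ^ 2 <= b ^ 2).
  { rewrite <- Rpow_mult_distr. apply pow_incr. split; [| apply cutoff_norm, Hb].
    apply Rmult_le_pos; [lra | apply sqrt_pos]. }
  (* The retracted vector has norm at most sqrt(h^3/K), and the inverse inequality with constant
     K/h^3 turns this into the bound 1 for derivatives. *)
  assert (Small : forall v, V v -> inner v v <= norm2 (n + n) z ^ 2 ->
    forall x, 0 <= x <= 1 -> ka * Rabs (Derive_on 0 1 v x) <= 1).
  { intros v Hv Nv x Hx. assert (I := fem_inverse_sup _ _ _ _ Fs v x Hv Hx).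
    apply Rsqr_incr_0_var; [| lra]. rewrite Rsqr_mult, <- Rsqr_abs, !Rsqr_pow2, pow1.
    apply Rle_trans with (ka ^ 2 * (K / h ^ 3 * norm2 (n + n) z ^ 2)).
    - apply Rmult_le_compat_l; [apply pow2_ge_0 |]. eapply Rle_trans; [exact I |].
      apply Rmult_le_compat_l; auto. apply Rdiv_le_0_compat; lra.
    - replace (ka ^ 2 * (K / h ^ 3 * norm2 (n + n) z ^ 2))
        with (K / h ^ 3 * (ka ^ 2 * norm2 (n + n) z ^ 2)) by ring.
      apply Rle_trans with (K / h ^ 3 * b ^ 2).
      + apply Rmult_le_compat_l; auto. apply Rdiv_le_0_compat; lra.
      + rewrite b2. right; field; lra. }
  assert (Lw : forall x y, 0 <= x <= 1 -> 0 <= y <= 1 -> Rabs (w x - w y) <= M * Rabs (x - y)).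
  { assert (L1 : forall x y, 0 <= x -> x <= y -> y <= 1 -> Rabs (w y - w x) <= M * Rabs (y - x)).
    { intros x y H1 H2 H3. destruct (dfn_MVT 0 1 _ _ x y Dw H1 H2 H3) as [c [Hc E]].
      rewrite E, Rabs_mult. apply Rmult_le_compat_r; [apply Rabs_pos |]. apply B; lra. }
    intros x y Hx Hy; destruct (Rle_dec x y).
    - rewrite Rabs_minus_sym, (Rabs_minus_sym x). apply L1; lra.
    - apply L1; lra. }
  destruct (fem_superapprox _ _ _ _ Fs w M xi HM Cw Lw Vxi) as [g [Hg Ig]].
  (* Up to sign ze is the projection error of w xi, so by best approximation the superapproximant g
     bounds it. *)
  assert (Ize : inner ze ze <= K * ((M + C1) * h) ^ 2 * inner xi xi).
  { rewrite (inner_ext ze ze (fun x => (-1) * (wxi x - proj n e wxi x))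
      (fun x => (-1) * (wxi x - proj n e wxi x))) by (intros; unfold ze; ring).
    rewrite inner_scal_l by auto with cts.
    rewrite inner_cts_sym, inner_scal_l by auto with cts.
    assert (PB := proj_best r K h V n e wxi g Fs Ob Cwxi Hg).
    assert (Q : K * (M * h) ^ 2 * inner xi xi <= K * ((M + C1) * h) ^ 2 * inner xi xi).
    { apply Rmult_le_compat_r; auto. apply Rmult_le_compat_l; [lra |]. apply pow_incr.
      split; [apply Rmult_le_pos; lra | apply Rmult_le_compat_r; lra]. }
    change (inner (fun x => wxi x - g x) (fun x => wxi x - g x)
      <= K * (M * h) ^ 2 * inner xi xi) in Ig. lra. }
  assert (R := ER h U w (G 1%nat) (wf' F bx) (rho0 F n e) (rho1 F n e) (sig0 G n e) (sig1 G n e)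
    th th' xi xi' ze ka Hh DU Dw Dth Dxi CG1).
  rewrite (inner_ext (res2 F G u0 n e ka z) (proj n e wxi) (res2 F G u0 n e ka z)
    (fun x => w x * xi x + ze x)) by (intros; unfold ze, wxi; ring).
  assert (Ifem : forall v v', V v -> (forall x, 0 <= x <= 1 -> Derive_on 0 1 v x = v' x) ->
     inner v' v' <= K / h ^ 2 * inner v v).
  { intros v v' Hv E. rewrite <- (inner_ext (Derive_on 0 1 v) (Derive_on 0 1 v)) by auto.
    apply (fem_inverse _ _ _ _ Fs v Hv). }
  eapply Rle_trans; [apply R; auto |].
  - apply cts_plus; auto.
  - intros x Hx. destruct (B x Hx) as [_ [_ [B1 [B2 [B3 B4]]]]].
    destruct (P3 x Hx) as [P4 P5]. destruct (S3 x Hx) as [S4 S5].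
    assert (C1h : C1 * h <= (M + C1) * h) by (apply Rmult_le_compat_r; lra).
    unfold rho0, rho1, sig0, sig1.
    repeat split; try lra.
    + rewrite <- Eth by auto. apply Small; auto. lra.
    + rewrite <- Exi by auto. apply Small; auto. lra.
  - lra.
  - apply (fem_zero _ _ _ _ Fs); auto.
  - apply (fem_zero _ _ _ _ Fs); auto.
  - rewrite Nz.
    assert (H4 : inner (rho0 F n e) (rho0 F n e) + inner (sig0 G n e) (sig0 G n e)
      + inner (rho1 F n e) (rho1 F n e) + inner (sig1 G n e) (sig1 G n e)
      <= 4 * C1 * h ^ (2 * (r - 1))).
    { unfold rho0, rho1, sig0, sig1. lra. }
    apply (Rmult_le_compat_l C2) in H4; [| lra].
    assert (0 <= C2 * (4 * C1) * (inner th th + inner xi xi)) by (repeat apply Rmult_le_pos; lra).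
    assert (0 < h ^ (2 * (r - 1))) by (apply pow_lt; lra).
    assert (0 <= C2 * h ^ (2 * (r - 1))) by nra. lra.
Qed.

(** * The equations satisfied by the discrete errors *)

Section ErrorEquation.

Variables (r : nat) (K h : R) (V : (R -> R) -> Prop) (n : nat) (e : nat -> R -> R).
Hypothesis Fs : fem_space r K h V.
Hypothesis Ob : fem_onb V n e.
Variables (beta : R -> R) (eta0 u0 : R).
Hypothesis Cb : cts 0 1 beta.
Hypothesis Cbx : cts 0 1 (Derive_on 0 1 beta).
Variables (F G : nat -> R -> R) (Ft Gt : R -> R) (y z : nat -> R) (ka : R).
Hypothesis CF0 : cts 0 1 (F O).
Hypothesis CF1 : cts 0 1 (F 1%nat).
Hypothesis CG0 : cts 0 1 (G O).
Hypothesis CG1 : cts 0 1 (G 1%nat).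
Hypothesis CFt : cts 0 1 Ft.
Hypothesis CGt : cts 0 1 Gt.
Hypothesis Yz : forall i, (i < n)%nat -> y i + z i = inner (F O) (e i) /\
  y (n + i)%nat + z (n + i)%nat = inner (G O) (e i).

Lemma comb_split1 (f : nat -> R -> R) x :
  comb n y f x = comb n (fun i => inner (F O) (e i)) f x - comb n z f x.
Proof.
  unfold comb; rewrite <- sumn_minus. apply sumn_ext; intros i Hi.
  rewrite <- (proj1 (Yz i Hi)); ring.
Qed.

Lemma comb_split2 (f : nat -> R -> R) x : comb n (shift n y) f x
  = comb n (fun i => inner (G O) (e i)) f x - comb n (shift n z) f x.
Proof.
  unfold comb, shift; rewrite <- sumn_minus. apply sumn_ext; intros i Hi.
  rewrite <- (proj2 (Yz i Hi)); ring.
Qed.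

Lemma res_cts : cts 0 1 (res1 F G beta (Derive_on 0 1 beta) eta0 u0 n e ka z) /\
  cts 0 1 (res2 F G u0 n e ka z).
Proof.
  assert (Cc : forall a, cts 0 1 (comb n a e)) by (intros; eapply onb_comb_cts; eauto).
  assert (Cd : forall a, cts 0 1 (comb n a (de e))) by (intros; eapply onb_comb_de_cts; eauto).
  assert (C1 := Cc z). assert (C2 := Cc (shift n z)). assert (C3 := Cd z). assert (C4 := Cd (shift n z)).
  assert (C5 := Cc (fun i => inner (F O) (e i))). assert (C6 := Cd (fun i => inner (F O) (e i))).
  assert (C7 := Cc (fun i => inner (G O) (e i))). assert (C8 := Cd (fun i => inner (G O) (e i))).
  split; unfold res1, res2, residual1, residual2, Uf, wf, wf', rho0, rho1, sig0, sig1; solve_cts.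
Qed.

(** The exact equation is subtracted from the truncated discrete one. The flux difference contains
    the full product of discrete errors, and the correction with factor 1 - ka^2 reduces it to the
    damped one in [residual1]. *)
Lemma sd_error1 k : (k < n)%nat ->
  (forall x, 0 <= x <= 1 -> Ft x + u0 * F 1%nat x + (beta x + eta0) * G 1%nat x
     + (F 1%nat x * G O x + F O x * G 1%nat x) + (G O x + u0) * Derive_on 0 1 beta x = 0) ->
  inner Ft (e k) - (sd_c n e beta u0 k + sd_l n e beta eta0 u0 k y
    + (sd_q n e k y y - (1 - ka ^ 2) * sd_q n e k z z))
  = - inner (res1 F G beta (Derive_on 0 1 beta) eta0 u0 n e ka z) (e k).
Proof.
  intros Hk Eq.
  assert (R := sd_rhs1 r K h V n e Fs Ob beta eta0 u0 Cb Cbx k y Hk).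
  assert (Q : sd_q n e k z z = - inner (quad1 n e z z) (e k)).
  { unfold sd_q. rewrite (proj2 (Nat.ltb_lt k n) Hk). reflexivity. }
  assert (Ce : cts 0 1 (e k)) by (eapply onb_cts; eauto).
  assert (C1 := flux1_cts r K h V n e Fs Ob beta eta0 u0 Cb Cbx y).
  assert (C2 := quad1_cts r K h V n e Fs Ob z z).
  assert (C3 := proj1 res_cts).
  rewrite <- (Rmult_1_l (inner (res1 _ _ _ _ _ _ _ _ _ _) _)), <- Ropp_mult_distr_l_reverse.
  rewrite <- inner_scal_l by auto.
  rewrite (inner_ext (fun x => - (1) * res1 F G beta (Derive_on 0 1 beta) eta0 u0 n e ka z x) (e k)
    (fun x => (Ft x + flux1 n e beta eta0 u0 y x) - (1 - ka ^ 2) * quad1 n e z z x) (e k)); auto.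
  - rewrite (inner_minus_l (fun x => Ft x + flux1 n e beta eta0 u0 y x)
      (fun x => (1 - ka ^ 2) * quad1 n e z z x)), inner_scal_l, inner_plus_l by auto with cts.
    rewrite Q. lra.
  - intros x Hx. specialize (Eq x Hx).
    unfold res1, residual1, flux1, quad1, Uf, wf, wf', rho0, rho1, sig0, sig1.
    rewrite !comb_split1, !comb_split2. lra.
Qed.

Lemma sd_error2 k : (k < n)%nat ->
  (forall x, 0 <= x <= 1 -> Gt x + F 1%nat x + u0 * G 1%nat x + G O x * G 1%nat x = 0) ->
  inner Gt (e k) - (sd_c n e beta u0 (n + k) + sd_l n e beta eta0 u0 (n + k) y
    + (sd_q n e (n + k) y y - (1 - ka ^ 2) * sd_q n e (n + k) z z))
  = - inner (res2 F G u0 n e ka z) (e k).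
Proof.
  intros Hk Eq.
  assert (R := sd_rhs2 r K h V n e Fs Ob beta eta0 u0 k y Hk).
  assert (Q : sd_q n e (n + k) z z = - inner (quad2 n e z z) (e k)).
  { unfold sd_q. rewrite (proj2 (Nat.ltb_ge (n + k) n)) by lia.
    replace (n + k - n)%nat with k by lia. reflexivity. }
  assert (Ce : cts 0 1 (e k)) by (eapply onb_cts; eauto).
  assert (C1 := flux2_cts r K h V n e Fs Ob u0 y).
  assert (C2 := quad2_cts r K h V n e Fs Ob z z).
  assert (C3 := proj2 res_cts).
  rewrite <- (Rmult_1_l (inner (res2 _ _ _ _ _ _ _) _)), <- Ropp_mult_distr_l_reverse.
  rewrite <- inner_scal_l by auto.
  rewrite (inner_ext (fun x => - (1) * res2 F G u0 n e ka z x) (e k)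
    (fun x => (Gt x + flux2 n e u0 y x) - (1 - ka ^ 2) * quad2 n e z z x) (e k)); auto.
  - rewrite (inner_minus_l (fun x => Gt x + flux2 n e u0 y x)
      (fun x => (1 - ka ^ 2) * quad2 n e z z x)), inner_scal_l, inner_plus_l by auto with cts.
    rewrite Q. lra.
  - intros x Hx. specialize (Eq x Hx).
    unfold res2, residual2, flux2, quad2, Uf, rho1, sig0, sig1.
    rewrite !comb_split1, !comb_split2. lra.
Qed.

End ErrorEquation.

(** Symmetry of W merges the two terms in which a coordinate is differentiated. It is applied to the
    time-dependent Gram matrix of the basis with weight w. *)
Lemma quad_form_derivative n T (b : nat -> R -> R) (db : nat -> R) (W : nat -> nat -> R -> R)
    (dW : nat -> nat -> R) t : 0 <= t <= T ->
  (forall i, (i < n)%nat -> is_derive_on 0 T (b i) t (db i)) ->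
  (forall i j, (i < n)%nat -> (j < n)%nat -> is_derive_on 0 T (W i j) t (dW i j)) ->
  (forall i j, W i j t = W j i t) ->
  is_derive_on 0 T (fun s => sumn n (fun i => sumn n (fun j => b i s * b j s * W i j s))) t
    (2 * sumn n (fun i => db i * sumn n (fun j => b j t * W i j t))
     + sumn n (fun i => b i t * sumn n (fun j => b j t * dW i j))).
Proof.
  intros Ht Db DW Sym.
  assert (E : sumn n (fun i => sumn n (fun j => (db i * b j t + b i t * db j) * W i j t
      + b i t * b j t * dW i j))
    = 2 * sumn n (fun i => db i * sumn n (fun j => b j t * W i j t))
     + sumn n (fun i => b i t * sumn n (fun j => b j t * dW i j))).
  { rewrite (sumn_ext n _ (fun i => db i * sumn n (fun j => b j t * W i j t)
      + (sumn n (fun j => db j * (b i t * W j i t)) + b i t * sumn n (fun j => b j t * dW i j)))).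
    - rewrite !sumn_plus, sumn_swap.
      rewrite (sumn_ext n (fun j => sumn n (fun i => db j * (b i t * W j i t)))
        (fun j => db j * sumn n (fun i => b i t * W j i t))) by (intros; apply sumn_scal).
      ring.
    - intros i Hi. rewrite <- !sumn_scal, <- !sumn_plus. apply sumn_ext; intros j Hj.
      rewrite (Sym j i). ring. }
  rewrite <- E. apply is_derive_on_sumn; auto. intros i Hi.
  apply (is_derive_on_sumn 0 T n (fun j s => b i s * b j s * W i j s)
    (fun j => (db i * b j t + b i t * db j) * W i j t + b i t * b j t * dW i j)); auto.
  intros j Hj. apply (is_derive_on_mult 0 T (fun s => b i s * b j s) (W i j)); auto.
  apply is_derive_on_mult; auto.
Qed.

Lemma sumn_weight_form (n : nat) (e : nat -> R -> R) a g :
  (forall i, (i < n)%nat -> cts 0 1 (e i)) -> cts 0 1 g -> forall i, (i < n)%nat ->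
  sumn n (fun j => a j * inner g (fun x => e i x * e j x))
  = inner (fun x => g x * comb n a e x) (e i).
Proof.
  intros Ce Cg i Hi.
  transitivity (inner (comb n a e) (fun x => g x * e i x)).
  - rewrite inner_comb_l by auto with cts. apply sumn_ext; intros j Hj. f_equal.
    apply RInt_on_ext; [lra | intros; ring].
  - apply RInt_on_ext; [lra | intros; ring].
Qed.

Definition sd_proj (n : nat) (e : nat -> R -> R) (eta u : R -> R -> R) (j : nat) (t : R) : R :=
  if Nat.ltb j n then inner (fun x => eta x t) (e j) else inner (fun x => u x t) (e (j - n)%nat).

Lemma sd_proj1 n e eta u j t : (j < n)%nat ->
  sd_proj n e eta u j t = inner (fun x => eta x t) (e j).
Proof. intros H; unfold sd_proj. rewrite (proj2 (Nat.ltb_lt j n) H); auto. Qed.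

Lemma sd_proj2 n e eta u j t : sd_proj n e eta u (n + j) t = inner (fun x => u x t) (e j).
Proof.
  unfold sd_proj. rewrite (proj2 (Nat.ltb_ge (n + j) n)) by lia.
  replace (n + j - n)%nat with j by lia; auto.
Qed.

Definition truncated_solution (n : nat) (e : nat -> R -> R) (beta : R -> R) (eta0 u0 T b : R)
    (eta u : R -> R -> R) (Y : nat -> R -> R) : Prop :=
  forall i, (i < n + n)%nat -> Y i 0 = sd_proj n e eta u i 0 /\ forall t, 0 <= t <= T ->
    let y := fun j => Y j t in let z := fun j => sd_proj n e eta u j t - Y j t in
    is_derive (Y i) t (sd_c n e beta u0 i + sd_l n e beta eta0 u0 i y
      + (sd_q n e i y y - (1 - cutoff (n + n) b z ^ 2) * sd_q n e i z z)).

(** The hypotheses in the form in which the estimates consume them. [rs_depth] makes the weighted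
    energy coercive, [rs_outflow] is the condition at x = 1, and the bound on eta_t controls the
    time derivative of the weight w. *)
Record regular_solution (r : nat) (T M b : R) (beta : R -> R) (eta0 u0 : R)
    (eta u : R -> R -> R) : Prop := {
  rs_beta : dfn 0 1 beta (Derive_on 0 1 beta);
  rs_beta_cts : cts 0 1 (Derive_on 0 1 beta);
  rs_eta : Cm_cyl T r eta;
  rs_u : Cm_cyl T r u;
  rs_eta_0 : forall t, 0 <= t <= T -> eta 0 t = 0;
  rs_u_0 : forall t, 0 <= t <= T -> u 0 t = 0;
  rs_bounds : forall x t, 0 <= x <= 1 -> 0 <= t <= T ->
    Rabs (Dxn r eta x t) <= M /\ Rabs (Dxn r u x t) <= M /\ Rabs (u x t + u0) <= M /\
    Rabs (beta x + eta x t + eta0) <= M /\ Rabs (Defs.Dx u x t) <= M /\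
    Rabs (Derive_on 0 1 beta x + Defs.Dx eta x t) <= M /\ Rabs (Dt T eta x t) <= M;
  rs_depth : forall x t, 0 <= x <= 1 -> 0 <= t <= T -> b <= beta x + eta x t + eta0;
  rs_outflow : forall t, 0 <= t <= T -> 0 < u 1 t + u0 /\
    beta 1 + eta 1 t + eta0 <= (u 1 t + u0) ^ 2;
  rs_eq1 : forall x t, 0 <= x <= 1 -> 0 <= t <= T ->
    Dt T eta x t + u0 * Defs.Dx eta x t + (beta x + eta0) * Defs.Dx u x t
    + (Defs.Dx eta x t * u x t + eta x t * Defs.Dx u x t) + (u x t + u0) * Derive_on 0 1 beta x = 0;
  rs_eq2 : forall x t, 0 <= x <= 1 -> 0 <= t <= T ->
    Dt T u x t + Defs.Dx eta x t + u0 * Defs.Dx u x t + u x t * Defs.Dx u x t = 0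
}.

Lemma sd_proj_derive n e T r eta u t : (1 <= r)%nat -> 0 < T -> 0 <= t <= T ->
  (forall i, (i < n)%nat -> cts 0 1 (e i)) -> Cm_cyl T r eta -> Cm_cyl T r u ->
  forall i, (i < n)%nat ->
  is_derive_on 0 T (sd_proj n e eta u i) t (inner (fun x => Dt T eta x t) (e i)) /\
  is_derive_on 0 T (sd_proj n e eta u (n + i)) t (inner (fun x => Dt T u x t) (e i)).
Proof.
  intros Hr HT Ht Ce He Hu i Hi. destruct r as [| r]; [lia |].
  assert (A : forall f, Cm_cyl T (S r) f ->
    is_derive_on 0 T (fun s => inner (fun x => f x s) (e i)) t (inner (fun x => Dt T f x t) (e i))).
  { intros f Hf. apply (is_derive_on_inner T f (fun x s => Dt T f x s)); auto.
    - intros x Hx. apply (Cm_cyl_Dt T r); auto.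
    - apply (Cm_cyl_rect_cts T r); [lra | apply Hf].
    - intros s Hs. apply (rect_cts_x T); auto. apply (Cm_cyl_rect_cts T (S r)); auto; lra. }
  split.
  - apply (is_derive_on_ext 0 T (fun s => inner (fun x => eta x s) (e i))); auto.
    intros; rewrite sd_proj1; auto.
  - apply (is_derive_on_ext 0 T (fun s => inner (fun x => u x s) (e i))); auto.
    intros; rewrite sd_proj2; auto.
Qed.

(* Energy estimate: sum z_i^2 + (w xi, xi) is differentiated, with test functions th and
   P(w xi). *)
Lemma semidiscrete_error r K M b T : (3 <= r)%nat -> 0 < K -> 0 <= M -> 0 < b -> 0 < T ->
  exists C, 0 < C /\ forall h V n e, 0 < h <= 1 -> fem_space r K h V -> fem_onb V n e ->
  forall beta eta0 u0 eta u Y, regular_solution r T M b beta eta0 u0 eta u ->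
  truncated_solution n e beta eta0 u0 T (sqrt (h ^ 3 / K)) eta u Y ->
  forall t, 0 <= t <= T ->
  norm2 (n + n) (fun j => sd_proj n e eta u j t - Y j t) ^ 2 <= C * h ^ (2 * (r - 1)).
Proof.
  intros Hr HK HM Hb HT.
  destruct (error_rate r K M Hr HK HM) as [C1 [HC1 ER]].
  assert (Hib : 0 < / b) by (apply Rinv_0_lt_compat, Hb).
  (* The rate is 2 C1 from the spatial terms plus M from the time derivative of the weight; 1 + 1/b
     compares |z|^2 with the energy, since w >= b. *)
  set (la := (2 * C1 + M) * (1 + / b)).
  assert (Hla : 0 < la) by (unfold la; apply Rmult_lt_0_compat; lra).
  exists ((1 + / b) * (2 * C1 / la * exp (la * T))). split.
  { repeat apply Rmult_lt_0_compat; try lra; [apply Rinv_0_lt_compat, Hla | apply exp_pos]. }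
  intros h V n e Hh Fs Ob beta eta0 u0 eta u Y RS TS.
  destruct RS as [Rb Rbc Re Ru Re0 Ru0 RB Rd Ro Rq1 Rq2].
  assert (Ce : forall i, (i < n)%nat -> cts 0 1 (e i)) by (intros; eapply onb_cts; eauto).
  assert (Cb : cts 0 1 beta) by (eapply dfn_cts; [lra | eauto]).
  set (z := fun t j => sd_proj n e eta u j t - Y j t).
  set (cut := fun t => cutoff (n + n) (sqrt (h ^ 3 / K)) (z t)).
  set (F := fun t j x => Dxn j eta x t). set (G := fun t j x => Dxn j u x t).
  set (w := fun t x => beta x + eta x t + eta0).
  set (R1 := fun t => res1 (F t) (G t) beta (Derive_on 0 1 beta) eta0 u0 n e (cut t) (z t)).
  set (R2 := fun t => res2 (F t) (G t) u0 n e (cut t) (z t)).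
  assert (Cm1 : forall f, Cm_cyl T r f -> Cm_cyl T 2 f) by (intros f Hf; apply (Cm_cyl_le T 2 r); auto; lia).
  assert (Cet : rect_cts T (fun x t => Dt T eta x t)).
  { apply (Cm_cyl_rect_cts T 1); [lra | apply (Cm1 _ Re)]. }
  assert (Cut : rect_cts T (fun x t => Dt T u x t)).
  { apply (Cm_cyl_rect_cts T 1); [lra | apply (Cm1 _ Ru)]. }
  assert (DF : forall t, 0 <= t <= T -> forall j, (j < r)%nat -> dfn 0 1 (F t j) (F t (S j))).
  { intros t Ht j Hj; apply (Cm_cyl_Dxn_derive T r eta j t); auto. }
  assert (DG : forall t, 0 <= t <= T -> forall j, (j < r)%nat -> dfn 0 1 (G t j) (G t (S j))).
  { intros t Ht j Hj; apply (Cm_cyl_Dxn_derive T r u j t); auto. }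
  assert (CF : forall t, 0 <= t <= T -> forall j, (j < r)%nat -> cts 0 1 (F t j)).
  { intros t Ht j Hj; eapply dfn_cts; [lra | apply DF; auto]. }
  assert (CG : forall t, 0 <= t <= T -> forall j, (j < r)%nat -> cts 0 1 (G t j)).
  { intros t Ht j Hj; eapply dfn_cts; [lra | apply DG; auto]. }
  assert (Cw : forall t, 0 <= t <= T -> cts 0 1 (w t)).
  { intros t Ht. apply cts_plus; [apply cts_plus; [exact Cb | apply (CF t Ht O); lia] | apply cts_const]. }
  assert (Dz : forall t, 0 <= t <= T -> forall i, (i < n)%nat ->
    is_derive_on 0 T (fun s => z s i) t (- inner (R1 t) (e i)) /\
    is_derive_on 0 T (fun s => z s (n + i)%nat) t (- inner (R2 t) (e i))).
  { intros t Ht i Hi.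
    destruct (sd_proj_derive n e T r eta u t ltac:(lia) HT Ht Ce Re Ru i Hi) as [P1 P2].
    assert (Yz : forall j, (j < n)%nat -> Y j t + z t j = inner (F t O) (e j) /\
      Y (n + j)%nat t + z t (n + j)%nat = inner (G t O) (e j)).
    { intros j Hj; unfold z. rewrite sd_proj1, sd_proj2 by auto.
      change (F t O) with (fun x => eta x t). change (G t O) with (fun x => u x t). split; ring. }
    assert (CFt := rect_cts_x T _ t Cet Ht). assert (CGt := rect_cts_x T _ t Cut Ht).
    assert (E1 := sd_error1 r K h V n e Fs Ob beta eta0 u0 Cb Rbc (F t) (G t)
      (fun x => Dt T eta x t) (fun j => Y j t) (z t) (cut t)
      (CF t Ht O ltac:(lia)) (CF t Ht 1%nat ltac:(lia)) (CG t Ht O ltac:(lia))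
      (CG t Ht 1%nat ltac:(lia)) CFt Yz i Hi (fun x Hx => Rq1 x t Hx Ht)).
    assert (E2 := sd_error2 r K h V n e Fs Ob beta eta0 u0 Cb Rbc (F t) (G t)
      (fun x => Dt T u x t) (fun j => Y j t) (z t) (cut t)
      (CF t Ht O ltac:(lia)) (CF t Ht 1%nat ltac:(lia)) (CG t Ht O ltac:(lia))
      (CG t Ht 1%nat ltac:(lia)) CGt Yz i Hi (fun x Hx => Rq2 x t Hx Ht)).
    destruct (TS i ltac:(lia)) as [_ T1]. destruct (TS (n + i)%nat ltac:(lia)) as [_ T2].
    split.
    - unfold R1; rewrite <- E1. apply is_derive_on_minus; [exact Ht | exact P1 |].
      apply (is_derive_on_of_is_derive 0 T _ (Y i)); [exact Ht | exact (T1 t Ht) | auto].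
    - unfold R2; rewrite <- E2. apply is_derive_on_minus; [exact Ht | exact P2 |].
      apply (is_derive_on_of_is_derive 0 T _ (Y (n + i)%nat)); [exact Ht | exact (T2 t Ht) | auto]. }
  (* Written with this Gram matrix, (w xi, xi) is a quadratic form in the coordinates, whose time
     derivative needs only those of the coordinates and of the entries. *)
  set (W := fun i j s => inner (w s) (fun x => e i x * e j x)).
  set (dW := fun t i j => inner (fun x => Dt T eta x t) (fun x => e i x * e j x)).
  assert (DW : forall t, 0 <= t <= T -> forall i j, (i < n)%nat -> (j < n)%nat ->
    is_derive_on 0 T (W i j) t (dW t i j)).
  { intros t Ht i j Hi Hj.
    apply (is_derive_on_inner T (fun x s => w s x) (fun x s => Dt T eta x s)); auto with cts.
    intros x Hx s Hs. unfold w.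
    replace (Dt T eta x s) with (0 + Dt T eta x s + 0) by ring.
    apply (is_derive_on_plus 0 T (fun s => beta x + eta x s)); auto; [| apply is_derive_on_const, Hs].
    apply is_derive_on_plus; auto; [apply is_derive_on_const, Hs |].
    apply (Cm_cyl_Dt T 1); auto. }
  set (th := fun t => comb n (z t) e). set (xi := fun t => comb n (shift n (z t)) e).
  assert (Cth : forall t, cts 0 1 (th t)) by (intros; eapply onb_comb_cts; eauto).
  assert (Cxi : forall t, cts 0 1 (xi t)) by (intros; eapply onb_comb_cts; eauto).
  set (E := fun s => sumn n (fun i => z s i ^ 2)
    + sumn n (fun i => sumn n (fun j => z s (n + i)%nat * z s (n + j)%nat * W i j s))).
  set (dE := fun t => 2 * (- inner (R1 t) (th t) - inner (R2 t) (proj n e (fun x => w t x * xi t x)))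
    + inner (fun x => Dt T eta x t * xi t x) (xi t)).
  assert (DE : dfn 0 T E dE).
  { intros t Ht.
    assert (CR : cts 0 1 (R1 t) /\ cts 0 1 (R2 t)).
    { exact (res_cts r K h V n e Fs Ob beta eta0 u0 Cb Rbc (F t) (G t) (z t) (cut t)
        (CF t Ht O ltac:(lia)) (CF t Ht 1%nat ltac:(lia)) (CG t Ht O ltac:(lia))
        (CG t Ht 1%nat ltac:(lia))). }
    destruct CR as [CR1 CR2].
    assert (CFt := rect_cts_x T _ t Cet Ht).
    unfold dE. replace (2 * (- inner (R1 t) (th t) - inner (R2 t) (proj n e (fun x => w t x * xi t x)))
      + inner (fun x => Dt T eta x t * xi t x) (xi t))
      with (sumn n (fun i => 2 * z t i * - inner (R1 t) (e i)) +
       (2 * sumn n (fun i => - inner (R2 t) (e i) * sumn n (fun j => z t (n + j)%nat * W i j t))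
     + sumn n (fun i => z t (n + i)%nat * sumn n (fun j => z t (n + j)%nat * dW t i j)))).
    - apply is_derive_on_plus; auto.
      + apply is_derive_on_sumn; auto. intros i Hi.
        destruct (Dz t Ht i Hi) as [D1 _].
        replace (2 * z t i * - inner (R1 t) (e i))
          with (- inner (R1 t) (e i) * z t i + z t i * - inner (R1 t) (e i)) by ring.
        apply (is_derive_on_ext 0 T (fun s => z s i * z s i)); auto; [intros; ring |].
        apply (is_derive_on_mult 0 T (fun s => z s i) (fun s => z s i)); auto.
      + apply (quad_form_derivative n T (fun i s => z s (n + i)%nat) (fun i => - inner (R2 t) (e i))
          W (dW t)); auto.
        * intros i Hi; apply Dz; auto.
        * intros i j; apply inner_ext; auto; intros; ring.
    (* Applying W to the coordinates of xi gives the numbers (w xi, e_i), which are the coordinates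
       of P(w xi); this is how that test function arises. *)
    - rewrite (sumn_ext n (fun i => - inner (R2 t) (e i) * sumn n (fun j => z t (n + j)%nat * W i j t))
        (fun i => (-1) * (inner (fun x => w t x * xi t x) (e i) * inner (R2 t) (e i)))).
      2:{ intros i Hi. assert (S := sumn_weight_form n e (shift n (z t)) (w t) Ce (Cw t Ht) i Hi).
          change (sumn n (fun j => z t (n + j)%nat * W i j t)
            = inner (fun x => w t x * xi t x) (e i)) in S. rewrite S. ring. }
      rewrite (sumn_ext n (fun i => z t (n + i)%nat * sumn n (fun j => z t (n + j)%nat * dW t i j))
        (fun i => shift n (z t) i * inner (fun x => Dt T eta x t * xi t x) (e i))).
      2:{ intros i Hi.
          assert (S := sumn_weight_form n e (shift n (z t)) (fun x => Dt T eta x t) Ce CFt i Hi).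
          change (sumn n (fun j => z t (n + j)%nat * dW t i j)
            = inner (fun x => Dt T eta x t * xi t x) (e i)) in S. rewrite S. reflexivity. }
      rewrite (sumn_ext n (fun i => 2 * z t i * - inner (R1 t) (e i))
        (fun i => (-2) * (z t i * inner (R1 t) (e i)))) by (intros; ring).
      rewrite !sumn_scal. unfold proj.
      rewrite <- (inner_comb_r n (z t) e (R1 t)) by auto.
      rewrite <- (inner_comb_r n (fun i => inner (fun x => w t x * xi t x) (e i)) e (R2 t)) by auto.
      rewrite <- (inner_comb_r n (shift n (z t)) e (fun x => Dt T eta x t * xi t x)) by auto with cts.
      fold (th t) (xi t). ring. }
  assert (Nz : forall t, norm2 (n + n) (z t) ^ 2 = inner (th t) (th t) + inner (xi t) (xi t)).
  { intros t. apply (norm2_sq_inner r K h V); auto. }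
  assert (EE : forall t, 0 <= t <= T -> E t = inner (th t) (th t) + inner (fun x => w t x * xi t x) (xi t)).
  { intros t Ht. unfold E. f_equal.
    - destruct Ob as [O1 _]. unfold th; rewrite (inner_comb_comb r K h V) by auto.
      apply sumn_ext; intros; ring.
    - change (xi t) with (comb n (shift n (z t)) e) at 2.
      rewrite (inner_comb_r n (shift n (z t)) e (fun x => w t x * xi t x)) by auto with cts.
      apply sumn_ext; intros i Hi. unfold xi. rewrite <- (sumn_weight_form n e) by auto.
      rewrite <- sumn_scal. apply sumn_ext; intros; unfold shift, W; ring. }
  assert (NE : forall t, 0 <= t <= T -> norm2 (n + n) (z t) ^ 2 <= (1 + / b) * E t).
  { intros t Ht. rewrite Nz, EE by auto.
    assert (Lb : b * inner (xi t) (xi t) <= inner (fun x => w t x * xi t x) (xi t)).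
    { rewrite <- inner_scal_l by auto. apply RInt_cts_le; auto with cts; [lra |].
      intros x Hx. assert (Q := Rd x t Hx Ht). unfold w.
      rewrite !Rmult_assoc. apply Rmult_le_compat_r; [nra | exact Q]. }
    assert (N1 := inner_nonneg _ (Cth t)). assert (N2 := inner_nonneg _ (Cxi t)).
    set (q := inner (fun x => w t x * xi t x) (xi t)) in *.
    assert (inner (xi t) (xi t) <= / b * q).
    { apply (Rmult_le_reg_l b); auto. rewrite <- Rmult_assoc, Rinv_r by lra. lra. }
    assert (0 <= / b * inner (th t) (th t)) by (apply Rmult_le_pos; lra).
    assert (0 <= b * inner (xi t) (xi t)) by (apply Rmult_le_pos; lra). lra. }
  set (hp := h ^ (2 * (r - 1))). assert (Hhp : 0 < hp) by (apply pow_lt; lra).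
  assert (Gr : forall t, 0 <= t <= T -> dE t <= la * E t + 2 * C1 * hp).
  { intros t Ht. destruct (Ro t Ht) as [O1 O2].
    assert (R := ER h V n e Hh Fs Ob (F t) (G t) beta (Derive_on 0 1 beta) eta0 u0
      (DF t Ht) (DG t Ht) Rb Rbc (Re0 t Ht) (Ru0 t Ht)).
    assert (B : forall x, 0 <= x <= 1 -> Rabs (F t r x) <= M /\ Rabs (G t r x) <= M /\
       Rabs (Uf (G t) u0 x) <= M /\ Rabs (wf (F t) beta eta0 x) <= M /\
       Rabs (G t 1%nat x) <= M /\ Rabs (wf' (F t) (Derive_on 0 1 beta) x) <= M).
    { intros x Hx. destruct (RB x t Hx Ht) as [B1 [B2 [B3 [B4 [B5 [B6 _]]]]]].
      repeat split; assumption. }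
    specialize (R B O1).
    assert (W1 : 0 <= wf (F t) beta eta0 1).
    { assert (Q := Rd 1 t ltac:(lra) Ht). unfold wf, F; simpl Dxn. lra. }
    specialize (R W1 O2 (z t)). cbv zeta in R. fold hp in R.
    assert (RR : - inner (R1 t) (th t) - inner (R2 t) (proj n e (fun x => w t x * xi t x))
       <= C1 * norm2 (n + n) (z t) ^ 2 + C1 * hp) by exact R.
    assert (RW : inner (fun x => Dt T eta x t * xi t x) (xi t) <= M * inner (xi t) (xi t)).
    { rewrite <- inner_scal_l by auto. assert (CFt := rect_cts_x T _ t Cet Ht).
      apply RInt_cts_le; auto with cts; [lra |].
      intros x Hx. destruct (RB x t Hx Ht) as [_ [_ [_ [_ [_ [_ B7]]]]]].
      rewrite !Rmult_assoc. apply Rmult_le_compat_r; [nra |].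
      eapply Rle_trans; [apply RRle_abs | exact B7]. }
    assert (N0 := NE t Ht). assert (N1 := inner_nonneg _ (Cth t)). assert (N2 := inner_nonneg _ (Cxi t)).
    assert (Nt := Nz t). unfold dE.
    assert (Q : (2 * C1 + M) * norm2 (n + n) (z t) ^ 2 <= la * E t).
    { unfold la. rewrite Rmult_assoc. apply Rmult_le_compat_l; lra. }
    assert (0 <= M * inner (th t) (th t)) by (apply Rmult_le_pos; auto).
    rewrite Nt in *. lra. }
  (* The discrete initial data are the projections of the exact ones, so all discrete errors vanish
     at t = 0. *)
  assert (E0 : E 0 = 0).
  { assert (Z : forall j, (j < n + n)%nat -> z 0 j = 0).
    { intros j Hj; unfold z. rewrite (proj1 (TS j Hj)). ring. }
    unfold E. rewrite !sumn_zero; [ring | |].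
    - intros i Hi. apply sumn_zero; intros j Hj. rewrite (Z (n + i)%nat) by lia. ring.
    - intros i Hi. rewrite Z by lia. ring. }
  intros t Ht. fold (z t) hp. eapply Rle_trans; [apply NE, Ht |].
  assert (Q := gronwall T E dE la (2 * C1 * hp) Hla DE Gr t Ht). rewrite E0 in Q.
  rewrite !Rmult_assoc. apply Rmult_le_compat_l; [lra |].
  eapply Rle_trans; [exact Q |].
  assert (P : 0 < 2 * C1 * hp / la) by (apply Rdiv_lt_0_compat; auto; nra).
  assert (X : exp (la * t) <= exp (la * T)).
  { destruct (Req_dec t T) as [-> |]; [lra |]. left; apply exp_increasing. nra. }
  assert (E1 := exp_pos (la * t)).
  replace (2 * (C1 * (/ la * (exp (la * T) * hp)))) with (2 * C1 * hp / la * exp (la * T))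
    by (field; lra).
  nra.
Qed.

(** * Existence, uniqueness and convergence *)

Lemma regular_solution_exists r T beta eta0 u0 eta_init u_init eta u a b : (3 <= r)%nat ->
  0 < T -> Cm_on 0 1 1 beta -> Cm_cyl T r eta -> Cm_cyl T r u ->
  solves_ibvp T beta eta0 u0 eta_init u_init eta u -> 0 < a -> 0 < b ->
  (forall x t, 0 <= x <= 1 -> 0 <= t <= T ->
     b <= beta x + eta x t + eta0 /\
     2 * a <= u x t + u0 /\
     beta x + eta x t + eta0 <= (u x t + u0 - a) * (u x t + u0 - 2 * a / 3)) ->
  exists M, 0 <= M /\ regular_solution r T M b beta eta0 u0 eta u.
Proof.
  intros Hr HT Cb Ce Cu [S1 [_ S3]] Ha Hb Cond.
  destruct Cb as [_ [Cb1 [Cb2 _]]].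
  assert (Db : dfn 0 1 beta (Derive_on 0 1 beta)).
  { intros x Hx; apply Derive_on_correct; auto; lra. }
  assert (Cbx : cts 0 1 (Derive_on 0 1 beta)) by (apply continuous_on_cts; auto; lra).
  assert (Cm2 : forall f, Cm_cyl T r f -> Cm_cyl T 2 f)
    by (intros f Hf; apply (Cm_cyl_le T 2 r); auto; lia).
  assert (Bd : forall m f, Cm_cyl T m f ->
    exists M, 0 <= M /\ forall x t, 0 <= x <= 1 -> 0 <= t <= T -> Rabs (f x t) <= M).
  { intros m f Hf; apply rect_cts_bounded; [lra |]. apply (Cm_cyl_rect_cts T m); auto; lra. }
  assert (Dr : forall f, Cm_cyl T r f -> Cm_cyl T 0 (Dxn r f)).
  { intros f Hf; apply Cm_cyl_Dxn. rewrite Nat.add_0_r; auto. }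
  destruct (Bd 0%nat _ (Dr eta Ce)) as [M1 [P1 B1]]. destruct (Bd 0%nat _ (Dr u Cu)) as [M2 [P2 B2]].
  destruct (Bd r u Cu) as [M3 [P3 B3]]. destruct (Bd r eta Ce) as [M4 [P4 B4]].
  assert (De := Cm2 eta Ce). assert (Du := Cm2 u Cu).
  destruct (Bd 1%nat (Defs.Dx u)) as [M5 [P5 B5]]; [apply Du |].
  destruct (Bd 1%nat (Defs.Dx eta)) as [M6 [P6 B6]]; [apply De |].
  destruct (Bd 1%nat (Dt T eta)) as [M7 [P7 B7]]; [apply De |].
  destruct (cts_bounded 0 1 beta) as [M8 [P8 B8]]; [lra | eapply dfn_cts; [lra | eauto] |].
  destruct (cts_bounded 0 1 (Derive_on 0 1 beta)) as [M9 [P9 B9]]; [lra | auto |].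
  assert (Q1 := Rabs_pos u0). assert (Q2 := Rabs_pos eta0).
  exists (M1 + M2 + M3 + M4 + M5 + M6 + M7 + M8 + M9 + Rabs u0 + Rabs eta0).
  split; [lra |]. constructor; auto.
  - intros t Ht; apply S3, Ht.
  - intros t Ht; apply S3, Ht.
  - intros x t Hx Ht.
    specialize (B1 x t Hx Ht). specialize (B2 x t Hx Ht). specialize (B3 x t Hx Ht).
    specialize (B4 x t Hx Ht). specialize (B5 x t Hx Ht). specialize (B6 x t Hx Ht).
    specialize (B7 x t Hx Ht). specialize (B8 x Hx). specialize (B9 x Hx).
    assert (T1 := Rabs_triang (u x t) u0). assert (T2 := Rabs_triang (beta x + eta x t) eta0).
    assert (T3 := Rabs_triang (beta x) (eta x t)).
    assert (T4 := Rabs_triang (Derive_on 0 1 beta x) (Defs.Dx eta x t)).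
    repeat split; lra.
  - intros x t Hx Ht; apply Cond; auto.
  (* With v = u + u0 >= 2a both factors v - a and v - 2a/3 lie between 0 and v, so their product is
     at most v^2. *)
  - intros t Ht. destruct (Cond 1 t ltac:(lra) Ht) as [_ [C2 C3]]. split; [lra |].
    eapply Rle_trans; [exact C3 |]. nra.
  - intros x t Hx Ht. destruct (S1 x t Hx Ht) as [Q _]. eapply eq_trans; [| exact Q].
    assert (E : Defs.Dx (fun y s => eta y s * u y s) x t
      = Defs.Dx eta x t * u x t + eta x t * Defs.Dx u x t).
    { apply Derive_on_eq; [lra | auto |].
      apply (is_derive_on_mult 0 1 (fun y => eta y t) (fun y => u y t)); auto.
      - apply (Cm_cyl_Dx T 1 eta t); auto.
      - apply (Cm_cyl_Dx T 1 u t); auto. }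
    rewrite E. ring.
  - intros x t Hx Ht. destruct (S1 x t Hx Ht) as [_ Q]. exact Q.
Qed.

Lemma L2norm_le f B : 0 <= B -> inner f f <= B ^ 2 -> L2norm f <= B.
Proof.
  intros HB H; unfold L2norm. rewrite <- (sqrt_pow2 B HB). apply sqrt_le_1_alt, H.
Qed.

Theorem proposition2p2 :
  forall r : nat, (3 <= r)%nat ->
  exists K : nat, (* the smoothness order that suffices for given r *)
  forall (T : R) (beta : R -> R) (eta0 u0 : R) (eta_init u_init : R -> R)
         (eta u : R -> R -> R) (a b c : R),
  0 < T ->
  Cm_on 0 1 1 beta ->
  (forall x, 0 <= x <= 1 -> 0 < beta x) ->
  (forall x, 0 <= x <= 1 -> 0 < beta x + eta0) ->
  0 < u0 ->
  (forall x, 0 <= x <= 1 -> sqrt (beta x + eta0) < u0) ->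
  Cm_cyl T K eta ->
  Cm_cyl T K u ->
  solves_ibvp T beta eta0 u0 eta_init u_init eta u ->
  0 < a ->
  0 < b ->
  (forall x t, 0 <= x <= 1 -> 0 <= t <= T ->
     b <= beta x + eta x t + eta0 /\
     2 * a <= u x t + u0 /\
     beta x + eta x t + eta0 <= (u x t + u0 - a) * (u x t + u0 - 2 * a / 3)) ->
  exists h0 C : R, 0 < h0 /\
  forall (N : nat) (xs : nat -> R),
  partition01 N xs ->
  quasiuniform c N xs ->
  mesh_size xs N <= h0 ->
  exists etah uh : R -> R -> R,
    solves_semidiscrete T beta eta0 u0 eta_init u_init r N xs etah uh /\
    (forall etah' uh' : R -> R -> R,
       solves_semidiscrete T beta eta0 u0 eta_init u_init r N xs etah' uh' ->
       forall x t, 0 <= x <= 1 -> 0 <= t <= T ->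
         etah' x t = etah x t /\ uh' x t = uh x t) /\
    (forall t, 0 <= t <= T ->
       L2norm (fun x => eta x t - etah x t) + L2norm (fun x => u x t - uh x t)
         <= C * mesh_size xs N ^ (r - 1)).
Proof.
  (* Approximation of order h^r takes r derivatives in x; the derivatives in t that occur are of
     first order. *)
  intros r Hr. exists r.
  intros T beta eta0 u0 eta_init u_init eta u a b c HT Cb _ _ _ _ Ce Cu Sol Ha Hb Cond.
  destruct (regular_solution_exists r T beta eta0 u0 eta_init u_init eta u a b Hr HT Cb Ce Cu Sol
    Ha Hb Cond) as [M [HM RS]].
  destruct (Sh_fem_space r c Hr) as [K [HK Fem]].
  destruct (semidiscrete_error r K M b T Hr HK HM Hb HT) as [C1 [HC1 SE]].
  destruct (proj_error r K M Hr HK HM) as [C2 [HC2 PE]].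
  assert (HCK : 0 < C1 * K) by (apply Rmult_lt_0_compat; auto).
  (* The squared error is at most twice the projection part, with C2, plus twice the discrete part,
     with C1. The final constant is 2 B because two norms are added. *)
  set (B := sqrt (2 * C2 + 2 * C1)). assert (HB : 0 <= B) by apply sqrt_pos.
  assert (B2 : B ^ 2 = 2 * C2 + 2 * C1) by (apply pow2_sqrt; lra).
  (* The second bound on h gives C1 h^4 <= h^3/K, so the discrete error stays inside the ball of the
     cutoff. *)
  exists (Rmin 1 (/ (C1 * K))), (2 * B).
  split; [apply Rmin_pos; [lra | apply Rinv_0_lt_compat, HCK] |].
  intros N xs P Q Hmesh.
  destruct (Fem N xs P Q) as [Hh Fs].
  set (h := mesh_size xs N) in *. set (V := Sh r N xs) in *.
  assert (Hh1 : h <= 1) by (eapply Rle_trans; [exact Hmesh | apply Rmin_l]).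
  assert (HhC : h <= / (C1 * K)) by (eapply Rle_trans; [exact Hmesh | apply Rmin_r]).
  destruct (fem_basis r K h V Hh HK Fs) as [n [e Ob]].
  assert (Rb := rs_beta _ _ _ _ _ _ _ _ _ RS). assert (Cbx := rs_beta_cts _ _ _ _ _ _ _ _ _ RS).
  assert (Cbeta : cts 0 1 beta) by (eapply dfn_cts; [lra | eauto]).
  assert (Cei : forall i, (i < n)%nat -> cts 0 1 (e i)) by (intros; eapply onb_cts; eauto).
  set (rad := sqrt (h ^ 3 / K)).
  assert (h3 : 0 < h ^ 3) by (apply pow_lt; lra).
  assert (hK : 0 < h ^ 3 / K) by (apply Rdiv_lt_0_compat; auto).
  assert (Hrad : 0 < rad) by (apply sqrt_lt_R0, hK).
  assert (Dp : forall t, 0 <= t <= T -> forall i, (i < n)%nat ->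
    is_derive_on 0 T (sd_proj n e eta u i) t (inner (fun x => Dt T eta x t) (e i)) /\
    is_derive_on 0 T (sd_proj n e eta u (n + i)) t (inner (fun x => Dt T u x t) (e i))).
  { intros t Ht; apply (sd_proj_derive n e T r); auto; lia. }
  assert (Lf : forall k, (k < n + n)%nat -> linform (n + n) (sd_l n e beta eta0 u0 k))
    by (intros; eapply sd_l_linform; eauto).
  assert (Qf : forall k, (k < n + n)%nat -> bilform (n + n) (sd_q n e k))
    by (intros; eapply sd_q_bilform; eauto).
  destruct (truncated_ode (n + n) (sd_c n e beta u0) (sd_l n e beta eta0 u0) (sd_q n e)
    (sd_proj n e eta u) rad T (fun i => sd_proj n e eta u i 0)) as [Y HY]; auto; [lra | |].
  { intros j Hj. destruct (Nat.lt_ge_cases j n) as [H | H].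
    - apply (dfn_cts 0 T _ (fun t => inner (fun x => Dt T eta x t) (e j))); [lra |].
      intros t Ht; exact (proj1 (Dp t Ht j H)).
    - replace j with (n + (j - n))%nat by lia.
      apply (dfn_cts 0 T _ (fun t => inner (fun x => Dt T u x t) (e (j - n)%nat))); [lra |].
      intros t Ht; exact (proj2 (Dp t Ht (j - n)%nat ltac:(lia))). }
  assert (Err := SE h V n e (conj Hh Hh1) Fs Ob beta eta0 u0 eta u Y RS HY).
  set (z := fun t j => sd_proj n e eta u j t - Y j t) in *.
  set (y := h ^ (r - 1)). assert (Hy : 0 < y) by (apply pow_lt; lra).
  assert (Ey : h ^ (2 * (r - 1)) = y ^ 2) by (unfold y; rewrite <- pow_mult; f_equal; lia).
  assert (Cut : forall t, 0 <= t <= T -> cutoff (n + n) rad (z t) = 1).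
  { intros t Ht. apply cutoff_one; auto. unfold rad.
    rewrite <- (sqrt_pow2 (norm2 (n + n) (z t))) by apply sqrt_pos.
    apply sqrt_le_1_alt. eapply Rle_trans; [apply (Err t Ht) |].
    (* Here r >= 3 is decisive: beyond h^3 a full factor h remains, and it absorbs C1 K. *)
    replace (2 * (r - 1))%nat with (3 + (1 + (2 * r - 6)))%nat by lia.
    rewrite !pow_add, pow_1.
    assert (H1 : h ^ (2 * r - 6) <= 1) by (rewrite <- (pow1 (2 * r - 6)); apply pow_incr; lra).
    assert (H0 : 0 < h ^ (2 * r - 6)) by (apply pow_lt; lra).
    assert (H2 : C1 * K * h <= 1).
    { apply (Rmult_le_compat_l (C1 * K)) in HhC; [| lra]. rewrite Rinv_r in HhC; lra. }
    apply (Rmult_le_reg_r K); auto.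
    replace (h ^ 3 / K * K) with (h ^ 3) by (field; lra).
    replace (C1 * (h ^ 3 * (h * h ^ (2 * r - 6))) * K)
      with (h ^ 3 * ((C1 * K * h) * h ^ (2 * r - 6))) by ring.
    rewrite <- (Rmult_1_r (h ^ 3)) at 2. apply Rmult_le_compat_l; [lra |].
    rewrite <- (Rmult_1_r 1). apply Rmult_le_compat; try lra.
    apply Rmult_le_pos; lra. }
  (* With the cutoff equal to 1 the correction term has the factor 1 - 1^2 = 0, so the truncated
     solution solves the original system. *)
  assert (SY : sd_solution n e beta eta0 u0 T Y).
  { intros k t Hk Ht yt. destruct (HY k Hk) as [_ D]. specialize (D t Ht).
    cbv zeta in D. fold (z t) in D. rewrite (Cut t Ht) in D.
    apply (is_derive_on_of_is_derive 0 T _ (Y k)); auto.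
    replace (sd_c n e beta u0 k + sd_l n e beta eta0 u0 k yt + sd_q n e k yt yt)
      with (sd_c n e beta u0 k + sd_l n e beta eta0 u0 k (fun j => Y j t) +
        (sd_q n e k (fun j => Y j t) (fun j => Y j t) - (1 - 1 ^ 2) * sd_q n e k (z t) (z t)));
      [exact D | unfold yt; ring]. }
  destruct Sol as [_ [Init _]].
  assert (Hy0 : forall k, (k < n)%nat -> Y k 0 = inner (fun x => eta_init x - eta0) (e k) /\
     Y (n + k)%nat 0 = inner (fun x => u_init x - u0) (e k)).
  { intros k Hk. rewrite (proj1 (HY k ltac:(lia))), (proj1 (HY (n + k)%nat ltac:(lia))).
    rewrite sd_proj1, sd_proj2 by auto.
    split; apply inner_ext; auto; intros x Hx; apply Init; auto. }
  assert (Cinit : cts 0 1 (fun x => eta_init x - eta0) /\ cts 0 1 (fun x => u_init x - u0)).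
  { split; [apply (cts_ext 0 1 (fun x => eta x 0)) | apply (cts_ext 0 1 (fun x => u x 0))];
      try lra; try (intros x Hx; apply Init, Hx);
      (apply (rect_cts_x T); [apply (Cm_cyl_rect_cts T r); auto |]; lra). }
  destruct Cinit as [Ci1 Ci2].
  assert (HV : forall f, V f <-> Sh r N xs f) by (intros; reflexivity).
  exists (fun x t => comb n (fun j => Y j t) e x), (fun x t => comb n (shift n (fun j => Y j t)) e x).
  split; [| split].
  - apply (semidiscrete_of_coords r K h V n e Fs Ob beta eta0 u0 Cbeta Cbx T eta_init u_init N xs Y);
      auto.
  - intros etah' uh' S' x t Hx Ht.
    destruct (coords_of_semidiscrete r K h V n e Fs Ob beta eta0 u0 Cbeta Cbx T eta_init u_init N xs
      etah' uh' HT HV S') as [Y' [SY' [Y0' EY']]].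
    assert (U : forall i s, (i < n + n)%nat -> 0 <= s <= T -> Y' i s = Y i s).
    { apply (quadratic_ode_unique (n + n) (sd_c n e beta u0) (sd_l n e beta eta0 u0) (sd_q n e)); auto.
      intros i Hi. destruct (Nat.lt_ge_cases i n) as [H | H].
      - rewrite (proj1 (Y0' i H)), (proj1 (Hy0 i H)); auto.
      - replace i with (n + (i - n))%nat by lia.
        rewrite (proj2 (Y0' (i - n)%nat ltac:(lia))), (proj2 (Hy0 (i - n)%nat ltac:(lia))); auto. }
    destruct (EY' x t Hx Ht) as [-> ->].
    split; apply comb_ext; intros; unfold shift; apply U; auto; lia.
  - intros t Ht.
    assert (Cm1 : forall f, Cm_cyl T r f -> Cm_cyl T 1 f)
      by (intros f Hf; apply (Cm_cyl_le T 1 r); auto; lia).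
    (* One argument for both components: f - f_h is the projection error plus the discrete error
       with coordinates zz. *)
    assert (Part : forall (f : R -> R -> R) (zz yy : nat -> R), Cm_cyl T r f -> f 0 t = 0 ->
      (forall x, 0 <= x <= 1 -> Rabs (Dxn r f x t) <= M) ->
      (forall i, (i < n)%nat -> yy i + zz i = inner (fun x => f x t) (e i)) ->
      inner (comb n zz e) (comb n zz e) <= C1 * y ^ 2 ->
      L2norm (fun x => f x t - comb n yy e x) <= B * y).
    { intros f zz yy Cf f0 Bf Eyz Hzz. apply L2norm_le; [nra |].
      assert (DF : forall j, (j < r)%nat -> dfn 0 1 (fun x => Dxn j f x t) (fun x => Dxn (S j) f x t)).
      { intros j Hj; apply (Cm_cyl_Dxn_derive T r); auto. }
      assert (CF1 : cts 0 1 (fun x => Dxn 1 f x t)) by (eapply dfn_cts; [lra | apply (DF 1%nat); lia]).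
      destruct (PE h V n e (conj Hh Hh1) Fs Ob (fun j x => Dxn j f x t) DF f0 CF1 Bf) as [E1 _].
      cbv zeta in E1. rewrite Ey in E1.
      change (fun x => Dxn 0 f x t) with (fun x => f x t) in E1.
      set (pf := comb n (fun i => inner (fun x => f x t) (e i)) e) in *.
      assert (Cp : cts 0 1 pf) by (eapply onb_comb_cts; eauto).
      assert (Cz : cts 0 1 (comb n zz e)) by (eapply onb_comb_cts; eauto).
      assert (Cft : cts 0 1 (fun x => f x t)) by (eapply dfn_cts; [lra | apply (DF O); lia]).
      assert (Eq : forall x, 0 <= x <= 1 ->
        f x t - comb n yy e x = (f x t - pf x) + comb n zz e x).
      { intros x Hx. unfold pf, comb.
        assert (S : sumn n (fun i => inner (fun x => f x t) (e i) * e i x)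
          = sumn n (fun i => yy i * e i x) + sumn n (fun i => zz i * e i x)).
        { rewrite <- sumn_plus. apply sumn_ext; intros i Hi. rewrite <- Eyz by auto. ring. }
        rewrite S. ring. }
      rewrite (inner_ext _ _ (fun x => (f x t - pf x) + comb n zz e x)
        (fun x => (f x t - pf x) + comb n zz e x)) by auto.
      eapply Rle_trans; [apply inner_sum_sq; auto with cts |].
      rewrite Rpow_mult_distr, B2. change (Dxn 0 f) with f in E1. lra. }
    assert (Nz := norm2_sq_inner r K h V n e (z t) Fs Ob).
    assert (Ez := Err t Ht). rewrite Ey in Ez. fold (z t) in Ez. rewrite Nz in Ez.
    assert (N1 := inner_nonneg (comb n (z t) e) ltac:(eapply onb_comb_cts; eauto)).
    assert (N2 := inner_nonneg (comb n (shift n (z t)) e) ltac:(eapply onb_comb_cts; eauto)).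
    assert (L1 : L2norm (fun x => eta x t - comb n (fun j => Y j t) e x) <= B * y).
    { apply (Part eta (z t)); auto; [apply (rs_eta_0 _ _ _ _ _ _ _ _ _ RS t Ht) | | | lra].
      - intros x Hx; apply (rs_bounds _ _ _ _ _ _ _ _ _ RS x t Hx Ht).
      - intros i Hi; unfold z. rewrite sd_proj1 by auto. ring. }
    assert (L2 : L2norm (fun x => u x t - comb n (shift n (fun j => Y j t)) e x) <= B * y).
    { apply (Part u (shift n (z t))); auto;
        [apply (rs_u_0 _ _ _ _ _ _ _ _ _ RS t Ht) | | | lra].
      - intros x Hx; apply (rs_bounds _ _ _ _ _ _ _ _ _ RS x t Hx Ht).
      - intros i Hi; unfold z, shift. rewrite sd_proj2. ring. }
    fold y. lra.
Qed.
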